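(* Let $G$ be an oriented graph in $\mathcal{GC}_3$ with $m$ edges and loop number $\ell$, and let $\omega$ be a homogeneous polynomial of degree $m-\ell-1$ in the canonical forms $\beta^{4k+1}$, $k\ge1$. Then the integral $$I_G(\omega)=\frac{1}{(-2\pi)^{\ell/2}}\int_{\sigma_G}\omega_G\wedge\phi_G$$ is absolutely convergent, and $G\mapsto I_G(\omega)$ defines a linear function $I(\omega):\mathcal{GC}_3\to\mathbb R$.
   Context: **Graph complex.** A graph $G$ consists of finite sets of vertices $V(G)$, edges $E(G)$ and half-edges $H(G)$; each edge $e$ consists of two half-edges $H(e)=\{e',e''\}$, and each half-edge is incident to one vertex (multiple edges and self-loops allowed). For a free $\mathbb Z$-module $M$ of rank $r$ write $\det M=\bigwedge^rM$. An orientation of $G$ is a generator of $\det\mathbb Z^{V(G)}\otimes\bigotimes_e\det\mathbb Z^{H(e)}\cong\mathbb Z$. $\mathcal{GC}_3$ is the $\mathbb Q$-vector space spanned by pairs $(G,o)$ of a connected graph with all vertices of valency $\ge3$ and an orientation, modulo $(G,o)\sim(G',\varphi_*o)$ for isomorphisms $\varphi:G\cong G'$ and $(G,-o)\sim-(G,o)$. The loop number is $\ell=|E(G)|-|V(G)|+1$, the rank of $H_1(G)$. **Orientations via cycles.** For connected $G$ with $m$ edges there is a canonical isomorphism of $\det\mathbb Z^{V(G)}\otimes\bigotimes_e\det\mathbb Z^{H(e)}$ with $\det\mathbb Z^{E(G)}\otimes\det H_1(G)$: $v_1\wedge\dots\wedge v_n\otimes\bigotimes_eo_e$ corresponds to $(\det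 A)\cdot e_1\wedge\dots\wedge e_m\otimes C_1\wedge\dots\wedge C_\ell$, where $A\in\mathrm{GL}_m(\mathbb Z)$ has columns $C_1,\dots,C_\ell,P_2,\dots,P_n$ written in the basis $o_{e_1},\dots,o_{e_m}$ of 1-chains, $P_i$ being any 1-chain with boundary $v_i-v_1$ (an edge with $o_e=e'\wedge e''$ is directed from the endpoint of $e'$ to that of $e''$; boundary = head minus tail). **Forms.** On positive definite symmetric $\ell\times\ell$ matrices $X$: $\beta^{4k+1}=\mathrm{tr}((X^{-1}dX)^{4k+1})$; $\phi^\ell=\mathrm{Pf}(dX\cdot X^{-1}\cdot dX)/\sqrt{\det X}$ for $\ell$ even (Pf is the Pfaffian), and $\phi^\ell=0$ for $\ell$ odd. Let $(G,o)$ be oriented with $o=e_1\wedge\dots\wedge e_m\otimes C_1\wedge\dots\wedge C_\ell$, where $\mathcal C=(C_1,\dots,C_\ell)$ is a basis of $H_1(G)\subset\mathbb Z^m$, viewed as an $m\times\ell$ matrix. Put $\Lambda_{\mathcal C}(x)=\mathcal C^{T}\mathrm{diag}(x_1,\dots,x_m)\mathcal C$. Then $\omega_G$ and $\phi_G$ are the pullbacks of $\omega$ and $\phi^\ell$ along $x\mapsto\Lambda_{\mathcal C}(x)$; they descend to the open simplex $\sigma_G=\{[x_1:\dots:x_m]:x_i>0\}\subset\mathbb P(\mathbb R^m)$, oriented by $\sum_{i}(-1)^{i-1}x_i\,dx_1\wedge\cdots\widehat{dx_i}\cdots\wedge dx_m$. If $\deg\omega+\ell\neq m-1$, one sets $I_G(\omega)=0$.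 *)

(* Defs.v *)
From HB Require Import structures.
From mathcomp Require Import all_boot all_order all_algebra perm.
From mathcomp Require Import ring.

Set Implicit Arguments.
Unset Strict Implicit.
Unset Printing Implicit Defensive.

Import Order.TTheory GRing.Theory Num.Theory.

Local Open Scope ring_scope.

(* [ext R m] is the exterior algebra over R on the generators dx_0, ...,
   dx_(m-1).  An element is given by its coefficients in the basis
   dx_S = dx_(i_1) /\ ... /\ dx_(i_k), where S = {i_1 < ... < i_k}. *)
Definition ext (R : Type) (m : nat) : Type := {ffun {set 'I_m} -> R}.

Section ExteriorAlgebra.
Variables (R : comNzRingType) (m : nat).
Local Notation E := (ext R m).
Implicit Types (A B S : {set 'I_m}) (a b c : E).

HB.instance Definition _ := GRing.Lmodule.copy E {ffun {set 'I_m} -> R^o}.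

(* dx_A /\ dx_B = (-1)^(inversions A B) dx_(A :|: B) for disjoint A and B *)
Definition inversions A B : nat :=
  (\sum_(i in A) \sum_(j in B) (j < i))%N.

Definition wedge a b : E :=
  [ffun S : {set 'I_m} => \sum_(A : {set 'I_m} | A \subset S)
      (-1) ^+ inversions A (S :\: A) * (a A * b (S :\: A))].

Definition ext1 : E := [ffun S : {set 'I_m} => (S == set0)%:R].

Definition dx (i : 'I_m) : E := [ffun S : {set 'I_m} => (S == set1 i)%:R].

Lemma inversionsUl A B S : [disjoint A & B] ->
  inversions (A :|: B) S = (inversions A S + inversions B S)%N.
Proof.
move=> dAB; rewrite /inversions -bigU //.
by apply: eq_bigl => i; rewrite !inE.
Qed.

Lemma inversionsUr S A B : [disjoint A & B] ->
  inversions S (A :|: B) = (inversions S A + inversions S B)%N.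
Proof.
move=> dAB; rewrite /inversions -big_split /=.
apply: eq_bigr => i _; rewrite -bigU //.
by apply: eq_bigl => j; rewrite !inE.
Qed.

Fact wedgeA : associative wedge.
Proof.
move=> a b c; apply/ffunP=> S; rewrite !ffunE.
under eq_bigr => A sAS.
  rewrite ffunE 2!mulr_sumr; over.
under [RHS]eq_bigr => D sDS.
  rewrite ffunE mulr_suml mulr_sumr; over.
rewrite [RHS](exchange_big_dep (fun A => A \subset S)) /=; last first.
  by move=> D A sDS sAD; apply: subset_trans sAD sDS.
apply: eq_bigr => A sAS.
rewrite [RHS](reindex_onto (fun B => A :|: B) (fun D => D :\: A)) /=; last first.
  move=> D /andP[_ sAD]; apply/setP=> i; rewrite !inE.
  by case: (boolP (i \in A)) => //= /(subsetP sAD) ->.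
apply: eq_big => [B|B sB].
  rewrite setDUl setDv set0U subUset sAS subsetUl /=.
  rewrite andbT subsetD; apply: andb_id2l => _.
  by apply/idP/eqP => [dB|/setDidPl//]; apply/setDidPl.
have /andP[sBS dBA] : (B \subset S) && [disjoint B & A] by rewrite -subsetD.
have dAB : [disjoint A & B] by rewrite disjoint_sym.
have -> : (A :|: B) :\: A = B.
  by rewrite setDUl setDv set0U; apply/setDidPl.
rewrite setDDl.
set T := S :\: (A :|: B).
have -> : S :\: A = B :|: T.
  apply/setP=> i; rewrite !inE.
  have := subsetP sBS i; have := disjointFr dBA (x := i).
  case: (i \in B) => [/(_ isT) -> /(_ isT) ->|_ _] //=.
  by rewrite orbF.
have dBT : [disjoint B & T].
  by rewrite /T -setI_eq0; apply/eqP/setP=> i; rewrite !inE;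
     case: (i \in B); rewrite /= ?orbT.
rewrite inversionsUr // inversionsUl // !exprD.
by ring.
Qed.

Lemma inversions0l A : inversions set0 A = 0%N.
Proof. by rewrite /inversions big_set0. Qed.

Lemma inversions0r A : inversions A set0 = 0%N.
Proof. by rewrite /inversions big1 // => i _; rewrite big_set0. Qed.

Fact wedge1l : left_id ext1 wedge.
Proof.
move=> a; apply/ffunP=> S; rewrite ffunE (bigD1 set0) ?sub0set //=.
rewrite setD0 inversions0l expr0 mul1r ffunE eqxx mul1r big1 ?addr0 //.
by move=> A /andP[_ /negbTE A0]; rewrite ffunE A0 mul0r mulr0.
Qed.

Fact wedge1r : right_id ext1 wedge.
Proof.
move=> a; apply/ffunP=> S; rewrite ffunE (bigD1 S) //=.
rewrite setDv inversions0r expr0 mul1r ffunE eqxx mulr1 big1 ?addr0 //.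
move=> A /andP[sAS nAS]; rewrite ffunE setD_eq0.
suff /negbTE -> : ~~ (S \subset A) by rewrite !mulr0.
by apply: contra nAS => sSA; rewrite eqEsubset sAS.
Qed.

Fact wedgeDl : left_distributive wedge +%R.
Proof.
move=> a b c; apply/ffunP=> S; rewrite !ffunE -big_split /=.
by apply: eq_bigr => A _; rewrite ffunE mulrDl mulrDr.
Qed.

Fact wedgeDr : right_distributive wedge +%R.
Proof.
move=> a b c; apply/ffunP=> S; rewrite !ffunE -big_split /=.
by apply: eq_bigr => A _; rewrite ffunE !mulrDr.
Qed.

Fact ext1_neq0 : ext1 != 0.
Proof.
by apply/eqP=> /ffunP/(_ set0)/eqP; rewrite !ffunE eqxx oner_eq0.
Qed.

HB.instance Definition _ := GRing.Zmodule_isNzRing.Build E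
  wedgeA wedge1l wedge1r wedgeDl wedgeDr ext1_neq0.

Fact wedgeZl (k : R) a b : k *: (a * b) = (k *: a) * b.
Proof.
apply/ffunP=> S; rewrite !ffunE scaler_sumr; apply: eq_bigr => A _.
by rewrite ffunE /GRing.scale /= mulrCA !mulrA.
Qed.

HB.instance Definition _ := GRing.Lmodule_isLalgebra.Build R E wedgeZl.

Fact wedgeZr (k : R) a b : k *: (a * b) = a * (k *: b).
Proof.
apply/ffunP=> S; rewrite !ffunE scaler_sumr; apply: eq_bigr => A _.
by rewrite ffunE /GRing.scale /= mulrCA; congr (_ * _); rewrite mulrCA.
Qed.

HB.instance Definition _ := GRing.Lalgebra_isAlgebra.Build R E wedgeZr.

End ExteriorAlgebra.

From mathcomp Require Import all_classical all_reals all_analysis.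
From mathcomp Require Import freeg.

Import numFieldNormedType.Exports.
Local Open Scope classical_set_scope.

Section LebesgueTuple.
Variable R : realType.

Definition tuple_cons n (p : measurableTypeR R * n.-tuple R) : n.+1.-tuple R :=
  [tuple of p.1 :: p.2].

Lemma measurable_tuple_cons n : measurable_fun [set: _] (@tuple_cons n).
Proof. exact: measurable_cons. Qed.

Section Step.
Variables (n : nat) (mu : {sigma_finite_measure set (n.-tuple R) -> \bar R}).

Let prod : {measure set (measurableTypeR R * n.-tuple R)%type -> \bar R} :=
  (@lebesgue_measure R \x mu)%E : set (measurableTypeR R * n.-tuple R)%type -> \bar R.

Definition lebesgue_cons : set (n.+1.-tuple R) -> \bar R :=
  pushforward (@lebesgue_measure R \x mu)%E (@tuple_cons n).

Let lebesgue_cons0 : lebesgue_cons set0 = 0%E.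
Proof. by rewrite /lebesgue_cons /pushforward preimage_set0 (measure0 prod). Qed.

Let lebesgue_cons_ge0 A : (0 <= lebesgue_cons A)%E.
Proof. exact: (measure_ge0 prod). Qed.

Let lebesgue_cons_sigma_additive : semi_sigma_additive lebesgue_cons.
Proof.
move=> F mF tF mUF; rewrite /lebesgue_cons /pushforward preimage_bigcup.
apply: (measure_semi_sigma_additive (s := prod)).
- by move=> k; rewrite -[X in measurable X]setTI; exact: measurable_tuple_cons.
- apply/trivIsetP => i j _ _ ij; rewrite -preimage_setI.
  by move/trivIsetP : tF => /(_ _ _ _ _ ij) -> //; rewrite preimage_set0.
- rewrite -preimage_bigcup -[X in measurable X]setTI.
  exact: measurable_tuple_cons.
Qed.

HB.instance Definition _ := isMeasure.Build _ _ _ lebesgue_cons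
  lebesgue_cons0 lebesgue_cons_ge0 lebesgue_cons_sigma_additive.

Let lebesgue_cons_sigma_finite : sigma_finite setT lebesgue_cons.
Proof.
have /sigma_finiteP[F [FT ndF Foo]] := sigma_finiteT (@lebesgue_measure R).
have /sigma_finiteP[G [GT ndG Goo]] := sigma_finiteT mu.
pose uncons (t : n.+1.-tuple R) : measurableTypeR R * n.-tuple R :=
  (thead t, [tuple of behead t]).
have consK p : uncons (tuple_cons p) = p.
  by case: p => x t; congr pair; exact: val_inj.
have muncons : measurable_fun setT uncons.
  apply/measurable_fun_pairP; split; first exact: measurable_tnth.
  exact: measurable_behead.
exists (fun k => uncons @^-1` (F k `*` G k)).
  apply/esym; rewrite -subTset => t _.
  have [i _ Fi] : (\bigcup_k F k) (thead t) by rewrite -FT.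
  have [j _ Gj] : (\bigcup_k G k) [tuple of behead t] by rewrite -GT.
  exists (maxn i j) => //; split => /=.
    by move: Fi; apply/subsetPset/ndF/leq_maxl.
  by move: Gj; apply/subsetPset/ndG/leq_maxr.
move=> k; have [mF Fk] := Foo k; have [mG Gk] := Goo k; split.
  by rewrite -[X in measurable X]setTI; apply: muncons => //; exact: measurableX.
rewrite /lebesgue_cons /pushforward -comp_preimage.
rewrite (_ : uncons \o _ = id) ?preimage_id; last first.
  by apply/funext => p; exact: consK.
by rewrite product_measure1E// lte_mul_pinfty// ge0_fin_numE.
Qed.

HB.instance Definition _ := Measure_isSigmaFinite.Build _ _ _ lebesgue_cons
  lebesgue_cons_sigma_finite.

End Step.

(* [lebesgue_tuple n] is the n-fold product of the Lebesgue measure of R,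
   transported from iterated pairs to tuples; for n = 0 it is the unit mass
   on the empty tuple. *)
Fixpoint lebesgue_tuple n : {sigma_finite_measure set (n.-tuple R) -> \bar R} :=
  if n is n'.+1 then lebesgue_cons (lebesgue_tuple n')
  else \d_[tuple of [::]].

End LebesgueTuple.

(* A differential form in X = (X_ij) is evaluated at a pair (X, dX), where
   dX is a matrix with entries in an algebra A; A is the exterior algebra of
   the coordinate differentials in all uses below. *)
Section Forms.
Variables (R : realType) (A : algType R) (n : nat).
Implicit Types (X : 'M[R]_n) (dX : 'M[A]_n).

Definition scalars X : 'M[A]_n := map_mx (in_alg A) X.

(* The index is k: this is the form of degree 4k+1. *)
Definition beta k X dX : A :=
  \tr ((scalars (invmx X) *m dX) ^+ (4 * k + 1)).

Fact pfaffian_even_lt (i : 'I_n./2) : (i.*2 < n)%N.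
Proof.
apply: (@leq_trans n./2.*2); first by rewrite ltn_double.
by rewrite -[leqRHS](odd_double_half n) leq_addl.
Qed.

Fact pfaffian_odd_lt (i : 'I_n./2) : (i.*2.+1 < n)%N.
Proof.
apply: (@leq_trans n./2.*2); first by rewrite -doubleS leq_double.
by rewrite -[leqRHS](odd_double_half n) leq_addl.
Qed.

(* Only meaningful for n even and a skew-symmetric M with commuting entries *)
Definition pfaffian (M : 'M[A]_n) : A :=
  (2 ^+ n./2 * (n./2)`!%:R)^-1 *:
  \sum_(s : 'S_n) (-1) ^+ s *
    \prod_(i < n./2) M (s (Ordinal (pfaffian_even_lt i)))
                       (s (Ordinal (pfaffian_odd_lt i))).

Definition phi X dX : A :=
  if odd n then 0
  else (Num.sqrt (\det X))^-1 *: pfaffian (dX *m scalars (invmx X) *m dX).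

End Forms.

(* A polynomial in the graded-commutative symbols beta^(4k+1), written as a
   list of terms: (c, [:: k_1; ...; k_r]) stands for
   c * beta^(4k_1+1) /\ ... /\ beta^(4k_r+1). *)
Definition canonical_poly (R : Type) : Type := seq (R * seq nat).

Definition homogeneous (R : Type) (d : nat) (w : canonical_poly R) : bool :=
  all (fun t => all (leq 1) t.2 &&
                ((\sum_(k <- t.2) (4 * k + 1))%N == d)) w.

Definition eval_canonical (R : realType) (A : algType R) (n : nat)
    (w : canonical_poly R) (X : 'M[R]_n) (dX : 'M[A]_n) : A :=
  \sum_(t <- w) t.1 *: \prod_(k <- t.2) beta k X dX.

(* A graph with vertices 'I_n and edges 'I_m.  The half-edges of the edge e
   are e' = (e, false) and e'' = (e, true); the graph maps each half-edge to
   its incident vertex.  Every finite graph is isomorphic to one of these. *)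
Definition graph (n m : nat) : Type := {ffun 'I_m * bool -> 'I_n}.

Section Graphs.
Variables n m : nat.
Implicit Types G : graph n m.

Definition adjacent G : rel 'I_n :=
  [rel u v | [exists h : 'I_m * bool, (G h == u) && (G (h.1, ~~ h.2) == v)]].

Definition connected_graph G : bool :=
  (0 < n)%N && [forall u, forall v, connect (adjacent G) u v].

Definition valency G (v : 'I_n) : nat := #|[pred h | G h == v]|.

Definition admissible G : bool :=
  connected_graph G && [forall v, (3 <= valency G v)%N].

(* m - n + 1; the subtraction does not truncate when the graph is connected *)
Definition loop_number G : nat := (m.+1 - n)%N.

Record graph_iso G G' := GraphIso {
  iso_vertex : {perm 'I_n};
  iso_edge : {perm 'I_m};
  iso_half : {perm 'I_m * bool};
  iso_half_edge : forall h, (iso_half h).1 = iso_edge h.1;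
  iso_incidence : forall h, G' (iso_half h) = iso_vertex (G h) }.

(* An orientation of G is a generator of det Z^V (x) (x)_e det Z^H(e).  It is
   encoded by its sign (true for -1) relative to the generator
   v_1 /\ ... /\ v_n (x) (x)_e (e' /\ e'') given by the numbering of the
   vertices and of the two half-edges of each edge.  In these bases the map
   induced by an isomorphism is the following sign. *)
Definition iso_sign G G' (f : graph_iso G G') : bool :=
  odd_perm (iso_vertex f) (+)
  odd #|[pred e : 'I_m | (iso_half f (e, false)).2]|.

(* Boundary of 1-chains in the basis o_e = e' /\ e'': the edge e is directed
   from the endpoint of e' to the endpoint of e''. *)
Definition boundary G : 'M[int]_(n, m) :=
  \matrix_(v, e) ((G (e, true) == v)%:R - (G (e, false) == v)%:R).

(* The columns of C form a basis of H_1(G) = ker (boundary G) *)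
Definition cycle_basis G (C : 'M[int]_(m, loop_number G)) : Prop :=
  boundary G *m C = 0 /\
  forall c : 'cV[int]_m, boundary G *m c = 0 ->
    exists! z : 'cV[int]_(loop_number G), c = C *m z.

(* Vertices are numbered from 0, so that column i has boundary v_(i+1) - v_0 *)
Definition based_paths G (P : 'M[int]_(m, n.-1)) : Prop :=
  forall (v : 'I_n) (i : 'I_n.-1),
    (boundary G *m P) v i = (v == i.+1 :> nat)%:R - (v == 0 :> nat)%:R.

(* The orientation with sign s corresponds to
   e_1 /\ ... /\ e_m (x) C_1 /\ ... /\ C_l, where C is a basis of H_1(G).  For
   a connected graph l + (n - 1) = m, so that [conform_mx] only casts the
   block matrix (C | P) to a square matrix. *)
Definition orients G (s : bool) (C : 'M[int]_(m, loop_number G)) : Prop :=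
  cycle_basis C /\
  exists2 P : 'M[int]_(m, n.-1), based_paths G P &
    (-1) ^+ s * \det (conform_mx (0 : 'M[int]_m) (row_mx C P)) = 1.

End Graphs.

Record oriented_graph := OrientedGraph {
  nvertices : nat;
  nedges : nat;
  underlying : graph nvertices nedges;
  orientation_sign : bool;
  underlying_admissible : admissible underlying }.

HB.instance Definition _ := gen_eqMixin oriented_graph.
HB.instance Definition _ := gen_choiceMixin oriented_graph.

Definition free_graphs : lmodType rat := {freeg oriented_graph / rat}.

Definition free_class (G : oriented_graph) : free_graphs := Freeg [:: (1, G)].

Inductive graph_relator : free_graphs -> Prop :=
| relator_iso n m (G G' : graph n m) (hG : admissible G) (hG' : admissible G')
    (f : graph_iso G G') (s : bool) :
    graph_relator (free_class (OrientedGraph s hG)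
                   - free_class (OrientedGraph (s (+) iso_sign f) hG'))
| relator_opp n m (G : graph n m) (hG : admissible G) (s : bool) :
    graph_relator (free_class (OrientedGraph (~~ s) hG)
                   + free_class (OrientedGraph s hG)).

Definition relations : {pred free_graphs} := fun x =>
  `[< exists2 t : seq (rat * free_graphs),
        (forall r, r \in t -> graph_relator r.2) &
        x = \sum_(r <- t) r.1 *: r.2 >].

Fact relations_submod : submod_closed relations.
Proof.
split; first by apply/asboolP; exists [::]; rewrite ?big_nil.
move=> a x y /asboolP[t ht ->] /asboolP[u hu ->]; apply/asboolP.
exists ([seq (a * r.1, r.2) | r <- t] ++ u).
  move=> r; rewrite mem_cat => /orP[/mapP[r' r't ->]|]; last exact: hu.
  exact: (ht _ r't).
rewrite big_cat big_map scaler_sumr; congr (_ + _).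
by apply: eq_bigr => r _; rewrite scalerA.
Qed.

HB.instance Definition _ :=
  GRing.isSubmodClosed.Build rat free_graphs relations relations_submod.

Definition GC3 : Type := Quotient.quot relations.

HB.instance Definition _ := GRing.Zmodule.on GC3.

Local Open Scope quotient_scope.

Definition GC3_proj (x : free_graphs) : GC3 := \pi_(Quotient.quot relations) x.

Definition GC3_scale (a : rat) (x : GC3) : GC3 := GC3_proj (a *: repr x).

Fact GC3_projZ a x : GC3_scale a (GC3_proj x) = GC3_proj (a *: x).
Proof.
apply/eqP; rewrite /GC3_scale /GC3_proj -(Quotient.idealrBE relations).
by rewrite -scalerBr rpredZ // (Quotient.idealrBE relations) reprK.
Qed.

Fact GC3_projP (x : GC3) : exists y, x = GC3_proj y.
Proof. by exists (repr x); rewrite /GC3_proj reprK. Qed.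

Fact GC3_projD x y : GC3_proj (x + y) = GC3_proj x + GC3_proj y.
Proof. by rewrite /GC3_proj raddfD. Qed.

Fact GC3_scaleA a b x : GC3_scale a (GC3_scale b x) = GC3_scale (a * b) x.
Proof. by have [y ->] := GC3_projP x; rewrite !GC3_projZ scalerA. Qed.

Fact GC3_scale1 : left_id 1 GC3_scale.
Proof. by move=> x; have [y ->] := GC3_projP x; rewrite GC3_projZ scale1r. Qed.

Fact GC3_scaleDr : right_distributive GC3_scale +%R.
Proof.
move=> a x y; have [x' ->] := GC3_projP x; have [y' ->] := GC3_projP y.
by rewrite -GC3_projD !GC3_projZ scalerDr GC3_projD.
Qed.

Fact GC3_scaleDl x : {morph GC3_scale^~ x : a b / a + b}.
Proof.
by move=> a b; have [y ->] := GC3_projP x; rewrite !GC3_projZ scalerDl GC3_projD.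
Qed.

HB.instance Definition _ := GRing.Zmodule_isLmodule.Build rat GC3
  GC3_scaleA GC3_scale1 GC3_scaleDr GC3_scaleDl.

Definition GC3_class (G : oriented_graph) : GC3 := GC3_proj (free_class G).

Section Integral.
Variables (R : realType) (n m : nat) (G : graph n m).
Variables (C : 'M[int]_(m, loop_number G)) (w : canonical_poly R).

(* C^T diag(x_1, ..., x_m) C.  As this is linear in x, its differential is
   the same expression in dx_1, ..., dx_m. *)
Definition Lambda (A : pzRingType) (x : 'rV[A]_m) : 'M[A]_(loop_number G) :=
  (map_mx intr C)^T *m diag_mx x *m map_mx intr C.

(* The form omega_G /\ phi_G on the cone of all x with positive coordinates *)
Definition integrand_form (x : 'rV[R]_m) : ext R m :=
  let X := Lambda x in
  let dX := Lambda (\row_i dx R i) in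
  eval_canonical w X dX * phi X dX.

(* The affine chart x_m = 1 of the open simplex *)
Definition chart (t : m.-1.-tuple R) : 'rV[R]_m :=
  \row_(i < m) nth 1 t i.

Definition chart_domain : set (m.-1.-tuple R) :=
  [set t | forall i, 0 < tnth t i].

(* On x_m = 1 the orientation form sum_i (-1)^(i-1) x_i dx_1 .. ^dx_i .. dx_m
   restricts to (-1)^(m-1) dx_1 ... dx_(m-1), and an (m-1)-form restricts to
   its coefficient of dx_1 ... dx_(m-1) times dx_1 ... dx_(m-1). *)
Definition density (t : m.-1.-tuple R) : R :=
  (-1) ^+ m.-1 * integrand_form (chart t) [set i : 'I_m | (i < m.-1)%N]%SET.

Definition absolutely_convergent : Prop :=
  (lebesgue_tuple R m.-1).-integrable chart_domain (EFin \o density).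

(* The prefactor is 1 / (-2 pi)^(l/2) for l even; for l odd phi_G = 0. *)
Definition canonical_integral (d : nat) : R :=
  if (d + loop_number G == m.-1)%N then
    ((- (2 * pi)) ^+ (loop_number G)./2)^-1 *
    \int[lebesgue_tuple R m.-1]_(t in chart_domain) density t
  else 0.

End Integral.

(* Main.v *)
Require Import Defs.
From HB Require Import structures.
From mathcomp Require Import all_boot all_order all_algebra perm.
From mathcomp Require Import boolp reals.
From mathcomp Require Import ring lra zify.

(* Write eta_x for the form omega /\ phi pulled back to the cone of positive
   x in R^m along x |-> C^T diag(x) C.

   Convergence.  The bases of rows of C give charts: choose a set B of l rows
   maximizing |det C_B| (prod_(i in B) x_i)^(1/2).  Rescaling the rows of C by
   x_i^(1/2) and multiplying by the inverse of the B-block turns C into a matrix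
   with entries bounded by 1 that contains an identity block, so that the
   coefficients of eta, times the product of the corresponding x_i, are bounded
   Lipschitz functions of this matrix.  If the x_i in a set of edges are smaller
   than all others by a factor del^2, this matrix is at distance O(del) from a
   block matrix; for a block matrix, eta descends to the quotient by the
   rescalings of both blocks and vanishes, being of degree m - 1 > m - 2.  By
   the pigeonhole principle a gap of size (x_i / x_j)^(1/(m+1)) always exists, so
   the density is dominated by a product of functions min(t, 1/t)^e / t.

   Linearity.  The integral over the simplex does not depend on the chart
   (Cheng-Wu: weight a homogeneous function by a function of sum_i x_i), so a
   permutation of the edges multiplies it by its signature.  A change of basis U
   of the cycles multiplies eta by the sign of det U, because of the square
   root in the Pfaffian form.  An isomorphism of graphs maps the basis (C | P) of
   1-chains to (C' | P') up to a block triangular matrix, whose determinant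
   compares the signs of the edge permutation, of the vertex permutation, of the
   reversed edges and of det U. *)

Set Implicit Arguments.
Unset Strict Implicit.
Unset Printing Implicit Defensive.

Import Order.TTheory GRing.Theory Num.Theory.
Local Open Scope ring_scope.

(** * The exterior algebra *)

(** Boundedness of the coefficients times the products of the x_i only gives a density of order 1 /
    (x_1 ... x_(m-1)), whose integral diverges logarithmically at 0 and at infinity in every
    coordinate. Any positive power gained is enough, so the crude pigeonhole exponent suffices.

    Descent to a quotient is proved by algebra instead of contraction with vector fields:
    subtracting from dX a one-form times an infinitesimal rescaling leaves the form unchanged. One
    differential per rescaling can thus be eliminated, and a form whose degree exceeds the number of
    remaining one-forms is zero. The class beta^1 = d log det X is not invariant under such shifts,
    which is why only k >= 1 may occur.

    A permutation that moves the last edge changes the affine chart by a nonlinear map. Integrating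
    against a function of the sum of the x_i replaces it by a permutation of the coordinates of R^m,
    which preserves Lebesgue measure. *)

Section Monomials.
Variables (R : comNzRingType) (m : nat) (A : algType R) (th : 'I_m -> A).
Hypothesis th_sq : forall i, th i * th i = 0.
Hypothesis th_anti : forall i j, i != j -> th i * th j = - (th j * th i).
Implicit Types (s : seq 'I_m) (S B : {set 'I_m}).

Definition monomial S : A := \prod_(i in S) th i.

Let ltord : rel 'I_m := fun i j => (i < j)%N.

Lemma pairwise_enum_ord : pairwise ltord (index_enum 'I_m).
Proof.
rewrite -sorted_pairwise; last by move=> i j k; exact: ltn_trans.
have := iota_ltn_sorted 0 m; rewrite -val_enum_ord sorted_map.
by rewrite enumT /index_enum; case: index_enum_key.
Qed.

(** Moving [th a] to its place costs one sign for each smaller index in B, and a repeated index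
    gives a zero square. The list is general so that the induction can run over the suffixes of the
    increasing enumeration. *)
Lemma mul_monomial_seq s a B : pairwise ltord s -> a \in s ->
  th a * \prod_(i <- s | i \in B) th i =
  if a \in B then 0
  else (-1) ^+ (\sum_(j <- s | j \in B) (j < a))%N *:
         \prod_(i <- s | (i \in a |: B)%SET) th i.
Proof.
elim: s => // x s IH /= /andP[/allP xs srt].
have xNs : x \notin s by apply/negP => /xs; rewrite /ltord ltnn.
rewrite !big_cons in_setU1 inE => /predU1P[->|a_s].
  rewrite eqxx /=; case: ifP => xB; first by rewrite mulrA th_sq mul0r.
  rewrite [X in (-1) ^+ X]big_seq_cond [X in (-1) ^+ X]big1 ?scale1r; last first.
    by move=> j /andP[/xs/ltnW]; rewrite leqNgt => /negbTE->.
  congr (_ * _); rewrite [LHS]big_seq_cond [RHS]big_seq_cond; apply: eq_bigl => i.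
  by rewrite in_setU1; case: eqP => // ->; rewrite (negbTE xNs).
have neq_ax : a != x by apply: contraNneq xNs => <-.
have xa := xs _ a_s; rewrite /ltord in xa.
have IHa := IH srt a_s.
rewrite (eq_sym x) (negbTE neq_ax) /=.
case: (boolP (x \in B)) => xB; last by rewrite IHa.
rewrite mulrA th_anti // mulNr -mulrA IHa xa.
case: ifP => aB; first by rewrite mulr0 oppr0.
by rewrite exprD expr1 mulN1r scaleNr scalerAr.
Qed.

Lemma mul_monomial1 a B :
  th a * monomial B =
  if a \in B then 0
  else (-1) ^+ (\sum_(j in B) (j < a))%N *: monomial (a |: B)%SET.
Proof.
by apply: mul_monomial_seq; [exact: pairwise_enum_ord | rewrite mem_index_enum].
Qed.

Lemma monomialM S B :
  monomial S * monomial B =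
  if [disjoint S & B] then (-1) ^+ inversions S B *: monomial (S :|: B)%SET
  else 0.
Proof.
(* The part of S that is multiplied out when only the suffix s of the enumeration is used. *)
pose Ss s : {set 'I_m} := [set i in S | i \in s]%SET.
suff key s : pairwise ltord s -> (\prod_(i <- s | i \in S) th i) * monomial B =
    if [disjoint Ss s & B] then
      (-1) ^+ (\sum_(i <- s | i \in S) \sum_(j in B) (j < i))%N *:
        monomial (Ss s :|: B)%SET
    else 0.
  have SE : Ss (index_enum 'I_m) = S.
    by apply/setP => i; rewrite inE mem_index_enum andbT.
  by have := key _ pairwise_enum_ord; rewrite SE.
elim: s => [_|x s IH /= /andP[/allP xs srt]].
  have -> : Ss [::] = set0 by apply/setP => i; rewrite !inE andbF.
  by rewrite !big_nil mul1r set0U scale1r disjoints_subset sub0set.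
have xNs : x \notin s by apply/negP => /xs; rewrite /ltord ltnn.
rewrite !big_cons; case: ifPn => xS; last first.
  rewrite IH //; have -> // : Ss (x :: s) = Ss s.
  by apply/setP => i; rewrite !inE; case: eqP => // ->; rewrite (negbTE xS).
have SsE : Ss (x :: s) = (x |: Ss s)%SET.
  by apply/setP => i; rewrite !inE; case: eqP => // ->; rewrite xS.
have dU : [disjoint x |: Ss s & B]%SET = (x \notin B) && [disjoint Ss s & B].
  by rewrite -disjointU1; apply: eq_disjoint => i; rewrite in_setU1 [RHS]inE.
rewrite -mulrA IH // SsE dU.
case: ifP => dSB; rewrite ?andbF ?mulr0 // andbT.
rewrite -scalerAr mul_monomial1 !inE (negbTE xNs) andbF /=.
case: ifP => xB /=; first by rewrite scaler0.
rewrite scalerA -exprD addnC setUA; congr ((-1) ^+ (_ + _)%N *: _).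
rewrite (eq_bigl [predU Ss s & B]); last by move=> j; rewrite !inE.
(* The members of [Ss s] exceed x, so only B contributes to the sign of moving [th x]. *)
rewrite bigU //=.
rewrite big1 // => j; rewrite inE => /andP[_ /xs/ltnW].
by rewrite leqNgt => /negbTE ->.
Qed.

(** The algebra morphism given by the universal property of the exterior algebra, with [dx i] sent
    to [th i]. *)
Definition substitute (a : ext R m) : A := \sum_S a S *: monomial S.

Lemma substitute_is_linear : linear substitute.
Proof.
move=> k a b; rewrite /substitute scaler_sumr -big_split /=.
by apply: eq_bigr => S _; rewrite !ffunE scalerDl scalerA.
Qed.

Lemma substituteM a b : substitute (a * b) = substitute a * substitute b.
Proof.
rewrite /substitute mulr_suml.
under [RHS]eq_bigr => S _ do rewrite mulr_sumr.
rewrite pair_big_dep /=.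
transitivity (\sum_(p : {set 'I_m} * {set 'I_m} | p.2 \subset p.1)
   ((-1) ^+ inversions p.2 (p.1 :\: p.2) * (a p.2 * b (p.1 :\: p.2)))
     *: monomial p.1).
  rewrite -(pair_big_dep xpredT (fun S B : {set 'I_m} => B \subset S)
    (fun S B => ((-1) ^+ inversions B (S :\: B) * (a B * b (S :\: B)))
     *: monomial S)) /=.
  by apply: eq_bigr => S _; rewrite ffunE scaler_suml.
rewrite [RHS](bigID (fun p : {set 'I_m} * {set 'I_m} => [disjoint p.1 & p.2])) /=.
rewrite [X in _ = _ + X]big1 ?addr0; last first.
  move=> [S B] /= /negbTE dSB; rewrite -scalerAl -scalerAr monomialM dSB.
  by rewrite !scaler0.
(* A subset B of S corresponds to the disjoint pair of B and its complement in S. *)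
rewrite (reindex_onto (fun p : {set 'I_m} * {set 'I_m} => ((p.1 :|: p.2)%SET, p.1))
  (fun p => (p.2, p.1 :\: p.2)%SET)) /=; last first.
  move=> [S B] /= sBS; congr (_, _); apply/setP=> i; rewrite !inE.
  by case: (boolP (i \in B)) => //= /(subsetP sBS) ->.
have setDE S B : ((S :|: B) :\: S == B)%SET = [disjoint S & B].
  rewrite setDUl setDv set0U disjoint_sym.
  by apply/eqP/idP => [dB|/setDidPl//]; apply/setDidPl.
apply: eq_big => [[S B]|[S B]] /=.
  by rewrite subsetUl /= -pair_eqE /= eqxx setDE.
rewrite subsetUl -pair_eqE /= eqxx setDE /= => dSB.
rewrite -scalerAl -scalerAr monomialM dSB !scalerA.
move: dSB; rewrite -setDE => /eqP ->; congr (_ *: _); ring.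
Qed.

Lemma substitute1 : substitute 1 = 1.
Proof.
rewrite /substitute (bigD1 set0) //= ffunE eqxx scale1r /monomial big_set0.
by rewrite big1 ?addr0 // => S /negbTE S0; rewrite ffunE S0 scale0r.
Qed.

Lemma substitute_dx i : substitute (dx R i) = th i.
Proof.
rewrite /substitute (bigD1 [set i]%SET) //= ffunE eqxx scale1r /monomial.
by rewrite big_set1 big1 ?addr0 // => S /negbTE S0; rewrite ffunE S0 scale0r.
Qed.

End Monomials.

(** * Degrees and linear substitutions of one-forms *)

Section ExtTheory.
Variables (R : comNzRingType) (m : nat).
Implicit Types (a b : ext R m) (S : {set 'I_m}).

Definition homog (k : nat) a := forall S, #|S| != k -> a S = 0.

Lemma homog0 k : homog k 0.
Proof. by move=> S _; rewrite ffunE. Qed.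

Lemma homogD k a b : homog k a -> homog k b -> homog k (a + b).
Proof. by move=> ha hb S hS; rewrite ffunE ha ?hb ?addr0. Qed.

Lemma homogZ k (c : R) a : homog k a -> homog k (c *: a).
Proof. by move=> ha S hS; rewrite ffunE ha ?scaler0. Qed.

Lemma homogN k a : homog k a -> homog k (- a).
Proof. by rewrite -scaleN1r; exact: homogZ. Qed.

Lemma homog_sum k (I : Type) (r : seq I) (P : pred I) (F : I -> ext R m) :
  (forall i, P i -> homog k (F i)) -> homog k (\sum_(i <- r | P i) F i).
Proof. by move=> h; elim/big_ind : _ => //; [exact: homog0|exact: homogD]. Qed.

Lemma homog1 : homog 0%N 1.
Proof. by move=> S; rewrite cards_eq0 => /negbTE S0; rewrite ffunE S0. Qed.

Lemma homog_alg (c : R) : homog 0%N (c%:A).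
Proof. by apply/homogZ/homog1. Qed.

Lemma homog_dx i : homog 1%N (dx R i).
Proof.
by move=> S; rewrite ffunE; have [->|//] := eqVneq S [set i]%SET; rewrite cards1.
Qed.

Lemma homogM j k a b : homog j a -> homog k b -> homog (j + k) (a * b).
Proof.
move=> ha hb S hS; rewrite ffunE big1 // => B sBS.
have [cB|cB] := eqVneq #|B| j; last by rewrite ha // mul0r mulr0.
rewrite hb ?mulr0 ?mulr0 //; apply: contra hS => /eqP <-.
by rewrite -cB -(cardsID B S) (setIidPr sBS).
Qed.

Lemma homog_prod (I : Type) (r : seq I) (d : I -> nat) (F : I -> ext R m) :
  (forall i, homog (d i) (F i)) ->
  homog (\sum_(i <- r) d i)%N (\prod_(i <- r) F i).
Proof.
move=> h; elim: r => [|i r IH]; first by rewrite !big_nil; exact: homog1.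
by rewrite !big_cons; exact: homogM.
Qed.

(** A pair of an element of A and an element of B is an inversion in exactly one of the two
    orders. *)
Lemma inversionsC (A B : {set 'I_m}) : [disjoint A & B] ->
  (inversions A B + inversions B A = #|A| * #|B|)%N.
Proof.
move=> dAB; rewrite /inversions [X in (_ + X)%N]exchange_big -big_split /=.
rewrite -sum_nat_const; apply: eq_bigr => i iA; rewrite -big_split /= -sum1_card.
apply: eq_bigr => j jB; case: ltngtP => // ij.
by move: (disjointFr dAB iA); rewrite -(val_inj ij) jB.
Qed.

Lemma wedge_comm j k a b : homog j a -> homog k b ->
  a * b = (-1) ^+ (j * k)%N *: (b * a).
Proof.
move=> ha hb; apply/ffunP => S; rewrite !ffunE scaler_sumr.
rewrite [RHS](reindex_onto (fun B => S :\: B) (fun B => S :\: B)) /=; last first.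
  by move=> B sBS; rewrite setDDr setDv set0U; apply/setIidPr.
have SDD B : (S :\: (S :\: B) == B)%SET = (B \subset S).
  by rewrite setDDr setDv set0U; apply/eqP/setIidPr.
apply: eq_big => [B|B sBS]; first by rewrite subsetDl SDD.
have /eqP SDB : (S :\: (S :\: B) == B)%SET by rewrite SDD.
rewrite SDB /GRing.scale /=.
have [cB|cB] := eqVneq #|B| j; last by rewrite (ha B) // !(mul0r,mulr0).
have [cSB|cSB] := eqVneq #|S :\: B| k; last by rewrite (hb (S :\: B)%SET) // !(mul0r,mulr0).
have dB : [disjoint B & S :\: B].
  by rewrite -setI_eq0 setIDA setIC setDIl setDv setI0.
have := inversionsC dB; rewrite cB cSB => <-.
rewrite exprD [b _ * _]mulrC -mulrA [X in _ = _ * X]mulrA -expr2 sqrr_sign.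
by rewrite mul1r.
Qed.

Lemma wedge_anticomm j k a b : odd j -> odd k -> homog j a -> homog k b ->
  a * b = - (b * a).
Proof.
move=> oj ok ha hb; rewrite (wedge_comm ha hb) -signr_odd oddM oj ok.
by rewrite expr1 scaleN1r.
Qed.

Lemma dx_sq (i : 'I_m) : dx R i * dx R i = 0.
Proof.
apply/ffunP => S; rewrite !ffunE big1 // => B sBS; rewrite !ffunE.
case: eqP => [->|]; last by rewrite mul0r mulr0.
case: eqP => [/setP/(_ i)|]; last by rewrite !mulr0.
by rewrite !inE eqxx.
Qed.

Definition linear_form (c : 'rV[R]_m) : ext R m := \sum_j c 0 j *: dx R j.

Lemma homog_linear_form c : homog 1%N (linear_form c).
Proof. by apply: homog_sum => j _; apply/homogZ/homog_dx. Qed.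

(** Anticommutation only shows that twice the square vanishes, so over a general commutative ring
    the square is expanded term by term. *)
Lemma linear_form_sq c : linear_form c * linear_form c = 0.
Proof.
rewrite /linear_form; elim: (index_enum _) => [|i r IH]; first by rewrite big_nil mul0r.
rewrite big_cons mulrDl !mulrDr IH addr0 -!scalerAl -scalerAr dx_sq !scaler0 add0r.
rewrite scalerAl (@wedge_anticomm 1%N 1%N (c 0 i *: _)) ?addNr //.
  by apply/homogZ/homog_dx.
by apply: homog_sum => j _; apply/homogZ/homog_dx.
Qed.

(** The pullback of forms with constant coefficients along the linear map with matrix L: [dx i]
    becomes row i of L. *)
Definition ext_map (L : 'M[R]_m) : ext R m -> ext R m :=
  substitute (fun i => linear_form (row i L)).

Lemma linear_form_anti (L : 'M[R]_m) i j : i != j ->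
  linear_form (row i L) * linear_form (row j L) =
  - (linear_form (row j L) * linear_form (row i L)).
Proof. by move=> _; apply: (@wedge_anticomm 1%N 1%N) => //; exact: homog_linear_form. Qed.

End ExtTheory.

HB.instance Definition _ (R : comNzRingType) m (L : 'M[R]_m) :=
  GRing.isLinear.Build R (ext R m) (ext R m) *:%R (ext_map L)
    (substitute_is_linear _).

Fact ext_map_is_monoid_morphism (R : comNzRingType) m (L : 'M[R]_m) :
  monoid_morphism (ext_map L).
Proof.
split; first exact: substitute1.
by apply: substituteM => [i|i j]; [exact: linear_form_sq|exact: linear_form_anti].
Qed.

HB.instance Definition _ (R : comNzRingType) m (L : 'M[R]_m) :=
  GRing.isMonoidMorphism.Build (ext R m) (ext R m) (ext_map L)
    (ext_map_is_monoid_morphism L).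

Section ExtMap.
Variables (R : comNzRingType) (m : nat).
Implicit Types (a b : ext R m) (S : {set 'I_m}) (L : 'M[R]_m).

Lemma ext_map_dx L i : ext_map L (dx R i) = linear_form (row i L).
Proof. exact: substitute_dx. Qed.

Lemma ext_map_monomial L (th : 'I_m -> ext R m) S :
  ext_map L (monomial th S) = monomial (fun i => ext_map L (th i)) S.
Proof. exact: rmorph_prod. Qed.

Lemma homog_monomial (th : 'I_m -> ext R m) S :
  (forall i, homog 1%N (th i)) -> homog #|S| (monomial th S).
Proof.
move=> h; rewrite -sum1_card /monomial; elim: (index_enum _) => [|i r IH].
  by rewrite !big_nil; exact: homog1.
by rewrite !big_cons; case: ifP => // _; exact: homogM.
Qed.

(** The degree count behind both vanishing arguments for [eta]: if too few one-forms survive the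
    substitution, every product of k of them has a zero factor. *)
Lemma ext_map_eq0 L k a : homog k a ->
  (forall S, #|S| = k -> exists2 i, i \in S & row i L = 0) -> ext_map L a = 0.
Proof.
move=> ha hL; apply: big1 => S _; have [hS|hS] := eqVneq #|S| k; last first.
  by rewrite ha // scale0r.
have [i iS Li0] := hL _ hS; have th0 : linear_form (row i L) = 0.
  by rewrite Li0; apply: big1 => j _; rewrite mxE scale0r.
have anti := linear_form_anti L.
have := @mul_monomial1 R m _ _ (fun i => linear_form_sq _) anti i (S :\ i)%SET.
rewrite setD11 setD1K // th0 mul0r => /esym/(congr1 (fun u =>
  (-1) ^+ (\sum_(j in (S :\ i)%SET) (j < i))%N *: u)).
rewrite scaler0 scalerA -expr2 sqrr_sign scale1r => ->; exact: scaler0.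
Qed.

Lemma dx_anti (i j : 'I_m) : i != j -> dx R i * dx R j = - (dx R j * dx R i).
Proof. by move=> _; apply: (@wedge_anticomm _ _ 1%N 1%N) => //; exact: homog_dx. Qed.

Lemma monomial_dx S : monomial (fun i => dx R i) S = [ffun B => (B == S)%:R].
Proof.
have dxS := mul_monomial1 (@dx_sq R m) dx_anti.
have [n] := ubnP #|S|; elim: n S => // n IH S; rewrite ltnS => leSn.
have [->|[i0 i0S]] := set_0Vmem S.
  by rewrite /monomial big_set0; apply/ffunP => B; rewrite !ffunE.
(* Splitting off the least index costs no sign. *)
pose i := [arg min_(j < i0 in S) (j : nat)]; rewrite /= in i.
have [iS imin] : i \in S /\ forall j, j \in S -> (i <= j)%N.
  by rewrite /i; case: arg_minnP.
have := dxS i (S :\ i)%SET; rewrite setD11 setD1K // big1 ?scale1r; last first.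
  by move=> j /setD1P[_ /imin]; rewrite leqNgt => /negbTE ->.
move=> <-; rewrite IH; last by rewrite (cardsD1 i S) iS in leSn.
apply/ffunP => B; rewrite !ffunE.
have [->|nBS] := eqVneq B S; last first.
  apply: big1 => D sDB; rewrite !ffunE; case: eqP => [DE|]; last by rewrite !(mul0r,mulr0).
  case: eqP => [DB|]; last by rewrite !mulr0.
  by case/eqP: nBS; rewrite -(setD1K iS) -DB DE setD1K // -sub1set -DE.
rewrite (bigD1 [set i]%SET) ?sub1set //= !ffunE !eqxx !mulr1 big1 ?addr0.
  rewrite /inversions big_set1 big1 ?expr0 // => j /setD1P[_ /imin].
  by rewrite leqNgt => /negbTE ->.
by move=> D /andP[_ /negbTE Di]; rewrite !ffunE Di mul0r mulr0.
Qed.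

Lemma linear_form_row_perm (s : 'S_m) i : linear_form (row i (perm_mx s)) = dx R (s i).
Proof.
rewrite /linear_form (bigD1 (s i)) //= !mxE eqxx scale1r big1 ?addr0 // => j.
by rewrite eq_sym !mxE => /negbTE ->; rewrite scale0r.
Qed.

Lemma linear_form_row_diag (c : 'rV[R]_m) i :
  linear_form (row i (diag_mx c)) = c 0 i *: dx R i.
Proof.
rewrite /linear_form (bigD1 i) //= !mxE eqxx mulr1n big1 ?addr0 // => j.
by rewrite eq_sym !mxE => /negbTE ->; rewrite scale0r.
Qed.

Lemma ext_map_diag (c : 'rV[R]_m) a S :
  ext_map (diag_mx c) a S = (\prod_(i in S) c 0 i) * a S.
Proof.
have monE B : monomial (fun i => linear_form (row i (diag_mx c))) B =
    (\prod_(i in B) c 0 i) *: monomial (fun i => dx R i) B.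
  rewrite /monomial; elim: (index_enum _) => [|i r IH].
    by rewrite !big_nil scale1r.
  rewrite !big_cons IH; case: ifP => // _.
  by rewrite linear_form_row_diag -scalerAl -scalerAr scalerA.
rewrite /ext_map /substitute sum_ffunE (bigD1 S) //= big1 ?addr0 => [|B nBS].
  by rewrite ffunE monE monomial_dx !ffunE eqxx /GRing.scale /= mulr1 mulrC.
by rewrite ffunE monE monomial_dx !ffunE eq_sym (negbTE nBS) !scaler0.
Qed.

End ExtMap.

(** * Permutations acting on forms of top degree *)

Section ExtPerm.
Variables (R : comNzRingType) (m : nat).
Implicit Types (a b : ext R m) (S : {set 'I_m}) (L : 'M[R]_m).

Lemma monomial_perm (s : 'S_m) :
  monomial (fun i => dx R (s i)) setT = (-1) ^+ s *: monomial (fun i => dx R i) setT.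
Proof.
have [ts -> dts] := prod_tpermP s; elim: ts dts => [_|[i j] ts IH] /=.
  rewrite big_nil odd_perm1 scale1r; apply: eq_bigr => i _; by rewrite perm1.
move=> /andP[ij /IH{}IH]; rewrite /dpair /= in ij.
rewrite big_cons /=; set t : 'S_m := (\prod_(_ <- ts) _)%g in IH *.
rewrite odd_permM odd_tperm ij.
have -> : monomial (fun k => dx R ((tperm i j * t)%g k)) setT =
    ext_map (perm_mx t) (monomial (fun k => dx R (tperm i j k)) setT).
  rewrite ext_map_monomial; apply: eq_bigr => k _.
  by rewrite ext_map_dx linear_form_row_perm permM.
suff -> : monomial (fun k => dx R (tperm i j k)) setT =
    - monomial (fun k => dx R k) setT.
  rewrite (linearN (ext_map (perm_mx t))) /= ext_map_monomial signrN scaleNr -IH; congr (- _).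
  by apply: eq_bigr => k _; rewrite ext_map_dx linear_form_row_perm.
have -> : monomial (fun k => dx R (tperm i j k)) setT =
    ext_map (perm_mx (tperm i j)) (monomial (fun k => dx R k) setT).
  rewrite ext_map_monomial; apply: eq_bigr => k _.
  by rewrite ext_map_dx linear_form_row_perm.
pose S : {set 'I_m} := ~: [set i; j].
have jS : j \notin S by rewrite !inE eqxx orbT.
have iS : i \notin (j |: S)%SET by rewrite !inE eqxx (negbTE ij).
(* The two factors exchanged by the transposition are brought to the front with a sign (-1)^p, whose
   value is immaterial since it occurs on both sides. *)
have [p pE] : exists p, monomial (fun k => dx R k) setT =
    (-1) ^+ p *: (dx R i * (dx R j * monomial (fun k => dx R k) S)).
  rewrite (mul_monomial1 (@dx_sq R m) (@dx_anti R m)) (negbTE jS) -scalerAr.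
  rewrite (mul_monomial1 (@dx_sq R m) (@dx_anti R m)) (negbTE iS) scalerA.
  set p := (\sum_(_ in S) _)%N; set q := (\sum_(_ in (_ |: _)%SET) _)%N.
  exists (p + q)%N; rewrite scalerA exprD -expr2 exprMn !sqrr_sign mulr1 scale1r; congr (monomial _ _).
  by apply/setP => k; rewrite !inE; case: eqP; case: eqP.
rewrite pE linearZ /= !rmorphM /= !ext_map_dx !linear_form_row_perm.
rewrite tpermL tpermR !mulrA dx_anti 1?eq_sym // mulNr scalerN.
congr (- (_ *: (_ * _))); rewrite ext_map_monomial; apply: eq_bigr => k.
rewrite !inE negb_or => /andP[ki kj].
by rewrite ext_map_dx linear_form_row_perm tpermD // eq_sym.
Qed.

Lemma ext_map_perm_top (s : 'S_m) a :
  ext_map (perm_mx s) a setT = (-1) ^+ s * a setT.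
Proof.
rewrite /ext_map /substitute sum_ffunE (bigD1 setT) //= big1 ?addr0 => [|S nST].
  have -> : monomial (fun i => linear_form (row i (perm_mx s))) setT =
      monomial (fun i => dx R (s i)) setT.
    by apply: eq_bigr => i _; rewrite linear_form_row_perm.
  by rewrite monomial_perm monomial_dx !ffunE eqxx /GRing.scale /= mulr1 mulrC.
rewrite ffunE homog_monomial ?scaler0 // => [i|]; first exact: homog_linear_form.
rewrite eq_sym; apply: contra nST => /eqP cS.
by rewrite eqEcard subsetT cS leqnn.
Qed.

End ExtPerm.

Lemma invmx_mul (F : comUnitRingType) n (X Y : 'M[F]_n) :
  X \in unitmx -> Y \in unitmx -> invmx (X *m Y) = invmx Y *m invmx X.
Proof.
move=> uX uY; have uXY : X *m Y \in unitmx by rewrite unitmx_mul uX.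
rewrite -[RHS]mulmx1 -(mulmxV uXY) mulmxA -(mulmxA _ _ (X *m Y)) mulKmx //.
by rewrite mulVmx // mul1mx.
Qed.

(** * Invariance of the canonical forms *)

Section CanonicalForm.
Variable R : realType.

Definition canonical_form (A : algType R) n (w : canonical_poly R)
    (X : 'M[R]_n) (dX : 'M[A]_n) : A :=
  eval_canonical w X dX * phi X dX.

Section Naturality.
Variables (A B : algType R) (f : {lrmorphism A -> B}) (n : nat).
Implicit Types (X : 'M[R]_n) (dX M : 'M[A]_n).

Lemma map_scalars p q (X : 'M[R]_(p, q)) :
  map_mx f (map_mx (in_alg A) X) = map_mx (in_alg B) X.
Proof. by apply/matrixP => i j; rewrite !mxE /= rmorph_alg. Qed.

Lemma map_mxX M k : map_mx f (M ^+ k) = (map_mx f M) ^+ k.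
Proof.
elim: k => [|k IH]; first by rewrite !expr0 map_mx1.
by rewrite !exprS -!mulmxE map_mxM /= IH.
Qed.

Lemma beta_natural k X dX : beta k X (map_mx f dX) = f (beta k X dX).
Proof. by rewrite /beta -[RHS]trace_map_mx map_mxX map_mxM /= map_scalars. Qed.

Lemma pfaffian_natural M : pfaffian (map_mx f M) = f (pfaffian M).
Proof.
rewrite /pfaffian [RHS]linearZ rmorph_sum; congr (_ *: _); apply: eq_bigr => s _.
rewrite rmorphM rmorph_sign rmorph_prod; congr (_ * _); apply: eq_bigr => i _.
by rewrite mxE.
Qed.

(** Only algebra operations are applied to dX, so an algebra morphism passes through the formula.
    For [ext_map] this turns a pullback into a substitution of one-forms. *)
Lemma canonical_form_natural w X dX :
  canonical_form w X (map_mx f dX) = f (canonical_form w X dX).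
Proof.
rewrite /canonical_form rmorphM; congr (_ * _).
  rewrite /eval_canonical rmorph_sum; apply: eq_bigr => t _.
  by rewrite [RHS]linearZ rmorph_prod; congr (_ *: _); apply: eq_bigr => k _; exact: beta_natural.
rewrite /phi; case: ifP => _; first by rewrite rmorph0.
rewrite [RHS]linearZ; congr (_ *: _).
by rewrite -[RHS]pfaffian_natural !map_mxM /= map_scalars.
Qed.

End Naturality.

Section Congruence.
Variables (A : algType R) (n : nat).
Implicit Types (X U : 'M[R]_n) (M dX : 'M[A]_n).

Lemma scalarsM X U : scalars A (X *m U) = scalars A X *m scalars A U.
Proof. exact: map_mxM. Qed.

Lemma scalars1 : scalars A (1%:M : 'M[R]_n) = 1%:M.
Proof. exact: map_mx1. Qed.

(** Cyclicity of the trace holds over the noncommutative A because one of the factors has scalar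
    entries. *)
Lemma trace_scalars_mulC U M :
  \tr (scalars A U *m M) = \tr (M *m scalars A U).
Proof.
rewrite /mxtrace; under eq_bigr => i _ do rewrite mxE.
rewrite exchange_big; apply: eq_bigr => j _; rewrite mxE; apply: eq_bigr => i _.
by rewrite mxE /= mulr_algl mulr_algr.
Qed.

Lemma beta_congr k X dX U : X \in unitmx -> U \in unitmx ->
  beta k (U^T *m X *m U) ((scalars A U)^T *m dX *m scalars A U) = beta k X dX.
Proof.
move=> uX uU; have uUT : U^T \in unitmx by rewrite unitmx_tr.
have invE : invmx (U^T *m X *m U) = invmx U *m invmx X *m invmx U^T.
  by rewrite !invmx_mul ?unitmx_mul ?uUT ?uX // mulmxA.
rewrite /beta invE !scalarsM.
have -> : scalars A (invmx U) *m scalars A (invmx X) *m scalars A (invmx U^T) *m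
   ((scalars A U)^T *m dX *m scalars A U) =
   scalars A (invmx U) *m (scalars A (invmx X) *m dX) *m scalars A U.
  rewrite -!mulmxA; congr (_ *m (_ *m _)); rewrite !mulmxA; congr (_ *m _).
  have -> : (scalars A U)^T = scalars A U^T by rewrite /scalars map_trmx.
  by rewrite -scalarsM mulVmx // scalars1 mul1mx.
set P := scalars A (invmx X) *m dX.
(* The congruence conjugates X^-1 dX by U, hence all its powers. *)
have -> : (scalars A (invmx U) *m P *m scalars A U) ^+ (4 * k + 1) =
    scalars A (invmx U) *m (P ^+ (4 * k + 1)) *m scalars A U.
  elim: (4 * k + 1)%N => [|j IH].
    by rewrite !expr0 mulmx1 -scalarsM mulVmx // scalars1.
  rewrite !exprS IH -!mulmxE !mulmxA; congr (_ *m _ *m _).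
  rewrite -!mulmxA; congr (_ *m (_ *m _)).
  by rewrite -scalarsM mulmxV // scalars1 mulmx1.
rewrite -mulmxA trace_scalars_mulC -mulmxA -scalarsM mulmxV //.
by rewrite scalars1 mulmx1.
Qed.

Hypothesis n_even : ~~ odd n.

Let even_idx (i : 'I_n./2) := Ordinal (pfaffian_even_lt i).
Let odd_idx (i : 'I_n./2) := Ordinal (pfaffian_odd_lt i).

Fact half_idx_subproof (j : 'I_n) : (j./2 < n./2)%N.
Proof. by rewrite ltn_half_double even_halfK ?ltn_ord. Qed.

Let half_idx j := Ordinal (half_idx_subproof j).

Let half_even i : half_idx (even_idx i) = i.
Proof. by apply: val_inj; rewrite /= doubleK. Qed.

Let half_odd i : half_idx (odd_idx i) = i.
Proof. by apply: val_inj; rewrite /= uphalf_double. Qed.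

Let idxE (j : 'I_n) : j = if odd j then odd_idx (half_idx j) else even_idx (half_idx j).
Proof.
by apply: val_inj; rewrite -[LHS]odd_double_half; case: (odd j).
Qed.

Lemma prod_even_odd (g : 'I_n -> R) :
  \prod_j g j = \prod_(i < n./2) (g (even_idx i) * g (odd_idx i)).
Proof.
rewrite (partition_big half_idx xpredT) //=; apply: eq_bigr => i _.
have neq : even_idx i != odd_idx i by rewrite -val_eqE /= neq_ltn ltnSn.
rewrite (bigD1 (even_idx i)) /= ?half_even //.
rewrite (bigD1 (odd_idx i)) /= ?half_odd ?eqxx 1?eq_sym // big1 ?mulr1 //.
move=> j /andP[/andP[/eqP hj]]; rewrite (idxE j) hj.
by case: ifP => _; rewrite eqxx.
Qed.

(** Expanding every entry chooses a pair of rows [F i] of U for each factor i; for fixed F, the sum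
    over permutations is the determinant of the matrix of chosen rows. The factors M keep their
    order throughout, as A is not commutative. *)
Lemma pfaffian_congr M U :
  pfaffian ((scalars A U)^T *m M *m scalars A U) = \det U *: pfaffian M.
Proof.
rewrite /pfaffian [RHS]scalerA [in RHS]mulrC -[RHS]scalerA; congr (_ *: _).
pose T := {ffun 'I_n./2 -> 'I_n * 'I_n}.
pose coef (F : T) (s : 'S_n) := \prod_(i < n./2)
  (U (F i).1 (s (even_idx i)) * U (F i).2 (s (odd_idx i))).
pose mon (F : T) : A := \prod_(i < n./2) M (F i).1 (F i).2.
have expand (s : 'S_n) : \prod_(i < n./2) ((scalars A U)^T *m M *m scalars A U)
      (s (even_idx i)) (s (odd_idx i)) = \sum_F coef F s *: mon F.
  under eq_bigr => i _.
    rewrite mxE; under eq_bigr => b _.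
      rewrite mxE mulr_suml; under eq_bigr => a _.
        rewrite !mxE /= mulr_algl mulr_algr scalerA; over.
      over.
    rewrite exchange_big pair_bigA /=; over.
  rewrite bigA_distr_bigA; apply: eq_bigr => F _.
  rewrite /coef /mon; elim: (index_enum _) => [|i r IH].
    by rewrite !big_nil scale1r.
  by rewrite !big_cons IH /= -scalerAl -scalerAr scalerA [in LHS](mulrC (U _ _)).
under eq_bigr => s _ do rewrite expand mulr_sumr.
rewrite exchange_big /=.
pose idx (F : T) (j : 'I_n) := if odd j then (F (half_idx j)).2 else (F (half_idx j)).1.
have idx_even F i : idx F (even_idx i) = (F i).1.
  by rewrite /idx half_even /= odd_double.
have idx_odd F i : idx F (odd_idx i) = (F i).2.
  by rewrite /idx half_odd /= odd_double.
have sumE F : \sum_(s : 'S_n) (-1) ^+ s * (coef F s *: mon F) =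
    \det (\matrix_(j, k) U (idx F j) k) *: mon F.
  rewrite /determinant scaler_suml; apply: eq_bigr => s _.
  have -> : \prod_j (\matrix_(j, k) U (idx F j) k) j (s j) = coef F s.
    rewrite prod_even_odd; apply: eq_bigr => i _.
    by rewrite !mxE idx_even idx_odd.
  by rewrite !mulr_sign; case: (odd_perm s); rewrite ?scaleNr.
(* A repeated row gives determinant 0, so only the choices F that come from permutations remain. *)
rewrite (eq_bigr _ (fun F _ => sumE F)) (bigID (fun F => injectiveb (idx F))) /=.
rewrite [X in _ + X]big1 ?addr0; last first.
  move=> F /injectivePn[j [k njk eqjk]].
  rewrite (determinant_alternate njk) ?scale0r // => l.
  by rewrite !mxE eqjk.
pose ofperm (t : 'S_n) : T := [ffun i => (t (even_idx i), t (odd_idx i))].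
have idx_ofperm t j : idx (ofperm t) j = t j.
  by rewrite /idx [in RHS](idxE j); case: ifP => _; rewrite ffunE.
(* The default [1] is never taken when [idx F] is injective. *)
pose toperm (F : T) : 'S_n := odflt 1%g [pick t : 'S_n | [forall j, t j == idx F j]].
rewrite (reindex_onto ofperm toperm) /=; last first.
  move=> F /injectiveP injF; rewrite /toperm; case: pickP => [t /forallP tF|].
    apply/ffunP => i; rewrite ffunE (eqP (tF _)) (eqP (tF _)) idx_even idx_odd.
    by case: (F i).
  by move/(_ (perm injF))/negP; case; apply/forallP => j; rewrite permE.
rewrite scaler_sumr; apply: eq_big => [t|t _].
  have -> : toperm (ofperm t) = t.
    rewrite /toperm; case: pickP => [u /forallP ut|].
      by apply/permP => j; rewrite (eqP (ut j)) idx_ofperm.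
    by move/(_ t)/negP; case; apply/forallP => j; rewrite idx_ofperm.
  by rewrite eqxx andbT; apply/injectiveP => j k; rewrite !idx_ofperm; exact: perm_inj.
have -> : \matrix_(j, k) U (idx (ofperm t) j) k = row_perm t U.
  by apply/matrixP => j k; rewrite !mxE idx_ofperm.
rewrite row_permE det_mulmx det_perm -scalerA.
have -> : mon (ofperm t) = \prod_(i < n./2) M (t (even_idx i)) (t (odd_idx i)).
  by apply: eq_bigr => i _; rewrite ffunE.
by rewrite scaler_sign mulr_sign; case: (odd_perm t); rewrite ?scalerN.
Qed.

End Congruence.

Lemma canonical_form_congr (A : algType R) n w (X U : 'M[R]_n) (dX : 'M[A]_n) :
  X \in unitmx -> U \in unitmx ->
  canonical_form w (U^T *m X *m U) ((scalars A U)^T *m dX *m scalars A U) =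
  Num.sg (\det U) *: canonical_form w X dX.
Proof.
move=> uX uU; rewrite /canonical_form scalerAr; congr (_ * _).
  apply: eq_bigr => t _; congr (_ *: _); apply: eq_bigr => k _; exact: beta_congr.
rewrite /phi; case: ifPn => [_|n_even]; first by rewrite scaler0.
have uUT : U^T \in unitmx by rewrite unitmx_tr.
have -> : (scalars A U)^T *m dX *m scalars A U *m scalars A (invmx (U^T *m X *m U)) *m
    ((scalars A U)^T *m dX *m scalars A U) =
    (scalars A U)^T *m (dX *m scalars A (invmx X) *m dX) *m scalars A U.
  have -> : (scalars A U)^T = scalars A U^T by rewrite /scalars map_trmx.
  rewrite !invmx_mul ?unitmx_mul ?uUT ?uX // !scalarsM.
  rewrite -!mulmxA; congr (_ *m (_ *m _)); rewrite !mulmxA; congr (_ *m _ *m _).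
  rewrite -scalarsM mulmxV // scalars1 mul1mx -mulmxA -scalarsM mulVmx //.
  by rewrite scalars1 mulmx1.
rewrite pfaffian_congr //; move: (pfaffian _) => pf; rewrite !scalerA; congr (_ *: _).
have dU0 : \det U != 0 by move: uU; rewrite unitmxE unitfE.
have -> : \det (U^T *m X *m U) = \det U ^+ 2 * \det X.
  by rewrite !det_mulmx det_tr mulrAC.
rewrite sqrtrM ?sqr_ge0 // sqrtr_sqr.
rewrite invfM mulrAC; congr (_ * _).
by rewrite {2}[\det U]numEsg mulrCA mulVf ?mulr1 // normr_eq0.
Qed.

(** * Degrees of the canonical forms *)

Section Homogeneity.
Variables (m n : nat) (X : 'M[R]_n).
Implicit Types (M N dX : 'M[ext R m]_n).

Definition homog_mx (k : nat) M := forall i j, homog k (M i j).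

Lemma homog_mxM j k M N : homog_mx j M -> homog_mx k N -> homog_mx (j + k)%N (M *m N).
Proof. by move=> hM hN a b; rewrite mxE; apply: homog_sum => c _; exact: homogM. Qed.

Lemma homog_mx_scalars (U : 'M[R]_n) : homog_mx 0%N (scalars _ U).
Proof. by move=> a b; rewrite mxE; exact: homog_alg. Qed.

Lemma homog_mxX k M : homog_mx 1%N M -> homog_mx k (M ^+ k).
Proof.
move=> hM; elim: k => [|k IH]; last by rewrite exprS -mulmxE; exact: (homog_mxM hM).
by rewrite expr0; have := @homog_mx_scalars 1%:M; rewrite scalars1.
Qed.

Lemma homog_trace k M : homog_mx k M -> homog k (\tr M).
Proof. by move=> hM; apply: homog_sum. Qed.

Lemma homog_mx_logder dX : homog_mx 1%N dX -> homog_mx 1%N (scalars _ (invmx X) *m dX).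
Proof. by move=> h; apply: (@homog_mxM 0%N 1%N) => //; exact: homog_mx_scalars. Qed.

Lemma homog_beta k dX : homog_mx 1%N dX -> homog (4 * k + 1)%N (beta k X dX).
Proof. by move=> h; apply/homog_trace/homog_mxX/homog_mx_logder. Qed.

Lemma homog_pfaffian M : ~~ odd n -> homog_mx 2%N M -> homog n (pfaffian M).
Proof.
move=> n_even hM; apply/homogZ/homog_sum => s _.
have nE : (n./2 * 2)%N = n by rewrite muln2 even_halfK.
have := @homog_prod R m _ (index_enum 'I_n./2) (fun=> 2%N) (fun i => M
  (s (Ordinal (pfaffian_even_lt i))) (s (Ordinal (pfaffian_odd_lt i)))).
rewrite sum_nat_const card_ord mulr_sign; set P := \prod_(_ <- _) _.
rewrite nE => /(_ (fun i => hM _ _)) hP.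
by case: ifP => // _; exact: homogN.
Qed.

Lemma homog_canonical_form d w dX : homogeneous d w -> homog_mx 1%N dX ->
  homog (d + n)%N (canonical_form w X dX).
Proof.
move=> /allP hw hX; apply: homogM.
  rewrite /eval_canonical big_seq; apply: homog_sum => t /hw/andP[_ /eqP <-].
  by apply/homogZ/homog_prod => k; exact: homog_beta.
rewrite /phi; case: ifPn => [_|n_even]; first exact: homog0.
apply/homogZ/homog_pfaffian => //; apply: (@homog_mxM 1%N 1%N) => //.
by apply: (@homog_mxM 1%N 0%N) => //; exact: homog_mx_scalars.
Qed.

Lemma trace_mulC_odd j k M N : odd j -> odd k -> homog_mx j M -> homog_mx k N ->
  \tr (M *m N) = - \tr (N *m M).
Proof.
move=> oj ok hM hN; rewrite /mxtrace; under eq_bigr => a _ do rewrite mxE.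
rewrite exchange_big -sumrN; apply: eq_bigr => b _; rewrite mxE -sumrN.
by apply: eq_bigr => a _; apply: wedge_anticomm (hM _ _) (hN _ _).
Qed.

End Homogeneity.

(** The Pfaffian form sees D only through D X^-1 D, and homogeneity excludes beta^1 = d log det X,
    which the shifts below do change. *)
Lemma eq_canonical_form (A : algType R) n d w (X : 'M[R]_n) (D D' : 'M[A]_n) :
  homogeneous d w ->
  (forall k, (0 < k)%N -> beta k X D = beta k X D') ->
  D *m scalars A (invmx X) *m D = D' *m scalars A (invmx X) *m D' ->
  canonical_form w X D = canonical_form w X D'.
Proof.
move=> /allP hw hb quadE; rewrite /canonical_form /phi quadE; congr (_ * _).
apply: eq_big_seq => t /hw/andP[/allP ht _]; congr (_ *: _).
by apply: eq_big_seq => k /ht; exact: hb.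
Qed.

(* Invariance under dX |-> dX - al X E for a 1-form al and a constant matrix E
   commuting with X and dX.  In the trace of an odd power, al^2 = 0 and
   anticommutation leave only the term al tr(P^(2k) E) with P = X^-1 dX, which
   vanishes by cyclicity; in dX X^-1 dX the terms linear in al cancel. *)
Section AnticommutingShift.
Variables (A : algType R) (n : nat) (P a e : 'M[A]_n).
Hypotheses (Pa : P *m a = - (a *m P)) (a_sq : a *m a = 0).
Hypotheses (e_a : e *m a = a *m e) (eP : e *m P = P *m e).

Lemma sqr_anticomm_shift : (P - a *m e) *m (P - a *m e) = P *m P.
Proof.
have h1 : P *m (a *m e) = - (a *m P *m e) by rewrite mulmxA Pa mulNmx.
have h2 : (a *m e) *m P = a *m P *m e by rewrite -mulmxA eP mulmxA.
have h3 : (a *m e) *m (a *m e) = 0.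
  by rewrite mulmxA -(mulmxA a) e_a mulmxA a_sq !mul0mx.
by rewrite mulmxBl !mulmxBr h1 h2 h3 subr0 opprK addrK.
Qed.

Lemma even_exp_anticomm_shift k : (P - a *m e) ^+ (2 * k) = P ^+ (2 * k).
Proof. by rewrite !exprM !expr2 -!mulmxE sqr_anticomm_shift. Qed.

Lemma even_exp_anticomm k : P ^+ (2 * k) *m a = a *m P ^+ (2 * k).
Proof.
have : (P *m P) *m a = a *m (P *m P).
  by rewrite -(mulmxA P P a) Pa mulmxN (mulmxA P a P) Pa mulNmx opprK mulmxA.
rewrite exprM expr2 -mulmxE; move: (P *m P) => Q Qa.
elim: k => [|i IH]; first by rewrite !expr0 mulmx1 mul1mx.
by rewrite exprS -!mulmxE -mulmxA IH mulmxA Qa -mulmxA.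
Qed.

Lemma odd_exp_anticomm_shift k :
  (P - a *m e) ^+ (2 * k).+1 = P ^+ (2 * k).+1 - a *m (P ^+ (2 * k) *m e).
Proof.
rewrite !(exprSr _ (2 * k)%N) even_exp_anticomm_shift -!mulmxE mulmxBr; congr (_ - _).
by rewrite (mulmxA _ a e) even_exp_anticomm -mulmxA.
Qed.

End AnticommutingShift.

Lemma trace_even_exp m n (P : 'M[ext R m]_n) (E : 'M[R]_n) k :
  homog_mx 1%N P -> scalars _ E *m P = P *m scalars _ E -> (0 < k)%N ->
  \tr (P ^+ (2 * k) *m scalars _ E) = 0.
Proof.
case: k => // k hP eP _; set e := scalars _ E in eP *.
rewrite mul2n doubleS -muln2 mulnC; set j := (2 * k).+1.
have j_odd : odd j by rewrite /j /= oddM.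
have Pl : P ^+ j.+1 = P *m P ^+ j by rewrite mulmxE -exprS.
have Pr : P ^+ j.+1 = P ^+ j *m P by rewrite mulmxE -exprSr.
have hPe : homog_mx j (P ^+ j *m e).
  have h := homog_mxM (homog_mxX (k := j) hP) (@homog_mx_scalars m n E).
  by rewrite addn0 in h; exact: h.
(* Splitting off one P leaves P^j E, also of odd degree, and cyclicity for two odd forms brings a
   minus sign. *)
have trE : \tr (P ^+ j.+1 *m e) = - \tr (P ^+ j.+1 *m e).
  transitivity (\tr (P *m (P ^+ j *m e))); first by rewrite mulmxA -Pl.
  rewrite (trace_mulC_odd _ j_odd hP hPe) //.
  by rewrite -(mulmxA _ e P) eP mulmxA -Pr.
move: (\tr _) trE => x xN; apply/ffunP => S.
have : x S = (-1 *: x) S by rewrite scaleN1r -xN.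
rewrite ffunE scaleN1r => xS; rewrite [RHS]ffunE; lra.
Qed.

Section Shift.
Variables (m n : nat) (X E : 'M[R]_n) (dX : 'M[ext R m]_n) (al : ext R m).
Hypotheses (uX : X \in unitmx) (hdX : homog_mx 1%N dX) (hal : homog 1%N al).
Hypotheses (al_sq : al * al = 0) (EX : E *m X = X *m E).
Hypothesis EdX : scalars _ E *m dX = dX *m scalars _ E.

Lemma mul_mx_scalarE (A : pzRingType) (c : A) (M : 'M[A]_n) i j :
  (M *m c%:M) i j = M i j * c.
Proof.
rewrite mxE (bigD1 j) //= mxE eqxx mulr1n big1 ?addr0 // => k /negbTE kj.
by rewrite mxE kj mulr0n mulr0.
Qed.

Lemma scalars_mul_scalar (A : algType R) (c : A) (U : 'M[R]_n) :
  scalars A U *m c%:M = c%:M *m scalars A U.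
Proof.
apply/matrixP => i j; rewrite mul_mx_scalarE mul_scalar_mx !mxE /=.
by rewrite mulr_algl mulr_algr.
Qed.

Lemma homog_mx_anticomm (M : 'M[ext R m]_n) :
  homog_mx 1%N M -> M *m al%:M = - (al%:M *m M).
Proof.
move=> hM; apply/matrixP => i j; rewrite mul_mx_scalarE mul_scalar_mx !mxE.
by apply: wedge_anticomm (hM _ _) hal.
Qed.

Lemma scalar_mx_sq : al%:M *m al%:M = 0 :> 'M[ext R m]_n.
Proof. by rewrite -scalar_mxM al_sq; apply/matrixP => i j; rewrite !mxE mul0rn. Qed.

Definition shift : 'M[ext R m]_n := dX - al%:M *m scalars _ (X *m E).

Lemma scalars_invmxC :
  scalars (ext R m) E *m scalars _ (invmx X) = scalars _ (invmx X) *m scalars _ E.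
Proof.
rewrite -!scalarsM; congr (scalars _ _).
rewrite -[LHS]mul1mx -(mulVmx uX) -!mulmxA; congr (_ *m _).
by rewrite mulmxA -EX mulmxK.
Qed.

Lemma logder_shift : scalars _ (invmx X) *m shift =
  scalars _ (invmx X) *m dX - al%:M *m scalars _ E.
Proof.
rewrite /shift mulmxBr mulmxA scalars_mul_scalar -mulmxA -scalarsM.
by rewrite mulKmx.
Qed.

Lemma beta_shift k : (0 < k)%N -> beta k X shift = beta k X dX.
Proof.
move=> k0; rewrite /beta logder_shift.
have hP := homog_mx_logder X hdX.
have eP : scalars _ E *m (scalars _ (invmx X) *m dX) =
    scalars _ (invmx X) *m dX *m scalars _ E.
  by rewrite mulmxA scalars_invmxC -(mulmxA _ _ dX) EdX mulmxA.
move: (scalars _ (invmx X) *m dX) hP eP => P hP eP.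
have -> : (4 * k + 1 = (2 * (2 * k)).+1)%N by rewrite addn1 mulnA.
have -> := odd_exp_anticomm_shift (homog_mx_anticomm hP) scalar_mx_sq
  (scalars_mul_scalar al E) eP (2 * k)%N.
rewrite raddfB /= -[RHS]subr0; congr (_ - _); rewrite mul_scalar_mx.
have trZ M : \tr (al *: M : 'M[ext R m]_n) = al * \tr M.
  by rewrite /mxtrace mulr_sumr; apply: eq_bigr => i _; rewrite mxE.
by rewrite trZ trace_even_exp ?mulr0 // muln_gt0.
Qed.

Lemma canonical_form_shift w d : homogeneous d w ->
  canonical_form w X shift = canonical_form w X dX.
Proof.
move=> hw; apply: (eq_canonical_form hw); first exact: beta_shift.
have dXa := homog_mx_anticomm hdX; have aa := scalar_mx_sq.
have exi := scalars_invmxC;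
have axi := scalars_mul_scalar al (invmx X).
have ae := scalars_mul_scalar al E.
have xix : scalars (ext R m) (invmx X) *m scalars _ X = 1%:M.
  by rewrite -scalarsM mulVmx // scalars1.
have xxi : scalars (ext R m) X *m scalars _ (invmx X) = 1%:M.
  by rewrite -scalarsM mulmxV // scalars1.
rewrite /shift scalarsM; move: (al%:M) dXa aa axi ae => a dXa aa axi ae.
move: EdX exi axi ae xix xxi.
move: (scalars _ E) (scalars _ X) (scalars _ (invmx X)) => e x xi.
move=> eD exi axi ae xix xxi.
have t1 : dX *m xi *m (a *m (x *m e)) = - (a *m dX *m e).
  by rewrite -mulmxA (mulmxA xi a) axi -(mulmxA a xi) (mulmxA xi x) xix mul1mx mulmxA dXa mulNmx.
have t2 : a *m (x *m e) *m xi *m dX = a *m dX *m e.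
  by rewrite -(mulmxA a) -(mulmxA x) exi (mulmxA x) xxi mul1mx -mulmxA eD mulmxA.
have t3 : a *m (x *m e) *m xi *m (a *m (x *m e)) = 0.
  rewrite -(mulmxA a) -(mulmxA x) exi (mulmxA x) xxi mul1mx.
  by rewrite -(mulmxA a e) (mulmxA e) ae -(mulmxA a e) mulmxA aa mul0mx.
rewrite mulmxBl mulmxBl !mulmxBr t1 t3 t2 opprK subr0.
by rewrite addrK.
Qed.

End Shift.
End CanonicalForm.

(* Used for measurable functions and for bounded Lipschitz functions. *)
Section FunctionSubring.
Variables (R : realType) (T : Type) (P : (T -> R) -> Prop).

Record function_subring : Prop := FunctionSubring {
  fs_cst : forall c : R, P (fun=> c);
  fs_add : forall f g, P f -> P g -> P (fun t => f t + g t);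
  fs_mul : forall f g, P f -> P g -> P (fun t => f t * g t) }.

Hypothesis hP : function_subring.

Lemma fs_eq f g : f =1 g -> P f -> P g.
Proof. by move=> /funext ->. Qed.

Lemma fs_sum (I : Type) (r : seq I) (Q : pred I) (F : I -> T -> R) :
  (forall i, Q i -> P (F i)) -> P (fun t => \sum_(i <- r | Q i) F i t).
Proof.
move=> hF; elim: r => [|i r IH].
  by apply: fs_eq (fs_cst hP 0) => t; rewrite big_nil.
case: (boolP (Q i)) => Qi; last first.
  by apply: fs_eq IH => t; rewrite big_cons (negbTE Qi).
by apply: fs_eq (fs_add hP (hF _ Qi) IH) => t; rewrite big_cons Qi.
Qed.

Lemma fs_prod (I : Type) (r : seq I) (Q : pred I) (F : I -> T -> R) :
  (forall i, Q i -> P (F i)) -> P (fun t => \prod_(i <- r | Q i) F i t).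
Proof.
move=> hF; elim: r => [|i r IH].
  by apply: fs_eq (fs_cst hP 1) => t; rewrite big_nil.
case: (boolP (Q i)) => Qi; last first.
  by apply: fs_eq IH => t; rewrite big_cons (negbTE Qi).
by apply: fs_eq (fs_mul hP (hF _ Qi) IH) => t; rewrite big_cons Qi.
Qed.

Lemma fs_det n (M : T -> 'M[R]_n) :
  (forall i j, P (fun t => M t i j)) -> P (fun t => \det (M t)).
Proof.
move=> hM; apply: fs_sum => s _; apply: fs_mul => //; first exact: fs_cst.
exact: fs_prod.
Qed.

(** A subring need not be closed under inverses, so membership of the inverse determinant is
    assumed: for Lipschitz functions it comes from a lower bound on the determinant, for measurable
    ones from real powers. *)
Lemma fs_invmx n (M : T -> 'M[R]_n) :
  (forall t, M t \in unitmx) -> (forall i j, P (fun t => M t i j)) ->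
  P (fun t => (\det (M t))^-1) ->
  forall i j, P (fun t => invmx (M t) i j).
Proof.
move=> uM hM hd i j.
apply: (@fs_eq (fun t => (\det (M t))^-1 * cofactor (M t) j i)) => [t|].
  by rewrite /invmx uM !mxE.
apply: fs_mul => //; apply: fs_mul => //; first exact: fs_cst.
by apply: fs_det => k l; apply: fs_eq (hM (lift j k) (lift i l)) => t; rewrite !mxE.
Qed.

Variable m : nat.
Local Notation A := (ext R m).

Definition ext_in (F : T -> A) := forall S, P (fun t => F t S).

Lemma ext_in_cst (c : A) : ext_in (fun=> c).
Proof. by move=> S; exact: fs_cst. Qed.

Lemma ext_in_add F G : ext_in F -> ext_in G -> ext_in (fun t => F t + G t).
Proof.
move=> hF hG S; apply: fs_eq (fs_add hP (hF S) (hG S)) => t.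
by rewrite ffunE.
Qed.

Lemma ext_in_mul F G : ext_in F -> ext_in G -> ext_in (fun t => F t * G t).
Proof.
move=> hF hG S.
apply: (@fs_eq (fun t => \sum_(B : {set 'I_m} | B \subset S)
    (-1) ^+ inversions B (S :\: B) * (F t B * G t (S :\: B)))) => [t|].
  by rewrite ffunE.
apply: fs_sum => B _; apply: fs_mul => //; first exact: fs_cst.
exact: fs_mul.
Qed.

Lemma ext_in_scale f F : P f -> ext_in F -> ext_in (fun t => f t *: F t).
Proof.
move=> hf hF S; apply: fs_eq (fs_mul hP hf (hF S)) => t.
by rewrite ffunE.
Qed.

Lemma ext_in_sum (I : Type) (r : seq I) (Q : pred I) (F : I -> T -> A) :
  (forall i, Q i -> ext_in (F i)) -> ext_in (fun t => \sum_(i <- r | Q i) F i t).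
Proof.
move=> hF; elim: r => [|i r IH] S.
  by apply: fs_eq (ext_in_cst 0 S) => t; rewrite big_nil.
case: (boolP (Q i)) => Qi; last first.
  by apply: fs_eq (IH S) => t; rewrite big_cons (negbTE Qi).
by apply: fs_eq (ext_in_add (hF _ Qi) IH S) => t; rewrite big_cons Qi.
Qed.

Lemma ext_in_prod (I : Type) (r : seq I) (F : I -> T -> A) :
  (forall i, ext_in (F i)) -> ext_in (fun t => \prod_(i <- r) F i t).
Proof.
move=> hF; elim: r => [|i r IH] S.
  by apply: fs_eq (ext_in_cst 1 S) => t; rewrite big_nil.
by apply: fs_eq (ext_in_mul (hF i) IH S) => t; rewrite big_cons.
Qed.

Variable n : nat.

Definition mx_in (M : T -> 'M[A]_n) := forall i j, ext_in (fun t => M t i j).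

Lemma mx_in_mul M N : mx_in M -> mx_in N -> mx_in (fun t => M t *m N t).
Proof.
move=> hM hN i j S.
suff h : ext_in (fun t => \sum_k M t i k * N t k j).
  by apply: fs_eq (h S) => t; rewrite mxE.
by apply: ext_in_sum => k _; exact: ext_in_mul.
Qed.

Lemma mx_in_exp M k : mx_in M -> mx_in (fun t => M t ^+ k).
Proof.
move=> hM; elim: k => [|k IH] i j S.
  by apply: fs_eq (ext_in_cst ((1 : 'M[A]_n) i j) S) => t; rewrite expr0.
by apply: fs_eq (mx_in_mul hM IH i j S) => t; rewrite exprS.
Qed.

(** The coefficients are polynomials in the entries of X^-1, the coefficients of dX and
    det(X)^(-1/2). *)
Lemma ext_in_canonical_form w (X : T -> 'M[R]_n) (dX : T -> 'M[A]_n) :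
  (forall i j, P (fun t => invmx (X t) i j)) -> mx_in dX ->
  P (fun t => (Num.sqrt (\det (X t)))^-1) ->
  ext_in (fun t => canonical_form w (X t) (dX t)).
Proof.
move=> hX hdX hsqrt.
have hXA : mx_in (fun t => scalars _ (invmx (X t))).
  move=> i j S.
  apply: fs_eq (ext_in_scale (hX i j) (ext_in_cst 1) S) => t.
  by rewrite [scalars _ _ _ _]mxE.
apply: ext_in_mul.
  apply: ext_in_sum => c _; apply: ext_in_scale; first exact: fs_cst.
  apply: ext_in_prod => k; apply: ext_in_sum => i _.
  by apply: mx_in_exp; exact: mx_in_mul.
rewrite /phi; case: (odd n); first exact: ext_in_cst.
apply: ext_in_scale => //; apply: ext_in_scale; first exact: fs_cst.
apply: ext_in_sum => s _; apply: ext_in_mul; first exact: ext_in_cst.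
apply: ext_in_prod => i; apply: (mx_in_mul (M := fun t => _ *m _)) => //.
exact: mx_in_mul.
Qed.

End FunctionSubring.

(** * Gram matrices *)

Section CauchyBinet.
Variables (R : realFieldType) (m n : nat).
Implicit Types (x : 'rV[R]_m) (N : 'M[R]_(m, n)) (f : {ffun 'I_n -> 'I_m}).

Definition gram x N : 'M[R]_n := N^T *m diag_mx x *m N.

Lemma gramE x N i j : gram x N i j = \sum_k x 0 k * (N k i * N k j).
Proof.
rewrite mxE; apply: eq_bigr => k _; rewrite mul_mx_diag !mxE.
by rewrite mulrAC mulrC.
Qed.

Lemma det_gram_expand x N :
  \det (gram x N) =
  \sum_(f : {ffun 'I_n -> 'I_m}) (\prod_j (x 0 (f j) * N (f j) j)) * \det (rowsub f N).
Proof.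
rewrite /determinant.
under eq_bigr => s _.
  under eq_bigr => j _ do rewrite gramE.
  rewrite bigA_distr_bigA mulr_sumr; over.
rewrite exchange_big; apply: eq_bigr => f _; rewrite mulr_sumr.
apply: eq_bigr => s _; rewrite mulrCA; congr (_ * _); rewrite -big_split /=.
by apply: eq_bigr => j _; rewrite mxE mulrA.
Qed.

(** The Cauchy-Binet formula with ordered choices of rows: each set of n rows occurs n! times, and a
    choice with a repeated row contributes 0. *)
Lemma det_gram x N :
  n`!%:R * \det (gram x N) =
  \sum_(f : {ffun 'I_n -> 'I_m}) (\prod_j x 0 (f j)) * \det (rowsub f N) ^+ 2.
Proof.
(* Take n! copies of the sum and reindex the copy of s by f composed with s; the sum over s then
   becomes a second determinant. *)
rewrite det_gram_expand mulrC mulr_natr -card_Sn -sumr_const.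
under eq_bigr => s _.
  rewrite (reindex (fun f => [ffun j => f (s j)])) /=; last first.
    exists (fun f => [ffun j => f (s^-1%g j)]) => f _; apply/ffunP => j;
      by rewrite !ffunE ?permK ?permKV.
  over.
rewrite exchange_big; apply: eq_bigr => f _.
have -> : \det (rowsub f N) ^+ 2 = \det (rowsub f N)^T * \det (rowsub f N).
  by rewrite det_tr expr2.
rewrite [RHS]mulrA [\det _^T]/determinant [X in _ = X * _]mulr_sumr mulr_suml.
rewrite (eq_bigl xpredT) => [|s]; last by rewrite inE.
apply: eq_bigr => s _; rewrite big_split /=.
have -> : \prod_j x 0 ([ffun j => f (s j)] j) = \prod_j x 0 (f j).
  rewrite [RHS](reindex_inj (@perm_inj _ s)) /=.
  by apply: eq_bigr => j _; rewrite ffunE.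
have -> : rowsub [ffun j => f (s j)] N = row_perm s (rowsub f N).
  by apply/matrixP => j k; rewrite !mxE ffunE.
rewrite row_permE det_mulmx det_perm mulrA; congr (_ * _).
rewrite -mulrA; congr (_ * _); rewrite mulrC; congr (_ * _).
by apply: eq_bigr => j _; rewrite !mxE ffunE.
Qed.

Lemma det_gram_ge x N f : (forall i, 0 <= x 0 i) ->
  (\prod_j x 0 (f j)) * \det (rowsub f N) ^+ 2 <= n`!%:R * \det (gram x N).
Proof.
move=> x0; rewrite det_gram (bigD1 f) //= lerDl; apply: sumr_ge0 => g _.
by apply: mulr_ge0; [exact: prodr_ge0 | exact: sqr_ge0].
Qed.

Lemma det_gram_gt0 x N f : (forall i, 0 < x 0 i) -> \det (rowsub f N) != 0 ->
  0 < \det (gram x N).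
Proof.
move=> x0 df; have := det_gram_ge N f (fun i => ltW (x0 i)).
have : 0 < (\prod_j x 0 (f j)) * \det (rowsub f N) ^+ 2.
  by rewrite mulr_gt0 ?prodr_gt0 // exprn_even_gt0.
by move=> /lt_le_trans/[apply]; rewrite pmulr_rgt0 // ltr0n fact_gt0.
Qed.

Lemma gram_mulmx x N (U : 'M[R]_n) : gram x (N *m U) = U^T *m gram x N *m U.
Proof. by rewrite /gram trmx_mul !mulmxA. Qed.

End CauchyBinet.

(** * The form eta and its symmetries *)

Section GramForm.
Variables (R : realType) (m n : nat).
Implicit Types (x c : 'rV[R]_m) (N : 'M[R]_(m, n)).

Definition gram_form (A : algType R) (y : 'rV[A]_m) N : 'M[A]_n :=
  (map_mx (in_alg A) N)^T *m diag_mx y *m map_mx (in_alg A) N.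

Lemma gram_formE (A : algType R) (y : 'rV[A]_m) N i j :
  gram_form y N i j = \sum_k (N k i * N k j) *: y 0 k.
Proof.
rewrite mxE; apply: eq_bigr => k _; rewrite mul_mx_diag !mxE /=.
by rewrite mulr_algl mulr_algr scalerA mulrC.
Qed.

Lemma gram_form_mulmx (A : algType R) (y : 'rV[A]_m) N (U : 'M[R]_n) :
  gram_form y (N *m U) = (scalars A U)^T *m gram_form y N *m scalars A U.
Proof.
by rewrite /gram_form /scalars !map_trmx trmx_mul !map_mxM /= !mulmxA.
Qed.

Lemma map_gram_form (A B : algType R) (f : {lrmorphism A -> B}) (y : 'rV[A]_m) N :
  map_mx f (gram_form y N) = gram_form (map_mx f y) N.
Proof.
apply/matrixP => i j; rewrite mxE !gram_formE rmorph_sum; apply: eq_bigr => k _.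
by rewrite [LHS]linearZ [in RHS]mxE.
Qed.

Definition dx_row : 'rV[ext R m]_m := \row_i dx R i.

Definition eta w x N : ext R m := canonical_form w (gram x N) (gram_form dx_row N).

Lemma homog_gram_form (y : 'rV[ext R m]_m) N :
  (forall i, homog 1%N (y 0 i)) -> homog_mx 1%N (gram_form y N).
Proof.
by move=> hy i j; rewrite gram_formE; apply: homog_sum => k _; exact: homogZ.
Qed.

Lemma homog_eta d w x N : homogeneous d w -> homog (d + n) (eta w x N).
Proof.
move=> hw; apply: homog_canonical_form => //; apply: homog_gram_form => i.
by rewrite mxE; exact: homog_dx.
Qed.

Lemma ext_map_eta L w x N :
  ext_map L (eta w x N) =
  canonical_form w (gram x N) (gram_form (\row_i linear_form (row i L)) N).
Proof.
have -> : (\row_i linear_form (row i L)) = map_mx (ext_map L) dx_row.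
  by apply/rowP => i; rewrite !mxE ext_map_dx.
rewrite /eta -(map_gram_form (ext_map L)).
exact/esym/(canonical_form_natural (ext_map L)).
Qed.

Lemma eta_mulmx w x N (U : 'M[R]_n) : gram x N \in unitmx -> U \in unitmx ->
  eta w x (N *m U) = Num.sg (\det U) *: eta w x N.
Proof.
by move=> uX uU; rewrite /eta gram_mulmx gram_form_mulmx canonical_form_congr.
Qed.

(** Both Gram matrices are quadratic in the rows, so rescaling the rows by c is pulling back along
    x_i -> c_i^2 x_i. *)
Lemma eta_row_scale w x c N :
  eta w x (diag_mx c *m N) =
  ext_map (diag_mx (\row_i (c 0 i ^+ 2))) (eta w (\row_i (c 0 i ^+ 2 * x 0 i)) N).
Proof.
have XE : gram x (diag_mx c *m N) = gram (\row_i (c 0 i ^+ 2 * x 0 i)) N.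
  apply/matrixP => i j; rewrite !gramE; apply: eq_bigr => k _.
  rewrite !mul_diag_mx !mxE; ring.
rewrite ext_map_eta /eta XE; set y := \row_i linear_form _.
suff -> : gram_form dx_row (diag_mx c *m N) = gram_form y N by [].
apply/matrixP => i j; rewrite [LHS]gram_formE [RHS]gram_formE.
apply: eq_bigr => k _; have -> : y 0 k = (c 0 k ^+ 2) *: dx R k by rewrite mxE linear_form_row_diag mxE.
have -> : dx_row 0 k = dx R k by rewrite mxE.
have cN l : (diag_mx c *m N) k l = c 0 k * N k l by rewrite mul_diag_mx mxE.
by rewrite !cN scalerA; congr (_ *: _); ring.
Qed.

Lemma gram_form_comm (A : algType R) (y : 'rV[A]_m) N (G : 'rV[R]_m) (E : 'M[R]_n) :
  E *m N^T = N^T *m diag_mx G -> N *m E = diag_mx G *m N ->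
  scalars A E *m gram_form y N = gram_form y N *m scalars A E.
Proof.
move=> ENT NE; rewrite /gram_form /scalars map_trmx.
have := congr1 (map_mx (in_alg A)) ENT; rewrite !map_mxM /= map_diag_mx => ENa.
have := congr1 (map_mx (in_alg A)) NE; rewrite !map_mxM /= map_diag_mx => NaE.
rewrite !mulmxA ENa -(mulmxA _ _ (map_mx _ E)) NaE !mulmxA; congr (_ *m _).
rewrite -(mulmxA _ (diag_mx _) (diag_mx y)) -(mulmxA _ (diag_mx y)); congr (_ *m _).
rewrite !mulmx_diag; congr diag_mx.
by apply/rowP => k; rewrite !mxE /= mulr_algl mulr_algr.
Qed.

(** N E = diag(G) N says that scaling the edges at rates G is induced by E on the columns. Hence X E
    is the Gram matrix with weights x_i G_i, and subtracting al X E from dX, where al is [dx i0],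
    replaces y_i by y_i - x_i G_i al. *)
Lemma gram_form_shift w d x N (G : 'rV[R]_m) (E : 'M[R]_n) (y : 'rV[ext R m]_m) i0 :
  homogeneous d w -> gram x N \in unitmx ->
  E^T = E -> N *m E = diag_mx G *m N ->
  (forall i, homog 1%N (y 0 i)) ->
  canonical_form w (gram x N)
    (gram_form (\row_i (y 0 i - (x 0 i * G 0 i) *: dx R i0)) N) =
  canonical_form w (gram x N) (gram_form y N).
Proof.
move=> hw uX ET NE hy.
have ENT : E *m N^T = N^T *m diag_mx G.
  by rewrite -{1}ET -trmx_mul NE trmx_mul tr_diag_mx.
have diagC : diag_mx G *m diag_mx x = diag_mx x *m diag_mx G.
  by rewrite !mulmx_diag; congr diag_mx; apply/rowP => i; rewrite !mxE mulrC.
have XE : gram x N *m E = N^T *m diag_mx x *m (diag_mx G *m N).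
  by rewrite /gram -mulmxA NE.
have EX : E *m gram x N = gram x N *m E.
  by rewrite XE /gram !mulmxA ENT -(mulmxA N^T) diagC !mulmxA.
have EdX := gram_form_comm (A := ext R m) y ENT NE.
apply: etrans (canonical_form_shift uX (homog_gram_form N hy) (@homog_dx R m i0)
  (dx_sq _ _) EX EdX hw).
apply: (congr1 (canonical_form w (gram x N))).
rewrite /shift XE mul_scalar_mx; apply/matrixP => i j; rewrite [LHS]gram_formE.
have -> : (gram_form y N - dx R i0 *: scalars _ (N^T *m diag_mx x *m (diag_mx G *m N))) i j
   = gram_form y N i j - dx R i0 * ((N^T *m diag_mx x *m (diag_mx G *m N)) i j)%:A.
  by rewrite !mxE.
rewrite gram_formE mulr_algr mul_diag_mx mxE scaler_suml -sumrB.
apply: eq_bigr => k _; rewrite mul_mx_diag !mxE scalerBr scalerA; congr (_ - _ *: _).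
by ring.
Qed.

(** For r_i = x_i / x_(t i), the one-form in row i is x_(t i) times the differential of the ratio
    x_i / x_(t i): the pullback removes the scaling direction. *)
Definition collapse (r : 'I_m -> R) (t : 'I_m -> 'I_m) : 'M[R]_m :=
  \matrix_(i, k) ((i == k)%:R - r i * (k == t i)%:R).

Lemma linear_form_collapse r t i :
  linear_form (row i (collapse r t)) = dx R i - r i *: dx R (t i).
Proof.
rewrite /linear_form.
under eq_bigr => k _ do rewrite !mxE scalerBl -scalerA.
rewrite sumrB -scaler_sumr; congr (_ - _ *: _).
  rewrite (bigD1 i) //= eqxx scale1r big1 ?addr0 // => k.
  by rewrite eq_sym => /negbTE ->; rewrite scale0r.
rewrite (bigD1 (t i)) //= eqxx scale1r big1 ?addr0 // => k.
by move=> /negbTE ->; rewrite scale0r.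
Qed.

Lemma row_collapse_eq0 r t i : r i = 1 -> t i = i -> row i (collapse r t) = 0.
Proof. by move=> ri ti; apply/rowP => k; rewrite !mxE ri ti mul1r eq_sym subrr. Qed.

Lemma eta_projective d w x N j : homogeneous d w -> gram x N \in unitmx ->
  x 0 j != 0 ->
  ext_map (collapse (fun i => x 0 i / x 0 j) (fun=> j)) (eta w x N) = eta w x N.
Proof.
move=> hw uX xj; rewrite ext_map_eta.
(* The scalar matrix 1 / x_j paired with the one-form dx_j: together they are the overall rescaling
   with one-form d log x_j. *)
have NE : N *m (x 0 j)^-1%:M = diag_mx (const_mx (x 0 j)^-1) *m N.
  by rewrite mul_mx_scalar diag_const_mx mul_scalar_mx.
have hdx i : homog 1%N (dx_row 0 i) by rewrite mxE; exact: homog_dx.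
apply: etrans (gram_form_shift j hw uX (tr_scalar_mx _ _) NE hdx).
apply: (congr1 (fun y => canonical_form w (gram x N) (gram_form y N))).
by apply/rowP => i; rewrite !mxE linear_form_collapse.
Qed.

(** By projectivity, eta /\ (d log x_i - d log x_j) is the pullback of eta /\ d log x_i along
    [collapse]. This is an m-form in m - 1 one-forms, because dx_j goes to 0. *)
Lemma eta_wedge_dlog d w x N i j : homogeneous d w -> gram x N \in unitmx ->
  (d + n).+1 = m -> x 0 i != 0 -> x 0 j != 0 ->
  (eta w x N * ((x 0 i)^-1 *: dx R i)) setT =
  (eta w x N * ((x 0 j)^-1 *: dx R j)) setT.
Proof.
move=> hw uX dm xi xj; set L := collapse (fun i => x 0 i / x 0 j) (fun=> j).
suff : eta w x N * ((x 0 i)^-1 *: dx R i) - eta w x N * ((x 0 j)^-1 *: dx R j) = 0.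
  by move/(congr1 (+%R^~ (eta w x N * ((x 0 j)^-1 *: dx R j)))); rewrite subrK add0r => ->.
have LE : ext_map L ((x 0 i)^-1 *: dx R i) = (x 0 i)^-1 *: dx R i - (x 0 j)^-1 *: dx R j.
  rewrite [LHS]linearZ /= ext_map_dx linear_form_collapse scalerBr scalerA mulrA.
  by rewrite mulVf // mul1r.
rewrite -mulrBr -LE -(eta_projective hw uX xj) -/L -rmorphM.
apply: (@ext_map_eq0 _ _ _ m).
  rewrite -[in X in homog X]dm -addn1; apply: homogM; first exact: homog_eta.
  by apply/homogZ/homog_dx.
move=> S cS; exists j; last by apply: row_collapse_eq0; rewrite ?divff.
suff -> : S = setT by rewrite inE.
by apply/eqP; rewrite eqEcard subsetT cardsT card_ord cS leqnn.
Qed.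

(* Shifting by the scalar matrix of each block removes dx_i and dx_j, so that
   eta has degree m - 1 in m - 2 one-forms. *)
Lemma eta_block_eq0 d w N (ga : {set 'I_m}) (c : 'I_n -> bool) i j :
  homogeneous d w -> gram (const_mx 1) N \in unitmx -> (d + n).+1 = m ->
  i \in ga -> j \notin ga -> (forall g e, (g \in ga) != c e -> N g e = 0) ->
  eta w (const_mx 1) N = 0.
Proof.
move=> hw uX dm iga jga Nbl.
pose t k := if k \in ga then i else j.
have ti : t i = i by rewrite /t iga.
have tj : t j = j by rewrite /t (negbTE jga).
suff etaE : ext_map (collapse (fun=> 1) t) (eta w (const_mx 1) N) = eta w (const_mx 1) N.
  rewrite -etaE; apply: (ext_map_eq0 (homog_eta _ _ hw)) => S cS.
  have [iS|iS] := boolP (i \in S); first by exists i => //; exact: row_collapse_eq0.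
  have [jS|jS] := boolP (j \in S); first by exists j => //; exact: row_collapse_eq0.
  have nij : i != j by apply: contraNneq jga => <-.
  have : (#|i |: (j |: S)%SET| <= m)%N by rewrite -[X in (_ <= X)%N]card_ord max_card.
  by rewrite cardsU1 cardsU1 !inE negb_or nij jS iS cS; lia.
(* The entries of N outside the blocks vanish, so scaling the rows of one block is the same as
   scaling its columns. *)
have NE (b : bool) : N *m diag_mx (\row_e (c e == b)%:R) =
    diag_mx (\row_g ((g \in ga) == b)%:R) *m N.
  apply/matrixP => g e; rewrite mul_mx_diag mul_diag_mx !mxE.
  have [->|/Nbl ->] := eqVneq (g \in ga) (c e); first by rewrite mulrC.
  by rewrite mulr0 mul0r.
have hdx k : homog 1%N (dx_row 0 k) by rewrite mxE; exact: homog_dx.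
rewrite ext_map_eta.
apply: etrans (gram_form_shift i hw uX (tr_diag_mx _) (NE true) hdx).
set y1 := \row_k (dx_row 0 k - _).
have hy1 k : homog 1%N (y1 0 k).
  by rewrite mxE; apply: homogD => //; apply/homogN/homogZ/homog_dx.
apply: etrans (gram_form_shift j hw uX (tr_diag_mx _) (NE false) hy1).
apply: (congr1 (fun y => canonical_form w (gram (const_mx 1) N) (gram_form y N))).
apply/rowP => k; rewrite !mxE linear_form_collapse /t !mul1r scale1r.
by case: (k \in ga); rewrite !(scale1r, scale0r, subr0).
Qed.

End GramForm.

(** * Bounds for the density *)

Section Bounds.
Variables (R : realType) (m n : nat).
Implicit Types (N : 'M[R]_(m, n)) (B : {ffun 'I_n -> 'I_m}).

Definition normalized N : Prop :=
  (exists B, rowsub B N = 1%:M) /\ forall i j, `|N i j| <= 1.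

(** The identity block alone contributes 1 to the Cauchy-Binet sum. *)
Lemma det_gram_normalized N : normalized N ->
  (n`!%:R)^-1 <= \det (gram (const_mx 1) N).
Proof.
move=> [[B NB] _].
have x0 i : 0 <= (const_mx 1 : 'rV[R]_m) 0 i by rewrite mxE.
have := det_gram_ge N B x0.
rewrite NB det1 expr1n mulr1 big1 => [|j _]; last by rewrite mxE.
have n0 : 0 < n`!%:R :> R by rewrite ltr0n fact_gt0.
by rewrite -[(_)^-1]mul1r ler_pdivrMr // mulrC.
Qed.

Let T := {N | normalized N}.

(** One constant serves as bound and as Lipschitz constant for the entrywise distance; the bound is
    what makes products Lipschitz. *)
Definition bounded_lipschitz (f : T -> R) : Prop :=
  exists2 K, 0 <= K & forall N N' : T, `|f N| <= K /\
    forall e, 0 <= e -> (forall i j, `|sval N i j - sval N' i j| <= e) ->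
      `|f N - f N'| <= K * e.

Lemma bounded_lipschitz_subring : function_subring bounded_lipschitz.
Proof.
split=> [c|f g [K K0 hf] [L L0 hg]|f g [K K0 hf] [L L0 hg]].
- by exists `|c| => // N N'; split=> // e e0 _; rewrite subrr normr0 mulr_ge0.
- exists (K + L) => [|N N']; first exact: addr_ge0.
  have [fK fL] := hf N N'; have [gK gL] := hg N N'; split.
    by rewrite (le_trans (ler_normD _ _)) ?lerD.
  move=> e e0 he; rewrite opprD addrACA mulrDl (le_trans (ler_normD _ _)) //.
  by rewrite lerD ?fL ?gL.
exists (2 * (K * L)) => [|N N']; first by rewrite !mulr_ge0.
have [fK fL] := hf N N'; have [gK gL] := hg N N'; split.
  rewrite normrM; apply: (@le_trans _ _ (K * L)); first by rewrite ler_pM.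
  by have := mulr_ge0 K0 L0; lra.
move=> e e0 he.
have -> : f N * g N - f N' * g N' = f N * (g N - g N') + (f N - f N') * g N'.
  by ring.
have [g'K _] := hg N' N.
have -> : 2 * (K * L) * e = K * (L * e) + (K * e) * L by ring.
by rewrite (le_trans (ler_normD _ _)) // lerD // normrM; apply: ler_pM; rewrite ?fL ?gL.
Qed.

Lemma bounded_lipschitz_inv (f : T -> R) (c : R) : 0 < c -> (forall N : T, c <= f N) ->
  bounded_lipschitz f -> bounded_lipschitz (fun N : T => (f N)^-1).
Proof.
move=> c0 cf [K K0 hf].
have f0 (N : T) : 0 < f N by exact: lt_le_trans (cf N).
(* The first term bounds the inverse, the second is its Lipschitz constant. *)
exists (c^-1 + K * (c^-1 * c^-1)).
  by rewrite addr_ge0 ?mulr_ge0 ?invr_ge0 // ltW.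
have invf (N : T) : `|(f N)^-1| <= c^-1.
  by rewrite gtr0_norm ?invr_gt0 // lef_pV2 ?posrE.
move=> N N'; split.
  by rewrite (le_trans (invf N)) // lerDl ?mulr_ge0 ?invr_ge0 // ltW.
move=> e e0 he; have [_ /(_ e e0 he) hN] := hf N N'.
have -> : (f N)^-1 - (f N')^-1 = - (f N - f N') * ((f N)^-1 * (f N')^-1).
  have := f0 N; have := f0 N' => /gt_eqF/negbT fN' /gt_eqF/negbT fN.
  by field; rewrite fN fN'.
rewrite !normrM normrN; apply: (@le_trans _ _ (K * e * (c^-1 * c^-1))).
  by apply: ler_pM => //; [exact: mulr_ge0 | apply: ler_pM].
by rewrite mulrDl mulrAC lerDr mulr_ge0 // invr_ge0 ltW.
Qed.

Lemma bounded_lipschitz_sqrt (f : T -> R) (c : R) : 0 < c -> (forall N : T, c <= f N) ->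
  bounded_lipschitz f -> bounded_lipschitz (fun N : T => Num.sqrt (f N)).
Proof.
move=> c0 cf [K K0 hf].
have f0 (N : T) : 0 < f N by exact: lt_le_trans (cf N).
have s0 : 0 < Num.sqrt c by rewrite sqrtr_gt0.
have sf (N : T) : Num.sqrt c <= Num.sqrt (f N) by rewrite ler_wsqrtr.
(* 1 + K bounds the square root, since s <= 1 + s^2; the last term is its Lipschitz constant, from s
   - s' = (s^2 - s'^2) / (s + s'). *)
exists (1 + K + K * (Num.sqrt c)^-1).
  by rewrite !addr_ge0 ?mulr_ge0 ?invr_ge0 // ltW.
move=> N N'; have [fK fL] := hf N N'; split.
  rewrite ger0_norm ?sqrtr_ge0 //.
  have sq : Num.sqrt (f N) ^+ 2 = f N by rewrite sqr_sqrtr // ltW.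
  have s1 : Num.sqrt (f N) <= 1 + f N by rewrite -{2}sq; nra.
  have fNK : f N <= K by rewrite (le_trans (ler_norm _)).
  have : 0 <= K * (Num.sqrt c)^-1 by rewrite mulr_ge0 ?invr_ge0 // ltW.
  by lra.
move=> e e0 he; have {}fL := fL e e0 he.
have := sf N; have := sf N'; set s := Num.sqrt (f N); set s' := Num.sqrt (f N').
move=> cs' cs.
have diffE : s - s' = (f N - f N') / (s + s').
  have ss : s + s' != 0 by rewrite gt_eqF //; lra.
  rewrite -(sqr_sqrtr (ltW (f0 N))) -(sqr_sqrtr (ltW (f0 N'))) -/s -/s'.
  by field.
have ss0 : 0 < s + s' by lra.
rewrite diffE normrM normfV (gtr0_norm ss0).
apply: (@le_trans _ _ (K * e * (Num.sqrt c)^-1)).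
  apply: ler_pM => //; first by rewrite invr_ge0 ltW.
  by rewrite lef_pV2 ?posrE //; lra.
by rewrite [leRHS]mulrDl mulrAC lerDr mulr_ge0 // addr_ge0.
Qed.

Lemma bounded_lipschitz_coord i j : bounded_lipschitz (fun N : T => sval N i j).
Proof.
exists 1 => // N N'; split; first by case: N => N [NB hN]; exact: hN.
by move=> e _ he; rewrite mul1r.
Qed.

Lemma bounded_lipschitz_gram i j :
  bounded_lipschitz (fun N : T => gram (const_mx 1) (sval N) i j).
Proof.
have sub := bounded_lipschitz_subring.
apply: (fs_eq (f := fun N : T => \sum_k (1 * (sval N k i * sval N k j)))) => [N|].
  by rewrite gramE; apply: eq_bigr => k _; rewrite mxE.
apply: fs_sum => // k _; apply: (fs_mul sub); first exact: fs_cst.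
by apply: (fs_mul sub); exact: bounded_lipschitz_coord.
Qed.

Lemma bounded_lipschitz_det_gram :
  bounded_lipschitz (fun N : T => \det (gram (const_mx 1) (sval N))).
Proof.
by apply: fs_det; [exact: bounded_lipschitz_subring | exact: bounded_lipschitz_gram].
Qed.

Lemma gram_normalized_unitmx N : normalized N -> gram (const_mx 1) N \in unitmx.
Proof.
move=> /det_gram_normalized dN; rewrite unitmxE unitfE gt_eqF //.
by rewrite (lt_le_trans _ dN) // invr_gt0 ltr0n fact_gt0.
Qed.

Lemma bounded_lipschitz_eta w S :
  bounded_lipschitz (fun N : T => eta w (const_mx 1) (sval N) S).
Proof.
have sub := bounded_lipschitz_subring.
have n0 : 0 < (n`!%:R)^-1 :> R by rewrite invr_gt0 ltr0n fact_gt0.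
have detge (N : T) : (n`!%:R)^-1 <= \det (gram (const_mx 1) (sval N)).
  by case: N => N hN; exact: det_gram_normalized.
apply: (ext_in_canonical_form sub).
- apply: (fs_invmx sub); first by case=> N hN; exact: gram_normalized_unitmx.
    exact: bounded_lipschitz_gram.
  by apply: bounded_lipschitz_inv n0 detge _; exact: bounded_lipschitz_det_gram.
- move=> i j B.
  apply: (fs_eq (f := fun N : T => (\sum_k (sval N k i * sval N k j) *: dx_row R m 0 k) B)).
    by move=> N; rewrite gram_formE.
  apply: (ext_in_sum sub) => k _; apply: (ext_in_scale sub); last exact: ext_in_cst.
  by apply: (fs_mul sub); exact: bounded_lipschitz_coord.
apply: (bounded_lipschitz_inv (c := Num.sqrt (n`!%:R)^-1)).
- by rewrite sqrtr_gt0.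
- by move=> N; rewrite ler_wsqrtr.
by apply: bounded_lipschitz_sqrt n0 detge _; exact: bounded_lipschitz_det_gram.
Qed.

End Bounds.

(** * Normalization of the cycle matrix at a point *)

Section Normalization.
Variables (R : realType) (m n : nat).
Implicit Types (x : 'rV[R]_m) (C N : 'M[R]_(m, n)) (B : {ffun 'I_n -> 'I_m}).

Lemma det_row_replaced (E : 'M[R]_n) j :
  (forall k l, k != j -> E k l = (k == l)%:R) -> \det E = E j j.
Proof.
move=> hE; rewrite (expand_det_row E j).
have cofE k : cofactor E j k = (k == j)%:R.
  have -> : cofactor E j k = cofactor 1%:M j k.
    rewrite /cofactor; congr (_ * \det _); apply/matrixP => a b.
    by rewrite !mxE hE // eq_sym neq_lift.
  have adj1 : \adj (1%:M : 'M[R]_n) = 1%:M by rewrite -[LHS]mulmx1 mul_adj_mx det1.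
  by have /matrixP/(_ k j) := adj1; rewrite !mxE.
rewrite (bigD1 j) //= cofE eqxx mulr1 big1 ?addr0 // => k /negbTE kj.
by rewrite cofE kj mulr0.
Qed.

(** Cramer's rule: once the block B is the identity, the entries are ratios of maximal minors, so a
    maximal choice of B can bound them. *)
Lemma cramer_rowsub C B g j : rowsub B C \in unitmx ->
  (C *m invmx (rowsub B C)) g j * \det (rowsub B C) =
  \det (rowsub [ffun k => if k == j then g else B k] C).
Proof.
move=> uU; set U := rowsub B C in uU *; set C' := C *m invmx U.
set B' := [ffun k => if k == j then g else B k].
have -> : rowsub B' C = rowsub B' C' *m U.
  have CE : C = C' *m U by rewrite mulmxKV.
  rewrite {1}CE; apply/matrixP => a b; rewrite !mxE.
  by apply: eq_bigr => k _; rewrite !mxE.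
rewrite det_mulmx; congr (_ * _); rewrite (@det_row_replaced _ j).
  by rewrite [RHS]mxE /B' ffunE eqxx.
move=> k l kj; rewrite [LHS]mxE /B' ffunE (negbTE kj).
have /matrixP/(_ k l) : U *m invmx U = 1%:M by rewrite mulmxV.
by rewrite !mxE => <-; apply: eq_bigr => a _; rewrite !mxE.
Qed.

Lemma eta_normalized w x C : (forall i, 0 < x 0 i) ->
  (exists B, \det (rowsub B C) != 0) ->
  exists B N, [/\ normalized N, \det (rowsub B C) != 0,
    forall g j, N g j = (C *m invmx (rowsub B C)) g j *
                        (Num.sqrt (x 0 g) / Num.sqrt (x 0 (B j)))
    & forall S, `|eta w x C S| * \prod_(i in S) x 0 i = `|eta w (const_mx 1) N S|].
Proof.
move=> x0 [B0 dB0]; pose s i := Num.sqrt (x 0 i).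
have s0 i : 0 < s i by rewrite sqrtr_gt0.
have sN0 i : s i != 0 by rewrite gt_eqF.
pose F B := `|\det (rowsub B C)| * \prod_j s (B j).
have [B _ Bmaxi] := @Order.TotalTheory.arg_maxP _ _ _ B0 xpredT F isT.
have Bmax B1 : F B1 <= F B by exact: Bmaxi.
have FB0 : 0 < F B.
  apply: lt_le_trans (Bmax B0); rewrite /F mulr_gt0 ?normr_gt0 //.
  by apply: prodr_gt0 => i _.
have dB : \det (rowsub B C) != 0.
  by apply: contraTneq FB0; rewrite /F => ->; rewrite normr0 mul0r ltxx.
have uU : rowsub B C \in unitmx by rewrite unitmxE unitfE.
set U := rowsub B C in uU dB *; pose C' := C *m invmx U.
(* Compare the maximal choice B with the one in which row [B j] is replaced by row g. *)
have C'le g j : `|C' g j| * s g <= s (B j).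
  have := Bmax [ffun k => if k == j then g else B k].
  have FE B1 : F B1 = `|\det (rowsub B1 C)| * (s (B1 j) * \prod_(k | k != j) s (B1 k)).
    by rewrite /F (bigD1 j).
  rewrite !FE -cramer_rowsub // -/U -/C' normrM ffunE eqxx.
  have -> : \prod_(k | k != j) s ([ffun k => if k == j then g else B k] k) =
      \prod_(k | k != j) s (B k).
    by apply: eq_bigr => k /negbTE kj; rewrite ffunE kj.
  set P := \prod_(_ | _) _; have P0 : 0 < P by apply: prodr_gt0.
  have dU0 : 0 < `|\det U| by rewrite normr_gt0.
  have -> : `|C' g j| * `|\det U| * (s g * P) = `|C' g j| * s g * (`|\det U| * P) by ring.
  have -> : `|\det U| * (s (B j) * P) = s (B j) * (`|\det U| * P) by ring.
  by rewrite ler_pM2r // mulr_gt0.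
pose N := \matrix_(g, j) (C' g j * (s g / s (B j))).
have NE g j : N g j = C' g j * (s g / s (B j)) by rewrite mxE.
have hN : normalized N.
  split; last first.
    move=> g j; rewrite NE normrM (gtr0_norm (divr_gt0 (s0 _) (s0 _))) mulrA.
    by rewrite ler_pdivrMr // mul1r.
  exists B; apply/matrixP => k l; rewrite [LHS]mxE NE [RHS]mxE.
  have -> : C' (B k) l = (k == l)%:R.
    have /matrixP/(_ k l) : U *m invmx U = 1%:M by rewrite mulmxV.
    by rewrite [in RHS]mxE => <-; rewrite !mxE; apply: eq_bigr => a _; rewrite !mxE.
  by case: eqVneq => [->|_]; rewrite ?mul0r // divff ?mulr1.
exists B, N; split => // S.
(* In C = diag(c) N V the rescaling c moves the point x to (1, ..., 1), and V contributes only a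
   sign. *)
pose c : 'rV[R]_m := \row_i (s i)^-1; pose V := diag_mx (\row_j s (B j)) *m U.
have c2 i : c 0 i ^+ 2 = (x 0 i)^-1.
  by rewrite mxE exprVn sqr_sqrtr // ltW.
have CE : C = diag_mx c *m (N *m V).
  have -> : diag_mx c *m (N *m V) = C' *m U.
    rewrite /V !mulmxA; congr (_ *m _); apply/matrixP => g j.
    have dN : (diag_mx c *m N) g j = c 0 g * N g j by rewrite mul_diag_mx mxE.
    rewrite mul_mx_diag [LHS]mxE dN NE [c 0 g]mxE [X in _ * X = _]mxE.
    by move: (C' g j) => z; field; rewrite !sN0.
  by rewrite mulmxKV.
have uV : V \in unitmx.
  rewrite unitmx_mul uU andbT unitmxE det_diag unitfE prodf_seq_neq0.
  by apply/allP => j _; rewrite mxE sN0.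
have dV : \det V != 0 by rewrite -unitfE -unitmxE.
have cx : (\row_i (c 0 i ^+ 2 * x 0 i)) = const_mx 1 :> 'rV[R]_m.
  by apply/rowP => i; rewrite mxE [in RHS]mxE c2 mulVf ?gt_eqF.
rewrite [in eta w x C]CE eta_row_scale cx.
rewrite eta_mulmx ?gram_normalized_unitmx // ext_map_diag ffunE.
rewrite !normrM normr_sg dV mul1r.
have pS : 0 < \prod_(i in S) x 0 i by apply: prodr_gt0.
have -> : \prod_(i in S) (\row_i (c 0 i ^+ 2)) 0 i = (\prod_(i in S) x 0 i)^-1.
  by rewrite -prodfV; apply: eq_bigr => i _; rewrite mxE c2.
by rewrite normfV (gtr0_norm pS) mulrAC mulVf ?gt_eqF // mul1r.
Qed.

End Normalization.

(** * Decay across a gap between the edge variables *)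

Section GapBound.
Variables (R : realType) (m n : nat).
Implicit Types (x : 'rV[R]_m) (C N : 'M[R]_(m, n)) (B : {ffun 'I_n -> 'I_m}).

(** Only finitely many B, g and j occur, so one constant serves for all points x. The bound on the
    inverses says that a nonzero entry is not small. *)
Lemma reduced_entries_bound C : exists2 K : R, 0 <= K & forall B g j,
  let c := (C *m invmx (rowsub B C)) g j in `|c| <= K /\ (c != 0 -> `|c|^-1 <= K).
Proof.
pose c (t : {ffun 'I_n -> 'I_m} * ('I_m * 'I_n)) :=
  (C *m invmx (rowsub t.1 C)) t.2.1 t.2.2.
have sum_ge (f : {ffun 'I_n -> 'I_m} * ('I_m * 'I_n) -> R) t :
    (forall t, 0 <= f t) -> f t <= \sum_t f t.
  by move=> f0; rewrite (bigD1 t) //= lerDl sumr_ge0.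
pose K1 := \sum_t `|c t|; pose K2 := \sum_t `|c t|^-1.
have K10 : 0 <= K1 by apply: sumr_ge0.
have K20 : 0 <= K2 by apply: sumr_ge0 => t _; rewrite invr_ge0.
exists (K1 + K2) => [|B g j]; first exact: addr_ge0.
split=> [|_]; have := sum_ge _ (B, (g, j)).
  move=> /(_ (fun t => `|c t|) (fun t => normr_ge0 _)) /=; rewrite -/K1; lra.
move=> /(_ (fun t => `|c t|^-1)) /= h.
have : `|c (B, (g, j))|^-1 <= K2 by apply: h => t; rewrite invr_ge0.
by rewrite /c /=; lra.
Qed.

Lemma eta_uniform_bound w : exists2 K : R, 0 <= K &
  forall N N', normalized N -> normalized N' -> forall S,
    `|eta w (const_mx 1) N S| <= K /\
    forall e, 0 <= e -> (forall i j, `|N i j - N' i j| <= e) ->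
      `|eta w (const_mx 1) N S - eta w (const_mx 1) N' S| <= K * e.
Proof.
have /fin_all_exists2[K K0 hK] := @bounded_lipschitz_eta R m n w.
exists (\sum_S K S) => [|N N' hN hN' S]; first exact: sumr_ge0.
have KS : K S <= \sum_S K S by rewrite (bigD1 S) //= lerDl sumr_ge0.
have [hb hl] := hK S (exist _ N hN) (exist _ N' hN'); split.
  exact: le_trans hb KS.
by move=> e e0 he; rewrite (le_trans (hl e e0 he)) // ler_wpM2r.
Qed.

Lemma eta_gap_bound w d C : homogeneous d w -> (d + n).+1 = m ->
  (exists B, \det (rowsub B C) != 0) ->
  exists2 K : R, 0 <= K & forall x, (forall i, 0 < x 0 i) ->
    (forall S, `|eta w x C S| * \prod_(i in S) x 0 i <= K) /\
    forall (ga : {set 'I_m}) i j del, i \in ga -> j \notin ga -> 0 <= del ->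
      (forall g e, g \in ga -> e \notin ga ->
        Num.sqrt (x 0 g) <= del * Num.sqrt (x 0 e)) ->
      forall S, `|eta w x C S| * \prod_(i in S) x 0 i <= K * del.
Proof.
move=> hw dm hC.
have [K0 K00 hK0] := reduced_entries_bound C.
have [K K_ge0 hK] := eta_uniform_bound w.
exists (K + K * K0) => [|x x0]; first by rewrite addr_ge0 ?mulr_ge0.
have [B [N [hN dB NE etaE]]] := eta_normalized w x0 hC.
have KK0 : 0 <= K * K0 by exact: mulr_ge0.
have prodS (S : {set 'I_m}) : `|\prod_(i in S) x 0 i| = \prod_(i in S) x 0 i.
  by rewrite gtr0_norm //; apply: prodr_gt0.
split=> [S|ga i j del iga jga del0 gap S].
  by rewrite etaE; have [+ _] := hK _ _ hN hN S; lra.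
rewrite etaE.
(* N without the entries that link [ga] to its complement, hence a block matrix. *)
pose N0 := \matrix_(g, e) (if (g \in ga) == (B e \in ga) then N g e else 0).
have s0 i' : 0 < Num.sqrt (x 0 i') by rewrite sqrtr_gt0.
have hN0 : normalized N0.
  have [[B1 NB1] N1] := hN; split; last first.
    by move=> g e; rewrite mxE; case: ifP => _; rewrite ?normr0.
  (* A diagonal entry of the identity block compares [B k] with itself, so it is kept. *)
  exists B; apply/matrixP => k l; rewrite !mxE.
  have NBkl : N (B k) l = (k == l)%:R.
    rewrite NE; set U := rowsub B C in dB *.
    have -> : (C *m invmx U) (B k) l = (k == l)%:R.
      have uU : U \in unitmx by rewrite unitmxE unitfE.
      have /matrixP/(_ k l) : U *m invmx U = 1%:M by rewrite mulmxV.
      rewrite [in RHS]mxE => <-; rewrite [LHS]mxE [RHS]mxE.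
      by apply: eq_bigr => a _; rewrite !mxE.
    by case: eqVneq => [->|_]; rewrite ?mul0r // divff ?mulr1 ?gt_eqF.
  by rewrite NBkl; have [->|_] := eqVneq k l; rewrite ?eqxx // if_same.
have N0eta : eta w (const_mx 1) N0 = 0.
  apply: (@eta_block_eq0 R m n d w N0 ga (fun e => B e \in ga) i j) => //.
    exact: gram_normalized_unitmx.
  by move=> g e /negbTE ne; rewrite mxE ne.
have dist g e : `|N g e - N0 g e| <= K0 * del.
  rewrite [N0 g e]mxE; case: eqP => [_|ne].
    by rewrite subrr normr0 mulr_ge0.
  rewrite subr0; have [_ /(_ g e) N1] := hN.
  have [cK cVK] := hK0 B g e; move: N1; rewrite NE; set c := (C *m _) g e in cK cVK *.
  have r0 : 0 < Num.sqrt (x 0 g) / Num.sqrt (x 0 (B e)) by rewrite divr_gt0.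
  rewrite normrM (gtr0_norm r0).
  case: (boolP (g \in ga)) ne => gga ne.
    have ega : B e \notin ga by apply/negP => h; rewrite h in ne.
    move=> _; apply: ler_pM => //; first exact: ltW.
    by rewrite ler_pdivrMr // gap.
  (* Here the ratio of square roots is large, and |N g e| <= 1 forces |c| <= del. A nonzero c is at
     least 1 / K0, so K0 del >= 1 and the bound |N g e| <= 1 is already good enough. *)
  have ega : B e \in ga by case: (boolP (B e \in ga)) ne => // _ [].
  have [->|c0] := eqVneq c 0; first by rewrite normr0 mul0r mulr_ge0.
  move=> cr; apply: (le_trans cr).
  have := gap _ _ ega gga; set sg := Num.sqrt (x 0 g); set se := Num.sqrt (x 0 (B e)).
  rewrite -/sg -/se in cr; move=> sese.
  have nc0 : 0 < `|c| by rewrite normr_gt0.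
  have cdel : `|c| <= del.
    have : `|c| * sg <= se by move: cr; rewrite mulrA (ler_pdivrMr _ _ (s0 (B e))) mul1r.
    by move=> /le_trans/(_ sese); rewrite (ler_pM2r (s0 g)).
  rewrite -(mulVf (lt0r_neq0 nc0)); apply: ler_pM => //; last exact: cVK.
  by rewrite invr_ge0 ltW.
have [_ /(_ (K0 * del))] := hK _ _ hN hN0 S; rewrite N0eta.
have -> : (0 : ext R m) S = 0 by rewrite ffunE.
rewrite subr0.
move=> /(_ (mulr_ge0 K00 del0) dist) h; rewrite (le_trans h) //.
by rewrite mulrA ler_wpM2r // lerDr.
Qed.

End GapBound.

From mathcomp Require Import all_classical all_reals all_analysis measurable_realfun.
Import numFieldNormedType.Exports.

Section RatioBound.
Variable R : realType.

(* Pigeonhole: one of the m + 1 intervals ]q^(k+1) y_j, q^k y_j[ contains none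
   of the m values y_e. *)
Lemma exists_gap m (y : 'I_m -> R) (q : R) i j : (forall k, 0 < y k) ->
  0 < q -> q < 1 -> y i = q ^+ m.+1 * y j ->
  exists ga : {set 'I_m}, [/\ i \in ga, j \notin ga &
    forall g e, g \in ga -> e \notin ga -> y g <= q * y e].
Proof.
(* The thresholds rise from tau 0 = y_i to tau (m+1) = y_j; the set [ga] will consist of the values
   below the empty interval. *)
move=> y0 q0 q1 yij; pose tau k := q ^+ (m.+1 - k) * y j.
have tau0 k : 0 < tau k by rewrite mulr_gt0 ?exprn_gt0.
have tau_incr k l : (k <= l)%N -> tau k <= tau l.
  move=> kl; rewrite ler_pM2r // ler_wiXn2l ?ltW //; lia.
have tauS k : (k <= m)%N -> tau k = q * tau k.+1.
  by move=> km; rewrite /tau mulrA -exprS; congr (_ ^+ _ * _); lia.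
have [k kP] : exists k : 'I_m.+1, forall e, ~~ ((tau k < y e) && (y e < tau k.+1)).
  have [/existsP[k /forallP kP]|] := boolP
    [exists k : 'I_m.+1, forall e, ~~ ((tau k < y e) && (y e < tau k.+1))].
    by exists k.
  rewrite negb_exists => /forallP hall; exfalso.
  have {}hall (k : 'I_m.+1) : exists e, (tau k < y e) && (y e < tau k.+1).
    have := hall k; rewrite negb_forall => /existsP[e]; rewrite negbK => he.
    by exists e.
  have [f hf] := fin_all_exists hall.
  have finj : injective f.
    move=> k l kl; apply/eqP; rewrite -val_eqE /=; case: ltngtP => //= lt_kl.
      have /andP[_ h1] := hf k; have /andP[h2 _] := hf l.
      have := tau_incr _ _ lt_kl; rewrite kl in h1; lra.
    have /andP[_ h1] := hf l; have /andP[h2 _] := hf k.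
    have := tau_incr _ _ lt_kl; rewrite kl in h2; lra.
  by have := leq_card f finj; rewrite !card_ord ltnn.
have km : (k <= m)%N by rewrite -ltnS.
exists [set e | y e <= tau k]%SET; split.
- by rewrite inE yij; apply: (le_trans _ (tau_incr 0 k isT)); rewrite /tau subn0.
- rewrite inE -ltNge; have -> : y j = tau m.+1 by rewrite /tau subnn expr0 mul1r.
  apply: (lt_le_trans _ (tau_incr k.+1 m.+1 _)); last by lia.
  by rewrite tauS // gtr_pMl.
move=> g e; rewrite !inE -ltNge => /le_trans gk ke; apply: gk.
rewrite tauS // ler_pM2l //.
by have := kP e; rewrite ke /= -leNgt.
Qed.

Lemma eta_ratio_bound m n w d (C : 'M[R]_(m, n)) : homogeneous d w -> (d + n).+1 = m ->
  (exists B : {ffun 'I_n -> 'I_m}, \det (rowsub B C) != 0) ->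
  exists2 K : R, 0 <= K & forall x : 'rV[R]_m, (forall i, 0 < x 0 i) ->
    forall S i j, (`|eta w x C S| * \prod_(k in S) x 0 k) ^+ (2 * m.+1) <=
      K * (x 0 i / x 0 j).
Proof.
move=> hw dm hC; have [K K0 hK] := eta_gap_bound hw dm hC.
exists (K ^+ (2 * m.+1)) => [|x x0 S i j]; first exact: exprn_ge0.
have [hb hgap] := hK x x0.
set v := `|eta w x C S| * _.
have v0 : 0 <= v.
  by rewrite mulr_ge0 //; apply: prodr_ge0 => k _; exact: ltW.
have [xji|xij] := lerP (x 0 j) (x 0 i).
  rewrite -[leLHS]mulr1; apply: ler_pM => //; first exact: exprn_ge0.
    by rewrite lerXn2r ?nnegrE // hb.
  by rewrite ler_pdivlMr // mul1r.
pose y k := Num.sqrt (x 0 k).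
have y0 k : 0 < y k by rewrite sqrtr_gt0.
have yij : y i < y j by rewrite ltr_sqrt.
pose r := y i / y j.
have r0 : 0 < r by rewrite divr_gt0.
have r1 : r < 1 by rewrite ltr_pdivrMr // mul1r.
(* The gap is sought among the square roots, so q^(m+1) is the root of x_i / x_j; this is the origin
   of the exponent 2 (m+1). *)
pose q := r `^ (m.+1%:R^-1).
have q0 : 0 < q by rewrite powR_gt0.
have qm : q ^+ m.+1 = r.
  by rewrite -powR_mulrn ?ltW // -powRrM mulVf ?pnatr_eq0 // powRr1 // ltW.
have q1 : q < 1.
  rewrite ltNge; apply/negP => q1; have := exprn_ege1 m.+1 q1.
  by rewrite qm leNgt r1.
have yijq : y i = q ^+ m.+1 * y j by rewrite qm divfK // gt_eqF.
have [ga [iga jga gap]] := exists_gap y0 q0 q1 yijq.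
have vK := hgap ga i j q iga jga (ltW q0) gap S.
have -> : x 0 i / x 0 j = q ^+ (2 * m.+1).
  rewrite mulnC exprM qm /r exprMn exprVn /y !sqr_sqrtr // ltW //.
by rewrite -exprMn lerXn2r ?nnegrE // mulr_ge0 // ltW.
Qed.

End RatioBound.

HB.instance Definition _ (R : realDomainType) :=
  Monoid.isComLaw.Build (\bar R) 1%E (@mule R) (@muleA R) (@muleC R) (@mul1e R).

(** Presents the pushforward as a measure, so that uniqueness theorems for measures apply to it. *)
Lemma pushforward_is_measure d d' (T1 : measurableType d) (T2 : measurableType d')
    (R : realType) (m : {measure set T1 -> \bar R}) (f : T1 -> T2) :
  measurable_fun setT f ->
  exists nu : {measure set T2 -> \bar R},
    forall A, nu A = pushforward m f A.
Proof.
by move=> mf; unshelve eexists (pushforward m f : {measure set T2 -> \bar R}).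
Qed.

(** * Lebesgue measure on tuples *)

Section TupleMeasure.
Variable R : realType.
Local Open Scope classical_set_scope.
Local Open Scope ereal_scope.
Local Notation mu := (@lebesgue_measure R).
Local Notation leb n := (lebesgue_tuple R n).

(** The pushforward times a gives every half-open interval its length, so it is Lebesgue measure by
    uniqueness. *)
Lemma pushforward_lebesgue_scale (a : R) (a0 : (0 < a)%R) (A : set (measurableTypeR R)) :
  measurable A ->
  pushforward mu (fun x : measurableTypeR R => (a * x)%R : measurableTypeR R) A =
  (a^-1)%:E * mu A.
Proof.
have ai0 : (0 <= a^-1)%R by rewrite invr_ge0 ltW.
pose k : {nonneg R} := NngNum ai0.
have mf : measurable_fun setT (fun x : measurableTypeR R => (a * x)%R : measurableTypeR R).
  exact: measurable_funM.
have a' : (0 <= a)%R by exact: ltW.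
pose k' : {nonneg R} := NngNum a'.
have [nu0 nu0E] := pushforward_is_measure mu mf.
pose nu : {measure set (measurableTypeR R) -> \bar R} := mscale k' nu0.
have nuE B : nu B = a%:E * pushforward mu (fun x : measurableTypeR R => (a * x)%R : measurableTypeR R) B.
  by rewrite -nu0E.
move=> mA.
have /(_ A mA) muE : forall A, measurable A -> mu A = nu A.
  apply: lebesgue_measure_unique => _ [[b c] _ <-] /=.
  rewrite nuE /pushforward.
  have -> : (fun x : R => a * x)%R @^-1` `]b, c] = `](a^-1 * b)%R, (a^-1 * c)%R].
    apply/seteqP; split=> x /=; rewrite !in_itv /=;
      by rewrite ![(a^-1 * _)%R]mulrC ltr_pdivrMr // ler_pdivlMr // ![(x * a)%R]mulrC.
  rewrite !lebesgue_measure_itv /= !lte_fin ltr_pM2l ?invr_gt0 //.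
  case: ifP => _; last by rewrite mule0.
  rewrite -!EFinB -EFinM -mulrBr mulrA divff ?mul1r ?gt_eqF //.
rewrite muE nuE muleA -EFinM mulVf ?gt_eqF // mul1e //.
Qed.

Lemma ge0_integral_scale (a : R) (f : R -> \bar R) : (0 < a)%R ->
  measurable_fun setT f -> (forall x, 0 <= f x) ->
  \int[mu]_x f (a * x)%R = (a^-1)%:E * \int[mu]_x f x.
Proof.
move=> a0 mf f0.
have ai0 : (0 <= a^-1)%R by rewrite invr_ge0 ltW.
pose k : {nonneg R} := NngNum ai0.
have mg : measurable_fun setT (fun x : measurableTypeR R => (a * x)%R : measurableTypeR R).
  exact: measurable_funM.
have <- := ge0_integral_mscale mu measurableT k mf (fun x _ => f0 x).
have := ge0_integral_pushforward mg mu measurableT mf (fun x _ => f0 x).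
rewrite preimage_setT => <-.
apply: eq_measure_integral => A mA _; exact: pushforward_lebesgue_scale.
Qed.

Lemma ge0_integral_tuple_cons n (f : n.+1.-tuple R -> \bar R) :
  measurable_fun setT f -> (forall t, 0 <= f t) ->
  \int[leb n.+1]_t f t = \int[mu]_x \int[leb n]_t f (tuple_cons (x, t)).
Proof.
move=> mf f0.
have mc := @measurable_tuple_cons R n.
rewrite -(@fubini_tonelli1 _ _ _ _ _ mu (leb n) (fun p => f (tuple_cons p))) //.
  have := ge0_integral_pushforward mc (mu \x leb n) measurableT mf (fun x _ => f0 x).
  by rewrite preimage_setT => <-.
exact: measurableT_comp.
Qed.

Lemma measurable_tuple_cons_section n (f : n.+1.-tuple R -> \bar R) :
  measurable_fun setT f -> (forall t, 0 <= f t) ->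
  measurable_fun setT (fun x : R => \int[leb n]_t f (tuple_cons (x, t))).
Proof.
move=> mf f0.
apply: (@measurable_fun_fubini_tonelli_F _ _ _ _ _ (leb n) (fun p => f (tuple_cons p))) => //.
by apply: measurableT_comp => //; exact: measurable_tuple_cons.
Qed.

Lemma measurable_cons_r n (f : n.+1.-tuple R -> \bar R) (x : R) :
  measurable_fun setT f -> measurable_fun setT (fun t => f (tuple_cons (x, t))).
Proof.
move=> mf.
have mc : measurable_fun setT (@tuple_cons R n \o pair x).
  apply: measurableT_comp; first exact: measurable_tuple_cons.
  exact: pair1_measurable.
exact: (measurableT_comp mf mc).
Qed.

Definition tuple_scale n (a : R) (t : n.-tuple R) : n.-tuple R := [tuple of map ( *%R a) t].

Lemma tnth_tuple_scale n a (t : n.-tuple R) i : tnth (tuple_scale a t) i = (a * tnth t i)%R.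
Proof. by rewrite tnth_map. Qed.

Lemma measurable_tuple_scale n a : measurable_fun setT (@tuple_scale n a).
Proof.
apply/measurable_fun_tnthP => i.
rewrite (_ : _ \o _ = fun t : n.-tuple R => (a * tnth t i)%R); last first.
  by apply/funext => t /=; rewrite tnth_tuple_scale.
by apply: measurable_funM => //; exact: measurable_tnth.
Qed.

Lemma ge0_integral_tuple_scale n (a : R) (f : n.-tuple R -> \bar R) : (0 < a)%R ->
  measurable_fun setT f -> (forall t, 0 <= f t) ->
  \int[leb n]_t f (tuple_scale a t) = (a ^- n)%:E * \int[leb n]_t f t.
Proof.
move=> a0; elim: n f => [|n IH] f mf f0.
  rewrite expr0 invr1 mul1e; apply: eq_integral => t _; congr f.
  by apply/eq_from_tnth => -[].
have mfs : measurable_fun setT (fun t => f (tuple_scale a t)).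
  by apply: measurableT_comp => //; exact: measurable_tuple_scale.
rewrite !ge0_integral_tuple_cons //.
have scons x (t : n.-tuple R) :
    tuple_scale a (tuple_cons (x, t)) = tuple_cons ((a * x)%R, tuple_scale a t).
  exact: val_inj.
under eq_integral => x _.
  under eq_integral => t _ do rewrite scons.
  rewrite (IH (fun t => f (tuple_cons ((a * x)%R, t)))) //; last exact: measurable_cons_r.
  over.
have mF := measurable_tuple_cons_section mf f0.
have F0 x : 0 <= \int[leb n]_t f (tuple_cons (x, t)) by apply: integral_ge0.
rewrite /= ge0_integralZl //; last 2 first.
- have ma : measurable_fun setT (fun x : measurableTypeR R => (a * x)%R : measurableTypeR R).
    exact: measurable_funM.
  exact: (measurableT_comp mF ma).
- by rewrite lee_fin invr_ge0 exprn_ge0 // ltW.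
rewrite (ge0_integral_scale a0 mF F0) muleA -EFinM; congr (_%:E * _).
by rewrite exprS invfM mulrC.
Qed.

Definition tuple_rect n (A : 'I_n -> set R) : set (n.-tuple R) :=
  [set t | forall i, A i (tnth t i)].

Lemma measurable_tuple_rect n (A : 'I_n -> set (measurableTypeR R)) :
  (forall i, measurable (A i)) -> measurable (tuple_rect A).
Proof.
move=> mA.
have -> : tuple_rect A = \bigcap_(i in [set: 'I_n]) (fun t => tnth t i) @^-1` A i.
  by apply/seteqP; split=> t /= h i; [move=> _; exact: h | exact: (h i I)].
apply: fin_bigcap_measurable => // i _; rewrite -[X in measurable X]setTI.
by apply: measurable_tnth => //; exact: mA.
Qed.

Lemma lebesgue_tuple_rect n (A : 'I_n -> set (measurableTypeR R)) :
  (forall i, measurable (A i)) -> leb n (tuple_rect A) = \prod_i mu (A i).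
Proof.
elim: n A => [|n IH] A mA.
  rewrite big_ord0 /= diracE mem_set //; by case.
rewrite big_ord_recl -IH //.
rewrite -[LHS]/((mu \x leb n) (@tuple_cons R n @^-1` tuple_rect A)).
have -> : @tuple_cons R n @^-1` tuple_rect A =
    A ord0 `*` tuple_rect (fun i => A (lift ord0 i)).
  apply/seteqP; split=> -[x t] /=.
    move=> h; split; first exact: (h ord0).
    by move=> i /=; have := h (lift ord0 i); rewrite tnthS.
  move=> [Ax At] i; case: (unliftP ord0 i) => [j|] ->; last by [].
  by rewrite tnthS; exact: At.
by rewrite product_measure1E //; exact: measurable_tuple_rect.
Qed.

(** Rectangles are stable under intersection, as uniqueness of measures requires of a generating
    family. A coordinate cylinder is a rectangle whose other sides are full. *)
Lemma measurable_tuple_rectE n :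
  @measurable _ (n.-tuple R) =
  <<s [set X | exists2 A : 'I_n -> set (measurableTypeR R),
         (forall i, measurable (A i)) & X = tuple_rect A] >>.
Proof.
apply/seteqP; split; last first.
  apply: smallest_sub; first exact: sigma_algebra_measurable.
  by move=> _ [A mA ->]; exact: measurable_tuple_rect.
apply: smallest_sub; first exact: smallest_sigma_algebra.
rewrite -bigcup_seq => X [i _ [A mA <-]]; rewrite setTI.
apply: sub_sigma_algebra; exists (fun j => if j == i then A else setT).
  by move=> j; case: ifP.
apply/seteqP; split=> t /= h; first by move=> j; case: eqP => // ->.
by have := h i; rewrite eqxx.
Qed.

Definition tuple_perm n (s : 'S_n) (t : n.-tuple R) : n.-tuple R :=
  [tuple tnth t (s i) | i < n].

Lemma tnth_tuple_perm n (s : 'S_n) (t : n.-tuple R) i :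
  tnth (tuple_perm s t) i = tnth t (s i).
Proof. by rewrite tnth_mktuple. Qed.

Lemma measurable_tuple_perm n (s : 'S_n) : measurable_fun setT (tuple_perm s).
Proof.
apply/measurable_fun_tnthP => i.
rewrite (_ : _ \o _ = fun t : n.-tuple R => tnth t (s i)); last first.
  by apply/funext => t /=; rewrite tnth_tuple_perm.
exact: measurable_tnth.
Qed.

Lemma ge0_integral_tuple_perm n (s : 'S_n) (f : n.-tuple R -> \bar R) :
  measurable_fun setT f -> (forall t, 0 <= f t) ->
  \int[leb n]_t f (tuple_perm s t) = \int[leb n]_t f t.
Proof.
move=> mf f0; have ms := measurable_tuple_perm s.
have := ge0_integral_pushforward ms (leb n) measurableT mf (fun x _ => f0 x).
rewrite preimage_setT => <-.
have [nu nuE] := pushforward_is_measure (leb n) ms.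
apply/esym/eq_measure_integral => X mX _.
transitivity (nu X); last by rewrite nuE.
pose rects : set (set (n.-tuple R)) := [set X | exists2 A : 'I_n -> set (measurableTypeR R),
         (forall i, measurable (A i)) & X = tuple_rect A].
pose cubes k : set (n.-tuple R) := tuple_rect (fun=> `[(- k%:R)%R, k%:R] : set R).
(* A permutation only reorders the sides of a rectangle, and the cubes exhaust the space by sets of
   finite measure. *)
apply: (measure_unique rects cubes) => //.
- exact: measurable_tuple_rectE.
- move=> _ _ [A mA ->] [B mB ->]; exists (fun i => A i `&` B i).
    by move=> i; exact: measurableI.
  apply/seteqP; split=> t /=; first by move=> [h1 h2] i; split.
  by move=> h; split=> i; have [] := h i.
- by move=> k; exists (fun=> `[(- k%:R)%R, k%:R] : set R).
- rewrite -subTset => t _.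
  exists (\max_i Num.truncn `|tnth t i|).+1 => // i /=.
  rewrite in_itv /= -ler_norml.
  apply: (le_trans (ltW (Num.Theory.truncnS_gt _))); rewrite ler_nat ltnS.
  exact: (leq_bigmax i).
- move=> _ [A mA ->]; rewrite nuE /pushforward.
  have -> : tuple_perm s @^-1` tuple_rect A = tuple_rect (fun i => A (s^-1%g i)).
    apply/seteqP; split=> t /= h i.
      by have := h (s^-1%g i); rewrite tnth_tuple_perm permKV.
    by rewrite tnth_tuple_perm; have := h (s i); rewrite permK.
  apply: etrans (lebesgue_tuple_rect mA) _.
  apply: etrans (esym (lebesgue_tuple_rect (fun i => mA ((s^-1)%g i)))).
  by rewrite (reindex_inj (@perm_inj _ (s^-1)%g)).
- move=> k.
  have mI (i : 'I_n) : measurable (`[(- k%:R)%R, k%:R] : set (measurableTypeR R)) by [].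
  rewrite [X in X < _](lebesgue_tuple_rect mI).
  rewrite lebesgue_measure_itv /= lte_fin.
  have -> : (if (- k%:R < k%:R :> R)%R then k%:R%:E - (- k%:R)%:E else 0) =
     (if (- k%:R < k%:R :> R)%R then k%:R - (- k%:R) else 0 : R)%:E by case: ifP.
  have prod_lty (F : 'I_n -> \bar R) : (forall i, F i \is a fin_num) ->
      \prod_(i < n) F i < +oo.
    move=> Ffin; have : \prod_(i < n) F i \is a fin_num by exact: prode_fin_num.
    by rewrite fin_numE ltey => /andP[].
  exact: prod_lty.
Qed.

End TupleMeasure.

(** * An integrable majorant on the half-line *)

Section Majorant.
Variable R : realType.
Local Open Scope classical_set_scope.
Local Open Scope ereal_scope.
Local Notation mu := (@lebesgue_measure R).
Local Notation leb n := (lebesgue_tuple R n).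

Lemma integral_powR_itv (a b c : R) : (0 < a)%R -> (a < b)%R -> c != 0%R ->
  \int[mu]_(x in `[a, b]) (x `^ (c - 1))%:E = ((b `^ c - a `^ c) / c)%:E.
Proof.
move=> a0 ab c0; pose F (x : R) : R := (c^-1 * x `^ c)%R.
have dF (x : R) : (0 < x)%R -> is_derive x (1%R : R) F (x `^ (c - 1))%R.
  move=> x0; have := is_derive1_powR c x0 => dx.
  apply: (is_derive_eq (is_deriveZ c^-1%R dx)).
  by rewrite /GRing.scale /= mulrA mulVf // mul1r.
have cpow (d x : R) : (0 < x)%R -> {for x, continuous (fun y : R => (y `^ d)%R)}.
  move=> x0; apply: differentiable_continuous; apply/derivable1_diffP.
  by have [] := is_derive1_powR d x0.
have cF (x : R) : (0 < x)%R -> {for x, continuous F}.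
  move=> x0; apply: differentiable_continuous; apply/derivable1_diffP.
  by have [] := dF x x0.
rewrite (@continuous_FTC2 _ _ F) //.
- by rewrite -EFinB /F -mulrBr mulrC.
- apply: continuous_in_subspaceT => x; rewrite inE /= in_itv /= => /andP[ax _].
  by apply: cpow; exact: lt_le_trans ax.
- split.
  + move=> x; rewrite in_itv /= => /andP[ax _].
    by have [] := dF x (lt_trans a0 ax).
  + by apply: cvg_at_right_filter; exact: cF.
  + by apply: cvg_at_left_filter; apply: cF; exact: lt_trans ab.
move=> x; rewrite in_itv /= => /andP[ax _].
by rewrite derive1E; apply/derive_val; exact: dF (lt_trans a0 ax).
Qed.

Lemma measurable_powR_fun (c : R) (D : set R) : measurable D ->
  measurable_fun D (fun x : R => ((x `^ c)%R)%:E).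
Proof.
move=> mD; apply/measurable_EFinP.
by apply: (measurable_funS measurableT) => //; exact: measurable_powR.
Qed.

Let powR_fin_ge0 (x c : R) : 0 <= (x `^ c)%R%:E.
Proof. by rewrite lee_fin powR_ge0. Qed.

Lemma integral_powR_near0 (e : R) : (0 < e)%R ->
  \int[mu]_(x in `]0%R, 1%R]) (x `^ (e - 1))%:E <= (e^-1)%:E.
Proof.
(* With [n.+2] the left end stays below 1 also for n = 0, so that the interval is nondegenerate. *)
move=> e0; pose F (n : nat) : set R := `[(n.+2%:R^-1)%R, 1%R].
have FU : \bigcup_n F n = `]0%R, 1%R].
  apply/seteqP; split=> x /=.
    move=> [n _]; rewrite /F /= !in_itv /= => /andP[nx ->]; rewrite andbT.
    by apply: lt_le_trans nx; rewrite invr_gt0.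
  rewrite in_itv /= => /andP[x0 x1].
  exists (Num.truncn x^-1) => //; rewrite /F /= in_itv /= x1 andbT.
  rewrite -[leRHS]invrK lef_pV2 ?posrE ?invr_gt0 //.
  apply: (le_trans (ltW (Num.Theory.truncnS_gt _))).
  by rewrite ler_nat.
have ndF : nondecreasing_seq F.
  apply/nondecreasing_seqP => n; rewrite subsetEset => x /=.
  rewrite /F /= !in_itv /= => /andP[nx ->]; rewrite andbT.
  by apply: le_trans nx; rewrite lef_pV2 ?posrE // ler_nat.
have cv := @ge0_nondecreasing_set_cvg_integral _ (measurableTypeR R) _ F (fun x : R => (x `^ (e - 1))%:E)
  (mu : {measure set (measurableTypeR R) -> \bar R}) ndF (fun _ => measurable_itv _) (fun _ => measurable_powR_fun _ (measurable_itv _))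
  (fun _ _ _ => powR_fin_ge0 _ _).
rewrite -FU -(cvg_lim _ cv) //; apply: lime_le; first by apply/cvg_ex; eexists; exact: cv.
apply: nearW => n; rewrite integral_powR_itv ?gt_eqF //; last first.
  by rewrite invf_lt1 // ltr1n.
have y0 := powR_ge0 (n.+2%:R^-1 : R)%R e.
rewrite lee_fin powR1 ler_pdivrMr // mulVf ?gt_eqF //; lra.
Qed.

Lemma integral_powR_nearoo (e : R) : (0 < e)%R ->
  \int[mu]_(x in `]1%R, +oo[) (x `^ (- e - 1))%:E <= (e^-1)%:E.
Proof.
move=> e0; pose F (n : nat) : set R := `[1%R, (n.+2%:R)%R].
have mF n : measurable (F n) by exact: measurable_itv.
have FU : `]1%R, +oo[ `<=` \bigcup_n F n.
  move=> x /=; rewrite in_itv /= andbT => x1.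
  exists (Num.truncn x) => //; rewrite /F /= in_itv /= (ltW x1) /=.
  apply: (le_trans (ltW (Num.Theory.truncnS_gt _))).
  by rewrite ler_nat.
have ndF : nondecreasing_seq F.
  apply/nondecreasing_seqP => n; rewrite subsetEset => x /=.
  rewrite /F /= !in_itv /= => /andP[-> nx] /=.
  by apply: le_trans nx _; rewrite ler_nat.
have cv := @ge0_nondecreasing_set_cvg_integral _ (measurableTypeR R) _ F (fun x : R => (x `^ (- e - 1))%:E)
  (mu : {measure set (measurableTypeR R) -> \bar R}) ndF mF (fun _ => measurable_powR_fun _ (measurable_itv _))
  (fun _ _ _ => powR_fin_ge0 _ _).
apply: (@le_trans _ _ (\int[mu]_(x in \bigcup_n F n) (x `^ (- e - 1))%:E)).
  have mU : measurable (\bigcup_n F n : set (measurableTypeR R)).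
    by apply: bigcup_measurable => n _; exact: mF.
  apply: ge0_subset_integral => //; first exact: measurable_powR_fun.
rewrite -(cvg_lim _ cv) //; apply: lime_le; first by apply/cvg_ex; eexists; exact: cv.
apply: nearW => n; rewrite integral_powR_itv ?oppr_eq0 ?gt_eqF //; last first.
  by rewrite ltr1n.
have y0 := powR_ge0 (n.+2%:R : R)%R (- e)%R.
rewrite lee_fin powR1 invrN mulrN -mulNr opprB ler_pdivrMr // mulVf ?gt_eqF //; lra.
Qed.

(** This is min(t, 1/t)^e / t extended by 0, written as two powers that are integrated
    separately. *)
Definition majorant (e t : R) : R :=
  (if t <= 0 then 0 else if t <= 1 then t `^ (e - 1) else t `^ (- e - 1))%R.

Lemma majorant_ge0 e t : (0 <= majorant e t)%R.
Proof. by rewrite /majorant; case: ifP => // _; case: ifP => _; exact: powR_ge0. Qed.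

Lemma majorantE e t : (0 < t)%R -> majorant e t = ((Num.min t t^-1) `^ e / t)%R.
Proof.
move=> t0; rewrite /majorant leNgt t0 /=.
have tN0 : t != 0%R by rewrite gt_eqF.
have powD (r s : R) : (t `^ (r + s) = t `^ r * t `^ s)%R.
  by rewrite powRD // tN0 implybT.
have tV : (t^-1 = t `^ (-1))%R by rewrite powR_inv1 // ltW.
have [t1|t1] := leP t 1%R.
  rewrite min_l; first by rewrite powD tV.
  by rewrite (le_trans t1) // invf_ge1.
rewrite min_r; first by rewrite powD [in RHS]tV -powRrM mulN1r.
by rewrite (le_trans _ (ltW t1)) // invf_le1 // ltW.
Qed.

End Majorant.

Section MajorantIntegral.
Variable R : realType.
Local Open Scope classical_set_scope.
Local Open Scope ereal_scope.
Local Notation mu := (@lebesgue_measure R).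
Local Notation leb n := (lebesgue_tuple R n).

Lemma EFin_majorant (e : R) : EFin \o majorant e =
  ((fun x : R => ((x `^ (e - 1))%R)%:E) \_ `]0%R, 1%R]) \+
  ((fun x : R => ((x `^ (- e - 1))%R)%:E) \_ `]1%R, +oo[).
Proof.
apply/funext => x; rewrite /= !patchE /majorant.
have [x0|x0] := leP x 0%R.
  rewrite !memNset ?adde0 //= in_itv /= ?andbT; apply/negP.
    by rewrite -leNgt (le_trans x0).
  by rewrite negb_and -leNgt x0.
have [x1|x1] := leP x 1%R.
  rewrite mem_set /= ?memNset ?adde0 //= in_itv /= ?x0 ?x1 // andbT; apply/negP.
  by rewrite -leNgt.
rewrite memNset /= ?mem_set ?add0e //= in_itv /= ?andbT //; apply/negP.
by rewrite negb_and -!ltNge x1 orbT.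
Qed.

Let measurable_piece (c : R) (D : set R) : measurable D ->
  measurable_fun setT ((fun x : R => ((x `^ c)%R)%:E) \_ D).
Proof. by move=> mD; apply/(measurable_restrictT _ mD); exact: measurable_powR_fun. Qed.

Lemma measurable_majorant (e : R) : measurable_fun setT (EFin \o majorant e).
Proof.
rewrite EFin_majorant; apply: emeasurable_funD; apply: measurable_piece;
  exact: measurable_itv.
Qed.

Lemma integral_majorant (e : R) : (0 < e)%R -> \int[mu]_x (majorant e x)%:E < +oo.
Proof.
move=> e0; rewrite (_ : (fun x => _) = EFin \o majorant e) // EFin_majorant.
rewrite ge0_integralD //; last 4 first.
- by move=> x _; apply: erestrict_ge0 => y _; rewrite lee_fin powR_ge0.
- by apply: measurable_piece; exact: measurable_itv.
- by move=> x _; apply: erestrict_ge0 => y _; rewrite lee_fin powR_ge0.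
- by apply: measurable_piece; exact: measurable_itv.
rewrite -!integral_mkcond.
apply: le_lt_trans (leeD (integral_powR_near0 e0) (integral_powR_nearoo e0)) _.
by rewrite -EFinD ltry.
Qed.

Lemma measurable_prod_majorant n (e : R) :
  measurable_fun setT (fun t : n.-tuple R => (\prod_(i < n) majorant e (tnth t i))%:E).
Proof.
apply/measurable_EFinP; apply: measurable_prod => i _.
have me : measurable_fun setT (majorant e) by apply/measurable_EFinP; exact: measurable_majorant.
by apply: (measurableT_comp me); exact: measurable_tnth.
Qed.

Lemma integral_prod_majorant n (e : R) : (0 < e)%R ->
  \int[leb n]_t (\prod_(i < n) majorant e (tnth t i))%:E < +oo.
Proof.
move=> e0; elim: n => [|n IH].
  under eq_integral do rewrite big_ord0.
  by rewrite integral_dirac //= diracT mul1e ltry.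
rewrite ge0_integral_tuple_cons; last 2 first.
- exact: measurable_prod_majorant.
- by move=> t; rewrite lee_fin; apply: prodr_ge0 => i _; exact: majorant_ge0.
set I := \int[leb n]_t _ in IH.
have I0 : 0 <= I.
  apply: integral_ge0 => t _; rewrite lee_fin.
  by apply: prodr_ge0 => i _; exact: majorant_ge0.
have inner x : \int[leb n]_t (\prod_(i < n.+1) majorant e (tnth (tuple_cons (x, t)) i))%:E
    = (majorant e x)%:E * I.
  rewrite -ge0_integralZl //; last 3 first.
  - exact: measurable_prod_majorant.
  - by move=> t _; rewrite lee_fin; apply: prodr_ge0 => i _; exact: majorant_ge0.
  - by rewrite lee_fin majorant_ge0.
  apply: eq_integral => t _; rewrite -EFinM; congr (_%:E).
  rewrite big_ord_recl; congr (_ * _)%R.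
  by apply: eq_bigr => i _; rewrite tnthS.
under eq_integral do rewrite inner.
rewrite ge0_integralZr //; last 2 first.
- exact: measurable_majorant.
- by move=> x _; rewrite lee_fin majorant_ge0.
have J := integral_majorant e0.
apply: lte_mul_pinfty => //; first by apply: integral_ge0 => x _; rewrite lee_fin majorant_ge0.
by rewrite ge0_fin_numE //; apply: integral_ge0 => x _; rewrite lee_fin majorant_ge0.
Qed.

End MajorantIntegral.

(** * Integrals of homogeneous functions *)

Section ChengWu.
Variable R : realType.
Local Open Scope classical_set_scope.
Local Open Scope ereal_scope.
Local Notation mu := (@lebesgue_measure R).
Local Notation leb n := (lebesgue_tuple R n).

(** This is [weight y / y] for y > 0, where [weight] below is the indicator function of [1, 2]. Its
    integral [c] is log 2; what is used is that it is positive and finite. *)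
Let kappa : R -> R := (fun y : R => y `^ (-1))%R \_ `[1%R, 2%R].

Let kappa_ge0 y : (0 <= kappa y)%R.
Proof. by rewrite /kappa patchE; case: ifP => // _; exact: powR_ge0. Qed.

Let kappa_le0 y : (y <= 0)%R -> kappa y = 0%R.
Proof.
move=> y0; rewrite /kappa patchE memNset //= in_itv /= => /andP[y1 _]; lra.
Qed.

Let measurable_kappa : measurable_fun setT kappa.
Proof.
apply/(measurable_restrictT _ (measurable_itv _)).
by apply: (measurable_funS measurableT) => //; exact: measurable_powR.
Qed.

Let c : \bar R := \int[mu]_x (kappa x)%:E.

Let kappa_itv : c = \int[mu]_(x in `[1%R, 2%R]) (x `^ (-1))%R%:E.
Proof.
rewrite /c [RHS]integral_mkcond; apply: eq_integral => x _.
by rewrite /kappa !patchE; case: ifP.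
Qed.

Let c_gt0 : 0 < c.
Proof.
rewrite kappa_itv; apply: (@lt_le_trans _ _ (\int[mu]_(x in `[1%R, 2%R]) (2^-1 : R)%:E)).
  rewrite integral_cst //= lebesgue_measure_itv /= lte_fin ltr1n /=.
  by rewrite -EFinB -EFinM lte_fin; lra.
apply: ge0_le_integral => //; first by apply: measurable_powR_fun; exact: measurable_itv.
move=> x /=; rewrite in_itv /= => /andP[x1 x2]; rewrite lee_fin.
by rewrite powR_inv1 ?lef_pV2 ?posrE //; lra.
Qed.

Let c_lty : c < +oo.
Proof.
rewrite kappa_itv; apply: (@le_lt_trans _ _ (\int[mu]_(x in `[1%R, 2%R]) (1 : R)%:E)).
  apply: ge0_le_integral => //.
  - by move=> x _; rewrite lee_fin powR_ge0.
  - by apply: measurable_powR_fun; exact: measurable_itv.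
  move=> x /=; rewrite in_itv /= => /andP[x1 x2]; rewrite lee_fin.
  by rewrite powR_inv1 ?invf_le1 //; lra.
rewrite integral_cst //= lebesgue_measure_itv /= lte_fin ltr1n /=.
by rewrite -EFinB -EFinM ltry.
Qed.

Let total n (t : n.-tuple R) : R := (\sum_i tnth t i)%R.

Let measurable_total n : measurable_fun setT (@total n).
Proof.
have h i : measurable_fun setT (fun t : n.-tuple R => tnth t i).
  exact: measurable_tnth.
exact: (measurable_sum _ h).
Qed.

Let total_cons n x (t : n.-tuple R) : total (tuple_cons (x, t)) = (x + total t)%R.
Proof.
rewrite /total big_ord_recl; congr (_ + _)%R.
by apply: eq_bigr => i _; rewrite tnthS.
Qed.

Let total_scale n a (t : n.-tuple R) : total (tuple_scale a t) = (a * total t)%R.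
Proof. by rewrite /total mulr_sumr; apply: eq_bigr => i _; rewrite tnth_tuple_scale. Qed.

Let total_perm n (s : 'S_n) (t : n.-tuple R) : total (tuple_perm s t) = total t.
Proof.
rewrite /total [RHS](reindex_inj (@perm_inj _ s)).
by apply: eq_bigr => i _; rewrite tnth_tuple_perm.
Qed.

(* [weight (total t)] has a positive finite integral over every ray, with respect
   to the invariant measure of the ray. *)
Let weight (y : R) : R := (y * kappa y)%R.

Let weight_ge0 y : (0 <= weight y)%R.
Proof.
have [y0|y0] := leP y 0%R; first by rewrite /weight kappa_le0 // mulr0.
by rewrite mulr_ge0 // ltW.
Qed.

Let measurable_weight : measurable_fun setT weight.
Proof. by apply: measurable_funM. Qed.

(** In this degree G(t) dt is invariant under scaling. *)
Definition positive_homogeneous n (G : n.+1.-tuple R -> \bar R) : Prop :=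
  [/\ measurable_fun setT G, forall t, 0 <= G t,
    forall t, (exists i, (tnth t i <= 0)%R) -> G t = 0 &
    forall a t, (0 < a)%R -> G (tuple_scale a t) = (a ^- n.+1)%:E * G t].

(** Substitute t = x (1, t') and let s be the total of (1, t'). Homogeneity and the Jacobian x^n
    leave G(1, t') / x, and weight(x s) / x = s kappa(s x), whose integral over x is c for every s >
    0. *)
Lemma cheng_wu n (G : n.+1.-tuple R -> \bar R) : positive_homogeneous G ->
  \int[leb n.+1]_t (G t * (weight (total t))%:E) =
  c * \int[leb n]_t G (tuple_cons (1%R, t)).
Proof.
move=> [mG G0 Gpos Ghom].
have mGh : measurable_fun setT (fun t => G t * (weight (total t))%:E).
  apply: emeasurable_funM => //; apply/measurable_EFinP.
  by apply: (measurableT_comp measurable_weight); exact: measurable_total.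
have Gh0 t : 0 <= G t * (weight (total t))%:E by rewrite mule_ge0 // lee_fin.
rewrite ge0_integral_tuple_cons //.
pose s (t : n.-tuple R) := (1 + total t)%R.
have sE t : s t = total (tuple_cons (1%R, t)) by rewrite total_cons.
have ms : measurable_fun setT s.
  by apply: measurable_funD => //; exact: measurable_total.
have mG1 : measurable_fun setT (fun t => G (tuple_cons (1%R, t))).
  exact: measurable_cons_r.
(* The integrand after the substitution. It is already zero for x <= 0: if s > 0 by the support of
   [kappa], otherwise because [G] vanishes. *)
pose K (p : R * n.-tuple R) := G (tuple_cons (1%R, p.2)) * (s p.2 * kappa (s p.2 * p.1))%:E.
have G1_eq0 t : (s t <= 0)%R -> G (tuple_cons (1%R, t)) = 0.
  move=> st; apply: Gpos.
  have [/existsP//|] := boolP [exists i, (tnth (tuple_cons (1%R, t)) i <= 0)%R].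
  rewrite negb_exists => /forallP hall; exfalso.
  have : (0 <= total t)%R.
    apply: sumr_ge0 => i _; have := hall (lift ord0 i).
    by rewrite tnthS -ltNge => /ltW.
  by move: st; rewrite /s; lra.
have K0 p : 0 <= K p.
  rewrite /K; have [sp|sp] := leP (s p.2) 0%R; last first.
    by rewrite mule_ge0 // lee_fin mulr_ge0 // ltW.
  by rewrite G1_eq0 ?mul0e.
have mK : measurable_fun setT (K : measurableTypeR R * n.-tuple R -> \bar R).
  apply: emeasurable_funM.
    by apply: (measurableT_comp mG1); exact: measurable_snd.
  apply/measurable_EFinP; apply: measurable_funM.
    by apply: (measurableT_comp ms); exact: measurable_snd.
  apply: (measurableT_comp measurable_kappa); apply: measurable_funM.
    by apply: (measurableT_comp ms); exact: measurable_snd.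
  exact: measurable_fst.
have inner x : \int[leb n]_t (G (tuple_cons (x, t)) * (weight (total (tuple_cons (x, t))))%:E)
    = \int[leb n]_t K (x, t).
  have [x0|x0] := leP x 0%R.
    apply: eq_integral => t _; rewrite Gpos ?mul0e; last by exists ord0.
    have [sp|sp] := leP (s t) 0%R; first by rewrite /K G1_eq0 ?mul0e.
    by rewrite /K kappa_le0 ?mulr0 ?mule0 //= pmulr_rle0.
  have xN0 : x != 0%R by rewrite gt_eqF.
  have xscons (t : n.-tuple R) :
      tuple_cons (x, tuple_scale x t) = tuple_scale x (tuple_cons (1%R, t)).
    by apply: val_inj; rewrite /= mulr1.
  set f := fun t => G (tuple_cons (x, t)) * (weight (total (tuple_cons (x, t))))%:E.
  have f0 t : 0 <= f t by exact: Gh0.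
  have mf : measurable_fun setT f by exact: (measurable_cons_r x mGh).
  transitivity ((x ^+ n)%:E * ((x ^- n)%:E * \int[leb n]_t f t)).
    by rewrite muleA -EFinM mulfV ?mul1e // expf_neq0.
  rewrite -(ge0_integral_tuple_scale x0 mf f0) -ge0_integralZl //; last 2 first.
  - by apply: (measurableT_comp mf); exact: measurable_tuple_scale.
  - by rewrite lee_fin exprn_ge0 // ltW.
  apply: eq_integral => t _; rewrite /f xscons Ghom // total_scale -sE /K /=.
  rewrite !muleA -EFinM muleAC -EFinM muleC; congr (_ * _%:E).
  by rewrite /weight (mulrC x (s t)) exprS; field; rewrite xN0 expf_neq0.
under eq_integral do rewrite inner.
rewrite (fubini_tonelli (m1 := mu) (m2 := leb n) K mK K0).
have inner2 t : \int[mu]_x K (x, t) = c * G (tuple_cons (1%R, t)).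
  have [sp|sp] := leP (s t) 0%R.
    rewrite G1_eq0 // mule0; apply: integral0_eq => x _.
    by rewrite /K G1_eq0 // mul0e.
  have -> : (fun x => K (x, t)) =
      fun x => (G (tuple_cons (1%R, t)) * (s t)%:E) * (kappa (s t * x))%:E.
    by apply/funext => x; rewrite /K /= EFinM muleA.
  have mk : measurable_fun setT (EFin \o kappa) by exact/measurable_EFinP.
  have ms' : measurable_fun setT (fun x : measurableTypeR R => (s t * x)%R : measurableTypeR R).
    exact: measurable_funM.
  rewrite ge0_integralZl //; last 3 first.
  - exact: (measurableT_comp mk ms').
  - by move=> x _; rewrite lee_fin.
  - by rewrite mule_ge0 // lee_fin ltW.
  rewrite (ge0_integral_scale sp mk) -/c => [|x]; last by rewrite lee_fin.
  by rewrite muleA -(muleA _ (s t)%:E) -EFinM mulfV ?mule1 ?gt_eqF // muleC.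
under eq_integral do rewrite inner2.
by rewrite ge0_integralZl // ltW.
Qed.

(** A permutation preserves Lebesgue measure and the total, hence the weighted integral, and the
    constant c can be cancelled. *)
Lemma projective_integral_perm n (G : n.+1.-tuple R -> \bar R) (s : 'S_n.+1) :
  positive_homogeneous G ->
  \int[leb n]_t G (tuple_perm s (tuple_cons (1%R, t))) =
  \int[leb n]_t G (tuple_cons (1%R, t)).
Proof.
move=> hG; have [mG G0 Gpos Ghom] := hG.
have hGs : positive_homogeneous (G \o tuple_perm s).
  split=> [|t|t [i ti]|a t a0] /=.
  - by apply: measurableT_comp => //; exact: measurable_tuple_perm.
  - exact: G0.
  - by apply: Gpos; exists (s^-1%g i); rewrite tnth_tuple_perm permKV.
  rewrite -Ghom //; congr G; apply/eq_from_tnth => i.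
  by rewrite tnth_tuple_perm !tnth_tuple_scale tnth_tuple_perm.
have cfin : c \is a fin_num by rewrite ge0_fin_numE // ltW.
suff : c * \int[leb n]_t G (tuple_perm s (tuple_cons (1%R, t))) =
       c * \int[leb n]_t G (tuple_cons (1%R, t)).
  move/(congr1 (fun y => ((fine c)^-1)%:E * y)).
  have c0 : (fine c != 0)%R by rewrite gt_eqF // fine_gt0 // c_gt0 c_lty.
  have cc : ((fine c)^-1)%:E * c = 1.
    by rewrite -[X in _ * X](fineK cfin) -EFinM mulVf.
  by rewrite !muleA cc !mul1e.
have <- := cheng_wu hG; have <- := cheng_wu hGs.
set W := fun t => G t * (weight (total t))%:E.
have mW : measurable_fun setT W.
  apply: emeasurable_funM => //; apply/measurable_EFinP.
  by apply: (measurableT_comp measurable_weight); exact: measurable_total.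
have W0 t : 0 <= W t by rewrite mule_ge0 // lee_fin.
rewrite -(ge0_integral_tuple_perm s mW W0); apply: eq_integral => t _.
by rewrite /W /= total_perm.
Qed.

End ChengWu.

(** * The integral of the density *)

Section EtaMeasurable.
Variable R : realType.
Local Open Scope classical_set_scope.
Variables (d0 : measure_display) (T : measurableType d0) (D : set T).
Hypothesis mD : measurable D.

(** Functions are given on D only, where x is positive and the Gram matrix invertible; measurability
    is that of an extension to T. *)
Let P (f : {t | D t} -> R) : Prop :=
  exists2 h : T -> R, measurable_fun D h & forall t, h (sval t) = f t.

Let P_subring : function_subring P.
Proof.
split=> [c|f g [h mh hE] [k mk kE]|f g [h mh hE] [k mk kE]].
- by exists (fun=> c) => //; exact: measurable_cst.
- by exists (h \+ k) => [|t]; [exact: measurable_funD | rewrite /= hE kE].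
- by exists (h \* k) => [|t]; [exact: measurable_funM | rewrite /= hE kE].
Qed.

(** The inverse and the inverse square root of the determinant are both treated as real powers. *)
Let P_powR f (c : R) : P f -> P (fun t => f t `^ c).
Proof.
move=> [h mh hE]; exists (fun t => h t `^ c) => [|t]; last by rewrite hE.
exact: (measurableT_comp (measurable_powR c) mh).
Qed.

Lemma measurable_eta m n w (C : 'M[R]_(m, n)) (X : T -> 'rV[R]_m) S :
  (forall i, measurable_fun D (fun t => X t 0 i)) ->
  (forall t, D t -> forall i, 0 < X t 0 i) ->
  (exists B : {ffun 'I_n -> 'I_m}, \det (rowsub B C) != 0) ->
  measurable_fun D (fun t => eta w (X t) C S).
Proof.
move=> mX X0 [B dB]; have sub := P_subring.
suff [h mh hE] : P (fun t => eta w (X (sval t)) C S).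
  apply: (eq_measurable_fun h) => // t; rewrite inE => Dt.
  exact: (hE (exist _ t Dt)).
have detX (t : {t | D t}) : 0 < \det (gram (X (sval t)) C).
  by case: t => t Dt; apply: det_gram_gt0 dB => i; exact: X0.
have PX i j : P (fun t => gram (X (sval t)) C i j).
  apply: (fs_eq (f := fun t : {t | D t} =>
    \sum_k (X (sval t) 0 k * (C k i * C k j)))) => [t|]; first by rewrite gramE.
  apply: fs_sum => // k _; apply: (fs_mul sub); last exact: fs_cst.
  by exists (fun t => X t 0 k).
have Pdet : P (fun t => \det (gram (X (sval t)) C)) by exact: fs_det.
apply: (ext_in_canonical_form sub).
- apply: (fs_invmx sub) => //; first by move=> t; rewrite unitmxE unitfE gt_eqF.
  apply: (fs_eq (f := fun t : {t | D t} => \det (gram (X (sval t)) C) `^ (-1))) => [t|];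
    last exact: P_powR.
  by rewrite powR_inv1 // ltW.
- move=> i j B'.
  apply: (@fs_eq _ _ _ (fun=> gram_form (dx_row R m) C i j B')) => //.
  exact: fs_cst.
apply: (fs_eq (f := fun t : {t | D t} => \det (gram (X (sval t)) C) `^ (- 2^-1))) => [t|];
  last exact: P_powR.
by rewrite powRN powR12_sqrt // ltW.
Qed.

End EtaMeasurable.

Section EtaIntegrable.
Variable R : realType.
Local Open Scope classical_set_scope.

Definition orthant n : set (n.-tuple R) := [set t | forall i, 0 < tnth t i].

Lemma measurable_orthant n : measurable (@orthant n).
Proof.
rewrite (_ : @orthant n = tuple_rect (fun=> `]0%R, +oo[ : set R)).
  by apply: measurable_tuple_rect => i; exact: measurable_itv.
by apply/seteqP; split=> t /= h i; have := h i; rewrite /= in_itv /= andbT.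
Qed.

Lemma powR_prod (I : finType) (a : I -> R) (e : R) : (forall i, 0 <= a i) ->
  (\prod_i a i) `^ e = \prod_i (a i `^ e).
Proof.
move=> a0; elim: (index_enum I) => [|i r IH]; first by rewrite !big_nil powR1.
by rewrite !big_cons powRM ?IH // prodr_ge0.
Qed.

Lemma chart_lt (m : nat) (t : m.-1.-tuple R) (i : 'I_m) (j : 'I_m.-1) :
  i = j :> nat -> chart t 0 i = tnth t j.
Proof. by move=> ij; rewrite mxE ij (tnth_nth 1). Qed.

Lemma chart_last m (t : m.-1.-tuple R) (i : 'I_m) : i = m.-1 :> nat -> chart t 0 i = 1.
Proof. by move=> im; rewrite mxE nth_default // size_tuple im. Qed.

Lemma chart_gt0 m (t : m.-1.-tuple R) i : orthant t -> 0 < chart t 0 i.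
Proof.
move=> t0; have [im|im] := ltnP i m.-1.
  by rewrite (@chart_lt _ _ _ (Ordinal im)).
by rewrite chart_last //; have := ltn_ord i; lia.
Qed.

Lemma measurable_chart m (i : 'I_m) :
  measurable_fun setT (fun t : m.-1.-tuple R => chart t 0 i).
Proof.
have [im|im] := ltnP i m.-1.
  rewrite (_ : (fun _ => _) = (fun t => tnth t (Ordinal im))).
    exact: measurable_tnth.
  by apply/funext => t; exact: chart_lt.
rewrite (_ : (fun _ => _) = (fun=> 1)); first exact: measurable_cst.
by apply/funext => t; apply: chart_last; have := ltn_ord i; lia.
Qed.

Definition chart_set m : {set 'I_m} := [set i : 'I_m | (i < m.-1)%N]%SET.

Lemma prod_chart m (t : m.-1.-tuple R) :
  \prod_(i in chart_set m) chart t 0 i = \prod_(i < m.-1) tnth t i.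
Proof.
case: m t => [|m] t; first by rewrite big_ord0 big1 // => -[].
rewrite big_mkcond big_ord_recr /= inE ltnn mulr1; apply: eq_bigr => i _.
by rewrite inE /= ltn_ord; exact: chart_lt.
Qed.

Lemma eta_chart_bound m n w d (C : 'M[R]_(m, n)) : homogeneous d w ->
  (d + n).+1 = m -> (1 < m)%N ->
  (exists B : {ffun 'I_n -> 'I_m}, \det (rowsub B C) != 0) ->
  exists (K e : R), [/\ 0 <= K, 0 < e & forall t : m.-1.-tuple R, orthant t ->
    `|eta w (chart t) C (chart_set m)| <= K * \prod_(i < m.-1) majorant e (tnth t i)].
Proof.
move=> hw dm m1 hC; have [K K0 hK] := eta_ratio_bound hw dm hC.
(* One inequality with exponent 2 (m+1) is used for each of the m - 1 coordinates; e undoes the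
   exponent of their product. *)
pose p := (2 * m.+1 * m.-1)%N.
have p0 : (0 < p)%N by rewrite !muln_gt0 /=; lia.
pose e : R := p%:R^-1.
have e0 : 0 < e by rewrite invr_gt0 ltr0n.
exists ((K ^+ m.-1) `^ e), e; split=> // [|t t0]; first exact: powR_ge0.
have x0 i := chart_gt0 i t0.
pose P := \prod_(i < m.-1) tnth t i.
have P0 : 0 < P by apply: prodr_gt0.
set v := `|_|; have v0 : 0 <= v * P by rewrite mulr_ge0 ?normr_ge0 // ltW.
(* Coordinate i is compared in both orders with the last one, which is 1. *)
have hr (i : 'I_m.-1) : (v * P) ^+ (2 * m.+1) <= K * Num.min (tnth t i) (tnth t i)^-1.
  have im : (i < m)%N by rewrite (leq_trans (ltn_ord i)) // leq_pred.
  have mm : (m.-1 < m)%N by lia.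
  have h1 := hK _ x0 (chart_set m) (Ordinal im) (Ordinal mm).
  have h2 := hK _ x0 (chart_set m) (Ordinal mm) (Ordinal im).
  rewrite prod_chart (@chart_last _ _ (Ordinal mm)) // (@chart_lt _ _ (Ordinal im) i) // in h1 h2.
  rewrite divr1 in h1; rewrite div1r in h2.
  by rewrite /Num.min; case: ifP.
have r0 (i : 'I_m.-1) : 0 <= Num.min (tnth t i) (tnth t i)^-1.
  by rewrite le_min invr_ge0 !ltW //; exact: t0.
have hp : (v * P) ^+ p <= K ^+ m.-1 * \prod_(i < m.-1) Num.min (tnth t i) (tnth t i)^-1.
  rewrite /p exprM -[X in _ ^+ X]card_ord -prodr_const.
  rewrite -[X in K ^+ X]card_ord -prodr_const -big_split /=.
  by apply: ler_prod => i _; rewrite hr exprn_ge0.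
have vP : v * P <= (K ^+ m.-1) `^ e *
    \prod_(i < m.-1) (Num.min (tnth t i) (tnth t i)^-1 `^ e).
  rewrite -powR_prod // -powRM ?exprn_ge0 ?prodr_ge0 //.
  have -> : v * P = ((v * P) ^+ p) `^ e.
    by rewrite -powR_mulrn // -powRrM mulfV ?powRr1 // pnatr_eq0 -lt0n.
  apply: ge0_ler_powR; rewrite ?nnegrE ?exprn_ge0 //; first exact: ltW.
  by rewrite mulr_ge0 ?exprn_ge0 // prodr_ge0.
rewrite (eq_bigr (fun i => Num.min (tnth t i) (tnth t i)^-1 `^ e * (tnth t i)^-1)).
  by rewrite big_split /= prodfV mulrA ler_pdivlMr.
by move=> i _; rewrite majorantE //; exact: t0.
Qed.

Lemma eta_chart_integrable m n w d (C : 'M[R]_(m, n)) : homogeneous d w ->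
  (d + n).+1 = m -> (1 < m)%N ->
  (exists B : {ffun 'I_n -> 'I_m}, \det (rowsub B C) != 0) ->
  (lebesgue_tuple R m.-1).-integrable (@orthant m.-1)
    (fun t => (eta w (chart t) C (chart_set m))%:E).
Proof.
move=> hw dm m1 hC; have [K [e [K0 e0 hK]]] := eta_chart_bound hw dm m1 hC.
have mQ := @measurable_orthant m.-1.
have mM := @measurable_prod_majorant R m.-1 e.
have M0 (t : m.-1.-tuple R) : 0 <= \prod_(i < m.-1) majorant e (tnth t i).
  by apply: prodr_ge0 => i _; exact: majorant_ge0.
apply: (le_integrable mQ (g := fun t => (K * \prod_(i < m.-1) majorant e (tnth t i))%:E)).
- apply/measurable_EFinP; apply: measurable_eta => //; last by move=> t t0 i; exact: chart_gt0.
  by move=> i; apply: (measurable_funS measurableT) => //; exact: measurable_chart.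
- move=> t t0; rewrite lee_fin [leRHS]ger0_norm ?mulr_ge0 //.
  exact: hK.
apply: (integrableS measurableT) => //.
under eq_fun do rewrite EFinM.
apply: integrableZl => //; apply/integrableP; split=> //.
under eq_integral do rewrite gee0_abs ?lee_fin //.
exact: integral_prod_majorant.
Qed.

End EtaIntegrable.

(** * Independence of the affine chart *)

Section ProjectiveIntegral.
Variables (R : realType) (k : nat).
Local Open Scope classical_set_scope.
Local Notation leb := (lebesgue_tuple R k).

Variable V : k.+1.-tuple R -> R.
Hypothesis mV : measurable_fun (@orthant R k.+1) V.
Hypothesis V_hom : forall a u, 0 < a -> orthant u ->
  V (tuple_scale a u) = a ^- k.+1 * V u.

Lemma orthant_cons t : @orthant R k.+1 (tuple_cons (1%R, t)) <-> @orthant R k t.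
Proof.
split=> h i; first by have := h (lift ord0 i); rewrite tnthS.
by case: (unliftP ord0 i) => [j|] ->; rewrite ?tnthS ?tnth0.
Qed.

Lemma orthant_perm n (s : 'S_n) (u : n.-tuple R) :
  orthant (tuple_perm s u) <-> orthant u.
Proof.
split=> h i; last by rewrite tnth_tuple_perm.
by have := h (s^-1%g i); rewrite tnth_tuple_perm permKV.
Qed.

Let posV_integral_perm (W : k.+1.-tuple R -> R) (s : 'S_k.+1) :
  measurable_fun (@orthant R k.+1) W ->
  (forall a u, 0 < a -> orthant u -> W (tuple_scale a u) = a ^- k.+1 * W u) ->
  (\int[leb]_(t in @orthant R k) (Num.max (W (tuple_perm s (tuple_cons (1%R, t)))) 0)%:E =
   \int[leb]_(t in @orthant R k) (Num.max (W (tuple_cons (1%R, t))) 0)%:E)%E.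
Proof.
move=> mW W_hom; have mQ := @measurable_orthant R k.+1.
pose G := (fun u => (Num.max (W u) 0)%:E) \_ (@orthant R k.+1).
have G_in u : orthant u -> G u = (Num.max (W u) 0)%:E.
  by move=> hu; rewrite /G patchE mem_set.
have G_out u : ~ orthant u -> G u = 0%E by move=> hu; rewrite /G patchE memNset.
have GE s' : (\int[leb]_(t in @orthant R k) (Num.max (W (tuple_perm s' (tuple_cons (1%R, t)))) 0)%:E =
    \int[leb]_t G (tuple_perm s' (tuple_cons (1%R, t))))%E.
  rewrite integral_mkcond; apply: eq_integral => t _; rewrite patchE.
  have [tQ|tQ] := pselect (orthant t).
    by rewrite mem_set // G_in //; apply/orthant_perm/orthant_cons.
  by rewrite memNset // G_out // => /orthant_perm/orthant_cons.
have perm1E u : tuple_perm (1%g : 'S_k.+1) u = u :> k.+1.-tuple R.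
  by apply/eq_from_tnth => i; rewrite tnth_tuple_perm perm1.
have := GE 1%g; under eq_integral do rewrite perm1E.
under [in RHS]eq_integral do rewrite perm1E.
move=> ->; rewrite GE; apply: projective_integral_perm; split.
- apply/(measurable_restrictT _ mQ)/measurable_EFinP.
  by apply: measurable_maxr => //; exact: measurable_cst.
- by move=> u; apply: erestrict_ge0 => v _; rewrite lee_fin le_max lexx orbT.
- move=> u [i ui]; apply: G_out => /(_ i); by rewrite ltNge ui.
move=> a u a0; have [uQ|uQ] := pselect (orthant u).
  have auQ : orthant (tuple_scale a u).
    by move=> i; rewrite tnth_tuple_scale mulr_gt0 //; exact: uQ.
  rewrite !G_in // W_hom // -EFinM maxr_pMr ?mulr0 //.
  by rewrite invr_ge0 exprn_ge0 // ltW.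
rewrite !G_out ?mule0 // => h; apply: uQ => i.
by have := h i; rewrite tnth_tuple_scale pmulr_rgt0.
Qed.

Lemma integral_projective_perm (s : 'S_k.+1) :
  \int[leb]_(t in @orthant R k) V (tuple_perm s (tuple_cons (1%R, t))) =
  \int[leb]_(t in @orthant R k) V (tuple_cons (1%R, t)).
Proof.
(* The comparison of charts is about nonnegative functions, so the positive and negative parts are
   treated separately. *)
rewrite /Rintegral integralE [in RHS]integralE; congr (fine (_ - _)%E).
  under eq_integral do rewrite funeposE /= -EFin_max.
  under [in RHS]eq_integral do rewrite funeposE /= -EFin_max.
  exact: posV_integral_perm.
under eq_integral do rewrite funenegE /= -EFin_max.
under [in RHS]eq_integral do rewrite funenegE /= -EFin_max.
apply: (posV_integral_perm (W := fun u => - V u)).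
  by apply: measurable_funN.
by move=> a u a0 uQ; rewrite V_hom // mulrN.
Qed.

End ProjectiveIntegral.

Lemma inv_scale (F : fieldType) k (a y z : F) : a != 0 ->
  (a * y)^-1 * z = a ^- k.+1 * (y^-1 * (a ^+ k * z)).
Proof.
move=> a0; rewrite exprS !invfM -!mulrA; congr (_ * _).
by rewrite mulrCA mulKf // expf_neq0.
Qed.

Section EtaVolume.
Variables (R : realType) (k n : nat).
Implicit Types (x : 'rV[R]_k.+1) (C : 'M[R]_(k.+1, n)).

(** The coefficient of eta /\ d log x_m on dx_1 ... dx_m. Unlike the coefficient of dx_1 ...
    dx_(m-1) alone, it does not depend on which coordinate is singled out. *)
Definition eta_vol w C x : R := (x 0 ord_max)^-1 * eta w x C (chart_set k.+1).

Lemma wedge_dx_last (a : ext R k.+1) :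
  (a * dx R ord_max) finset.setT = a (chart_set k.+1).
Proof.
have setE : (finset.setT :\: chart_set k.+1 = [set ord_max])%SET.
  apply/setP => i; rewrite !inE -val_eqE /=; have := ltn_ord i; lia.
rewrite ffunE (bigD1 (chart_set k.+1)) ?finset.subsetT //= setE ffunE eqxx.
rewrite /inversions big1 => [|i _]; last first.
  by rewrite big_set1 ltnNge -ltnS ltn_ord.
rewrite expr0 mul1r mulr1 big1 ?addr0 // => B /andP[_ nB]; rewrite ffunE.
case: eqP => [BE|_]; last by rewrite !mulr0.
case/eqP: nB; apply/setP => i; have /setP/(_ i) := BE; have /setP/(_ i) := setE.
by rewrite !inE !andbT => <- /negb_inj.
Qed.

Lemma card_chart_set : #|chart_set k.+1| = k.
Proof.
have -> : chart_set k.+1 = (~: [set ord_max])%SET.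
  apply/setP => i; rewrite !inE -val_eqE /=; have := ltn_ord i; lia.
by rewrite cardsC1 card_ord.
Qed.

Lemma eta_volE d w C x i : homogeneous d w -> (d + n)%N = k ->
  gram x C \in unitmx -> x 0 i != 0 -> x 0 ord_max != 0 ->
  eta_vol w C x = (eta w x C * ((x 0 i)^-1 *: dx R i)) finset.setT.
Proof.
move=> hw dk uX xi xm.
rewrite (eta_wedge_dlog (d := d) (j := ord_max)) ?dk //.
by rewrite -scalerAr ffunE wedge_dx_last.
Qed.

(** Multiplying C by the square root of a is a rescaling of the rows and also a change of basis of
    positive determinant, which leaves [eta] unchanged. *)
Lemma eta_scale w C x a S : 0 < a -> gram x C \in unitmx ->
  eta w x C S = a ^+ #|S| * eta w (a *: x) C S.
Proof.
move=> a0 uX; pose c : 'rV[R]_k.+1 := const_mx (Num.sqrt a).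
have c2 i : c 0 i ^+ 2 = a by rewrite mxE sqr_sqrtr // ltW.
have s0 : 0 < Num.sqrt a by rewrite sqrtr_gt0.
have := eta_row_scale w x c C.
have -> : diag_mx c *m C = C *m (Num.sqrt a)%:M.
  by rewrite diag_const_mx mul_scalar_mx mul_mx_scalar.
have dS : 0 < \det ((Num.sqrt a)%:M : 'M[R]_n) by rewrite det_scalar exprn_gt0.
rewrite eta_mulmx //; last by rewrite unitmxE unitfE gt_eqF.
rewrite gtr0_sg // scale1r.
have -> : (\row_i (c 0 i ^+ 2 * x 0 i)) = a *: x.
  by apply/rowP => i; rewrite mxE c2 mxE.
move=> ->; rewrite ext_map_diag; congr (_ * _).
by under eq_bigr do rewrite mxE c2; rewrite prodr_const.
Qed.

Lemma eta_vol_scale w C x a : 0 < a -> gram x C \in unitmx ->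
  eta_vol w C (a *: x) = a ^- k.+1 * eta_vol w C x.
Proof.
move=> a0 uX; have := eta_scale w (chart_set k.+1) a0 uX; rewrite /eta_vol.
move: (eta w (a *: x) C) (eta w x C) => f g ->; rewrite card_chart_set.
by rewrite [(a *: x) 0 _]mxE; apply: inv_scale; rewrite gt_eqF.
Qed.

(** Both Gram matrices are quadratic in the rows, so the signs cancel and only the relabelling of
    the edges remains. *)
Lemma eta_signed_perm w C C' (s : 'S_k.+1) (ep : 'I_k.+1 -> R) x :
  (forall i, ep i ^+ 2 = 1) -> (forall i j, C' (s i) j = ep i * C i j) ->
  eta w x C' = ext_map (perm_mx s) (eta w (\row_i x 0 (s i)) C).
Proof.
move=> ep2 C'E.
have CC i a b : C' (s i) a * C' (s i) b = C i a * C i b.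
  by rewrite !C'E mulrACA -expr2 ep2 mul1r.
have XE : gram x C' = gram (\row_i x 0 (s i)) C.
  apply/matrixP => a b; rewrite [LHS]gramE [RHS]gramE.
  rewrite (reindex_inj (@perm_inj _ s)); apply: eq_bigr => i _.
  by rewrite CC mxE.
rewrite ext_map_eta /eta XE; apply: (congr1 (canonical_form w _)).
apply/matrixP => a b; rewrite [LHS]gram_formE [RHS]gram_formE.
rewrite (reindex_inj (@perm_inj _ s)); apply: eq_bigr => i _.
by rewrite CC /dx_row !mxE linear_form_row_perm.
Qed.

Lemma eta_vol_signed_perm d w C C' (s : 'S_k.+1) (ep : 'I_k.+1 -> R) x :
  homogeneous d w -> (d + n)%N = k ->
  (forall i, ep i ^+ 2 = 1) -> (forall i j, C' (s i) j = ep i * C i j) ->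
  (forall i, x 0 i != 0) -> gram x C' \in unitmx ->
  gram (\row_i x 0 (s i)) C \in unitmx ->
  eta_vol w C' x = (-1) ^+ s * eta_vol w C (\row_i x 0 (s i)).
Proof.
move=> hw dk ep2 C'E x0 uX uX'.
(* Any edge may carry the logarithmic factor; [s ord_max] is chosen because the pullback sends the
   factor of [ord_max] to that of [s ord_max]. *)
rewrite (eta_volE (i := s ord_max) hw dk uX) // (eta_signed_perm w _ ep2 C'E).
rewrite (eta_volE (i := ord_max) hw dk uX') ?mxE //.
rewrite -ext_map_perm_top; move: (eta w _ C) => e.
by rewrite rmorphM /= [ext_map _ (_ *: _)]linearZ /= ext_map_dx linear_form_row_perm.
Qed.

End EtaVolume.

Section EtaIntegral.
Variable R : realType.
Local Open Scope classical_set_scope.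
Implicit Types (m n : nat) (w : canonical_poly R).

Definition full_rank m n (C : 'M[R]_(m, n)) : Prop :=
  exists B : {ffun 'I_n -> 'I_m}, \det (rowsub B C) != 0.

Lemma gram_unitmx m n (C : 'M[R]_(m, n)) (x : 'rV[R]_m) : full_rank C ->
  (forall i, 0 < x 0 i) -> gram x C \in unitmx.
Proof.
by case=> B dB x0; rewrite unitmxE unitfE gt_eqF //; exact: det_gram_gt0 dB.
Qed.

Lemma full_rank_signed_perm m n (C C' : 'M[R]_(m, n)) (s : 'S_m) (ep : 'I_m -> R) :
  (forall i, ep i ^+ 2 = 1) -> (forall i j, C' (s i) j = ep i * C i j) ->
  full_rank C -> full_rank C'.
Proof.
move=> ep2 C'E [B dB]; exists [ffun j => s (B j)].
have -> : rowsub [ffun j => s (B j)] C' = diag_mx (\row_j ep (B j)) *m rowsub B C.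
  by apply/matrixP => i j; rewrite mul_diag_mx !mxE ffunE C'E.
rewrite det_mulmx det_diag mulf_neq0 //; apply/prodf_neq0 => i _; rewrite mxE.
by apply: contra_eq_neq (ep2 (B i)) => ->; rewrite expr0n /= eq_sym oner_eq0.
Qed.

Definition eta_integral m n w (C : 'M[R]_(m, n)) : R :=
  \int[lebesgue_tuple R m.-1]_(t in @orthant R m.-1) eta w (chart t) C (chart_set m).

Lemma eta_integral_mulmx m n w d (C : 'M[R]_(m, n)) (U : 'M[R]_n) :
  homogeneous d w -> (d + n).+1 = m -> (1 < m)%N -> full_rank C -> U \in unitmx ->
  eta_integral w (C *m U) = Num.sg (\det U) * eta_integral w C.
Proof.
move=> hw dm m1 hC uU.
rewrite -RintegralZl; last 2 first.
- exact: measurable_orthant.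
- exact: eta_chart_integrable hw dm m1 hC.
apply: eq_Rintegral => t; rewrite inE => t0.
have uX := gram_unitmx hC (fun i => chart_gt0 i t0).
have -> := eta_mulmx w uX uU.
by move: (eta _ _ _) => f; rewrite ffunE.
Qed.

Lemma eta_integral_signed_perm m n w d (C C' : 'M[R]_(m, n)) (s : 'S_m) (ep : 'I_m -> R) :
  homogeneous d w -> (d + n).+1 = m -> (1 < m)%N -> full_rank C ->
  (forall i, ep i ^+ 2 = 1) -> (forall i j, C' (s i) j = ep i * C i j) ->
  eta_integral w C' = (-1) ^+ s * eta_integral w C.
Proof.
case: m C C' s ep => // k C C' s ep hw [dk] m1 hC ep2 C'E.
have hC' := full_rank_signed_perm ep2 C'E hC.
(* [chart] puts the coordinate 1 last and [tuple_cons] puts it first. The cyclic shift r translates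
   between them, so s is conjugated by r. *)
pose r : 'S_k.+1 := perm (@ordS_inj k.+1).
pose V (u : k.+1.-tuple R) := eta_vol w C (\row_i tnth u (r i)).
have chartE (t : k.-tuple R) i : @chart R k.+1 t 0 i = tnth (tuple_cons (1, t)) (r i).
  rewrite !mxE (tnth_nth 1) permE /=; have [ik|ik] := eqVneq (i : nat) k.
    by rewrite ik modnn nth_default // size_tuple.
  by rewrite modn_small // ltnS ltn_neqAle ik -ltnS ltn_ord.
have posV (u : k.+1.-tuple R) : orthant u -> forall i, 0 < (\row_i tnth u (r i)) 0 i.
  by move=> u0 i; rewrite mxE; exact: u0.
have mQ := @measurable_orthant R k.+1.
have mV : measurable_fun (@orthant R k.+1) V.
  apply: measurable_funM.
    apply: (eq_measurable_fun (fun u : k.+1.-tuple R => tnth u (r ord_max) `^ (-1))).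
      by move=> u; rewrite inE => u0; rewrite mxE powR_inv1 // ltW.
    apply: (measurableT_comp (measurable_powR _)).
    by apply: (measurable_funS measurableT) => //; exact: measurable_tnth.
  apply: measurable_eta => //.
  move=> i; apply: (eq_measurable_fun (fun u : k.+1.-tuple R => tnth u (r i))).
    by move=> u _; rewrite mxE.
  by apply: (measurable_funS measurableT) => //; exact: measurable_tnth.
have V_hom a u : 0 < a -> orthant u -> V (tuple_scale a u) = a ^- k.+1 * V u.
  move=> a0 u0; have uX := gram_unitmx hC (posV _ u0).
  apply: etrans (eta_vol_scale w a0 uX); apply: (congr1 (eta_vol w C)).
  by apply/rowP => i; rewrite !mxE tnth_tuple_scale.
have volE (D : 'M[R]_(k.+1, n)) (t : k.-tuple R) :
    eta_vol w D (@chart R k.+1 t) = eta w (@chart R k.+1 t) D (chart_set k.+1).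
  by rewrite /eta_vol chart_last // invr1 mul1r.
have := integral_projective_perm mV V_hom (r^-1 * s * r)%g.
have VE (t : k.-tuple R) : V (tuple_cons (1, t)) = eta w (@chart R k.+1 t) C (chart_set k.+1).
  rewrite -volE /V; apply: (congr1 (eta_vol w C)).
  by apply/rowP => i; rewrite mxE chartE.
under [in RHS]eq_Rintegral do rewrite VE.
move=> intE; apply: (canRL (signrMK s)); apply: etrans intE.
rewrite /eta_integral -RintegralZl; last 2 first.
- exact: measurable_orthant.
- exact: eta_chart_integrable hw (congr1 S dk) m1 hC'.
apply: eq_Rintegral => t; rewrite inE => t0.
rewrite -volE.
have x0 i := @chart_gt0 R k.+1 t i t0.
rewrite (eta_vol_signed_perm hw dk ep2 C'E) //; last 3 first.
- by move=> i; rewrite gt_eqF.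
- exact: gram_unitmx.
- by apply: gram_unitmx => // i; rewrite mxE.
rewrite signrMK /V; apply: (congr1 (eta_vol w C)); apply/rowP => i.
by rewrite !mxE tnth_tuple_perm !permM permK -chartE mxE.
Qed.

End EtaIntegral.

(** * Orientations *)

Section CyclesPaths.
Variables (l p m : nat) (Elp : (l + p)%N = m).

Definition cycles_paths_det (C : 'M[int]_(m, l)) (P : 'M[int]_(m, p)) : int :=
  \det (conform_mx (0 : 'M[int]_m) (row_mx C P)).

Lemma cycles_paths_det_block (Q : 'M[int]_m) C P C' P' U W A :
  Q *m C = C' *m U -> Q *m P = C' *m W + P' *m A ->
  \det Q * cycles_paths_det C P = cycles_paths_det C' P' * (\det U * \det A).
Proof.
rewrite /cycles_paths_det; move: Q C P C' P'; rewrite -Elp => Q C P C' P' QC QP.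
rewrite !conform_mx_id -det_mulmx -(det_ublock U W A) -det_mulmx.
by rewrite mul_mx_row QC QP mul_row_block mulmx0 addr0.
Qed.

Lemma full_rank_cycles (R : realType) C P : cycles_paths_det C P != 0 ->
  full_rank (map_mx intr C : 'M[R]_(m, l)).
Proof.
rewrite /cycles_paths_det => dCP.
have [L LC] : exists L : 'M[R]_(l, m), L *m map_mx intr C = 1%:M.
  move: C P dCP; rewrite -Elp => C P; rewrite conform_mx_id => dCP.
  have : map_mx intr (row_mx C P) \in @unitmx R (l + p).
    by rewrite unitmxE det_map_mx unitfE intr_eq0.
  move=> /mulVmx; set M := invmx _; rewrite map_row_mx -[M]vsubmxK mul_col_row.
  rewrite scalar_mx_block => /eq_block_mx[h _ _ _]; by exists (usubmx M).
have fullC : row_full (map_mx intr C : 'M[R]_(m, l)) by apply/row_fullP; exists L.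
by exists (fullrankfun fullC); rewrite -unitfE -unitmxE fullrowsub_unit.
Qed.

End CyclesPaths.

(** The columns are v_(i+1) - v_0, a basis of the 0-chains of total degree 0. *)
Definition based_boundary p : 'M[int]_(1 + p, p) := col_mx (const_mx (-1)) 1%:M.

Lemma based_boundaryE p (v : 'I_p.+1) i :
  based_boundary p v i = (v == i.+1 :> nat)%:R - (v == 0 :> nat)%:R.
Proof.
rewrite mxE; case: splitP => j vj; rewrite mxE (vj : @nat_of_ord p.+1 v = _) ?ord1 //.
by rewrite subr0 -val_eqE /= add1n eqSS.
Qed.

(** N is the basis of v_0 and the differences v_(i+1) - v_0. In it a permutation is block triangular
    with corner 1, since it preserves the sum of the coordinates; the other diagonal block A
    therefore carries the whole determinant. *)
Lemma perm_based_boundary p (s : 'S_p.+1) : exists2 A : 'M[int]_p,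
  perm_mx s *m based_boundary p = based_boundary p *m A & \det A = (-1) ^+ s.
Proof.
pose N : 'M[int]_(1 + p) := block_mx 1%:M (const_mx (-1)) 0 1%:M.
pose N' : 'M[int]_(1 + p) := block_mx 1%:M (const_mx 1) 0 1%:M.
have NN' : N *m N' = 1%:M.
  rewrite mulmx_block !mulmx1 !mul1mx !mul0mx !mulmx0 !addr0 add0r.
  rewrite (_ : const_mx 1 + const_mx (-1) = 0) ?scalar_mx_block //.
  by apply/matrixP => i j; rewrite !mxE subrr.
have detN : \det N = 1 by rewrite det_ublock !det1 mulr1.
pose S : 'M[int]_(1 + p) := perm_mx s.
pose X := N' *m S *m N.
have NX : N *m X = S *m N by rewrite !mulmxA NN' mul1mx.
have oneS : const_mx 1 *m S = const_mx 1 :> 'rV[int]_(1 + p).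
  apply/rowP => i; rewrite !mxE (bigD1 (s^-1%g i)) //= !mxE permKV eqxx mulr1.
  rewrite big1 ?addr0 // => j; rewrite !mxE -(inj_eq (@perm_inj _ s)) permKV.
  by move=> /negbTE ->; rewrite mulr0.
have oneX : const_mx 1 *m (S *m N) = row_mx 1%:M 0 :> 'rV[int]_(1 + p).
  rewrite mulmxA oneS -row_mx_const mul_row_block !mulmx0 !mulmx1 addr0; congr row_mx.
    by apply/rowP => i; rewrite !mxE ord1.
  by apply/rowP => i; rewrite !mxE big_ord1 !mxE mul1r addrC subrr.
have XE : usubmx X = row_mx 1%:M 0.
  by rewrite -oneX /X -mulmxA -mul_usub_mx /N' block_mxEv col_mxKu (_ : 1%:M = const_mx 1) ?row_mx_const //;
     apply/rowP => i; rewrite !mxE ord1.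
have XE' : X = block_mx 1%:M 0 (dlsubmx X) (drsubmx X).
  by rewrite block_mxEv -XE hsubmxK vsubmxK.
exists (drsubmx X).
  have Nr : N = row_mx (col_mx 1%:M 0) (based_boundary p) by rewrite /N block_mxEh.
  have Xr : rsubmx X = col_mx 0 (drsubmx X) by rewrite {1}XE' block_mxEh row_mxKr.
  have := congr1 rsubmx NX; rewrite -(mulmx_rsub N X) -(mulmx_rsub S N) Xr {2}Nr row_mxKr => <-.
  by rewrite Nr mul_row_col mulmx0 add0r.
have := congr1 determinant NX; rewrite (det_mulmx N X) (det_mulmx S N) detN mul1r mulr1 det_perm => <-.
by rewrite XE' det_lblock det1 mul1r block_mxKdr.
Qed.

Lemma perm_based_paths n (s : 'S_n) (Y : 'M[int]_(n, n.-1)) : (0 < n)%N ->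
  (forall (v : 'I_n) (i : 'I_n.-1),
    Y v i = (v == i.+1 :> nat)%:R - (v == 0 :> nat)%:R) ->
  exists2 A, perm_mx s *m Y = Y *m A & \det A = (-1) ^+ s.
Proof.
case: n s Y => // p s Y _ YE; have [A AE dA] := perm_based_boundary s.
have -> : Y = based_boundary p by apply/matrixP => v i; rewrite YE based_boundaryE.
by exists A.
Qed.

(** * Chains and orientations under isomorphisms *)

Section OrientationTransport.

Lemma cycle_basis_mulmx n m (G : graph n m) (C : 'M[int]_(m, loop_number G)) k
    (Y : 'M[int]_(m, k)) :
  cycle_basis C -> boundary G *m Y = 0 -> exists W, Y = C *m W.
Proof.
move=> [_ hC] GY.
have /choice[z zE] : forall j, exists z, col j Y = C *m z.
  move=> j; have [|z [zE _]] := hC (col j Y); last by exists z.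
  by rewrite colE mulmxA GY mul0mx.
exists (\matrix_(i, j) z j i 0); apply/matrixP => i j.
have /colP/(_ i) := zE j; rewrite !mxE => ->; apply: eq_bigr => a _.
by rewrite mxE.
Qed.

(** Counting half-edges. The consequences used are n <= m, which makes the natural subtractions
    exact, m >= 2 and a positive loop number. *)
Lemma admissible_card n m (G : graph n m) : admissible G ->
  (0 < n)%N /\ (3 * n <= 2 * m)%N.
Proof.
move=> /andP[/andP[n0 _] /forallP val3]; split=> //.
have -> : (2 * m)%N = (\sum_v valency G v)%N.
  transitivity #|{: 'I_m * bool}|; first by rewrite card_prod card_ord card_bool mulnC.
  rewrite -sum1_card (partition_big G xpredT) //=.
  by apply: eq_bigr => v _; rewrite /valency -sum1_card.
rewrite mulnC -[n in leqLHS]card_ord -sum_nat_const.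
by apply: leq_sum => v _; exact: val3.
Qed.

Variables (n m : nat) (G G' : graph n m) (f : graph_iso G G').

Let flip e : bool := (iso_half f (e, false)).2.

(** The induced map on 1-chains: a reversed edge goes to minus its image. *)
Definition iso_mx : 'M[int]_m :=
  \matrix_(a, e) ((-1) ^+ flip e *+ (a == iso_edge f e)).

(** The two halves of e go to different halves of one edge, so the image of one determines that of
    the other. *)
Let iso_halfE e b : iso_half f (e, b) = (iso_edge f e, b (+) flip e).
Proof.
have h1 b' : (iso_half f (e, b')).1 = iso_edge f e by rewrite iso_half_edge.
rewrite [LHS]surjective_pairing h1; congr pair; case: b => //=.
have : iso_half f (e, true) != iso_half f (e, false).
  by rewrite (inj_eq (@perm_inj _ _)) xpair_eqE andbF.
rewrite /flip; case: (iso_half f (e, true)) (h1 true) => a b /= ->.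
case: (iso_half f (e, false)) (h1 false) => a' b' /= ->.
by rewrite xpair_eqE eqxx; case: b; case: b'.
Qed.

(** By the row convention of [perm_mx], the matrix that sends each vertex to its image is that of
    the inverse permutation. *)
Lemma boundary_iso :
  boundary G' *m iso_mx = perm_mx (iso_vertex f)^-1 *m boundary G.
Proof.
apply/matrixP => v e; rewrite mxE (bigD1 (iso_edge f e)) //= big1 => [|a ae].
  rewrite !mxE eqxx mulr1n addr0 (bigD1 ((iso_vertex f)^-1%g v)) //=.
  rewrite big1 => [|u uv]; last by rewrite !mxE eq_sym (negbTE uv) mul0r.
  rewrite !mxE eqxx mul1r addr0.
  have h b : (G (e, b) == (iso_vertex f)^-1%g v) = (G' (iso_edge f e, b (+) flip e) == v).
    by rewrite -iso_halfE iso_incidence -(inj_eq (@perm_inj _ (iso_vertex f))) permKV.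
  by rewrite !h; case: (flip e) => /=; ring.
by rewrite !mxE (negbTE ae) mulr0n mulr0.
Qed.

Lemma det_iso_mx : \det iso_mx =
  (-1) ^+ (odd_perm (iso_edge f) (+) odd #|[pred e | flip e]|).
Proof.
have -> : iso_mx = perm_mx (iso_edge f)^-1 *m diag_mx (\row_e (-1) ^+ flip e).
  apply/matrixP => a e; rewrite mul_mx_diag !mxE mulr_natl.
  by rewrite (can2_eq (permKV _) (permK _)).
rewrite det_mulmx det_perm odd_permV det_diag signr_addb signr_odd.
congr (_ * _); rewrite -sum1_card expr_sum (bigID flip) /= [X in _ * X]big1 => [|e fe].
  by rewrite mulr1; apply: eq_bigr => e fe; rewrite mxE fe.
by rewrite mxE (negbTE fe).
Qed.

Lemma orients_transport s s' C C' : admissible G ->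
  @orients n m G s C -> @orients n m G' s' C' ->
  exists2 U, iso_mx *m C = C' *m U &
    \det U = (-1) ^+ (odd_perm (iso_edge f) (+) iso_sign f (+) s (+) s').
Proof.
move=> /admissible_card[n0 nm] [[GC hC] [P GP dP]] [hC' [P' GP' dP']].
have Elp : (loop_number G + n.-1)%N = m by rewrite /loop_number; lia.
have GQ k (Y : 'M[int]_(m, k)) : boundary G' *m (iso_mx *m Y) =
    perm_mx (iso_vertex f)^-1 *m (boundary G *m Y).
  by rewrite !mulmxA boundary_iso.
have [U UE] : exists U, iso_mx *m C = C' *m U.
  by apply: (cycle_basis_mulmx hC'); rewrite GQ GC mulmx0.
exists U => //.
have PP' : boundary G' *m P' = boundary G *m P.
  by apply/matrixP => v i; rewrite GP GP'.
have [A AE dA] := perm_based_paths (iso_vertex f)^-1 n0 GP.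
(* The transported paths and P' A have the same boundary, so they differ by cycles. *)
have [W WE] : exists W, iso_mx *m P - P' *m A = C' *m W.
  by apply: (cycle_basis_mulmx hC'); rewrite mulmxBr GQ (mulmxA (boundary G')) PP' AE subrr.
have QP : iso_mx *m P = C' *m W + P' *m A by rewrite -WE subrK.
have detE t (D : int) : (-1) ^+ nat_of_bool t * D = 1 -> D = (-1) ^+ nat_of_bool t.
  by move/(congr1 ( *%R ((-1) ^+ t))); rewrite signrMK mulr1.
have := cycles_paths_det_block Elp UE QP; rewrite /cycles_paths_det.
rewrite (detE _ _ dP) (detE _ _ dP') det_iso_mx dA odd_permV /iso_sign -/flip.
move: (\det U) (odd_perm (iso_vertex f)) (odd_perm (iso_edge f)) (odd _) => D a b c.
move: s s' {dP dP'} => s s'.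
by case: s; case: s'; case: a; case: b; case: c; rewrite /= ?expr1 ?expr0; lia.
Qed.

End OrientationTransport.

Section Density.
Variables (R : realType) (n m : nat) (G : graph n m).
Implicit Types (C : 'M[int]_(m, loop_number G)) (w : canonical_poly R).

Lemma integrand_formE C w x :
  integrand_form C w x = eta w x (map_mx intr C).
Proof.
have XE : Lambda C x = gram x (map_mx intr C) by [].
have dXE : Lambda C (\row_i dx R i) = gram_form (dx_row R m) (map_mx intr C).
  rewrite /Lambda /gram_form; have -> : map_mx (intr : int -> ext R m) C =
    map_mx (in_alg (ext R m)) (map_mx intr C).
    by apply/matrixP => i j; rewrite !mxE; exact/esym/(rmorph_int (in_alg (ext R m))).
  by [].
exact: (f_equal2 (canonical_form w) XE dXE).
Qed.

Lemma densityE C w t :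
  density C w t = (-1) ^+ m.-1 * eta w (chart t) (map_mx intr C) (chart_set m).
Proof. by rewrite /density integrand_formE. Qed.

Lemma integral_density d C w : homogeneous d w -> (d + loop_number G).+1 = m ->
  (1 < m)%N -> full_rank (map_mx intr C : 'M[R]_(m, _)) ->
  absolutely_convergent C w /\
  canonical_integral C w d = ((- (2 * pi)) ^+ (loop_number G)./2)^-1 *
    ((-1) ^+ m.-1 * eta_integral w (map_mx intr C)).
Proof.
move=> hw dm m1 hC; have intC := eta_chart_integrable hw dm m1 hC.
have mQ := @measurable_orthant R m.-1.
split.
  rewrite /absolutely_convergent.
  have -> : EFin \o density C w = fun t => (((-1) ^+ m.-1)%:E *
      (eta w (chart t) (map_mx intr C) (chart_set m))%:E)%E.
    by apply/funext => t; rewrite -EFinM -densityE.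
  exact: integrableZl.
rewrite /canonical_integral ifT; last by rewrite -[X in X.-1]dm.
apply: (congr1 ( *%R _)); apply: etrans (RintegralZl _ mQ intC).
by apply: eq_Rintegral => t _; rewrite densityE.
Qed.

End Density.

Section OrientationExistence.
Variables (n m : nat) (G G' : graph n m) (f : graph_iso G G').

Lemma iso_mx_mulT : iso_mx f *m (iso_mx f)^T = 1%:M.
Proof.
apply/matrixP => a b; rewrite !mxE (bigD1 ((iso_edge f)^-1%g a)) //= !mxE permKV eqxx.
rewrite big1 ?addr0 => [|e ea]; last first.
  rewrite !mxE (_ : (a == _) = false) ?mulr0n ?mul0r //.
  by apply: contraNF ea => /eqP ->; rewrite permK.
rewrite mulr1n eq_sym; case: eqP => _; rewrite ?mulr0n ?mulr0 //.
by rewrite mulr1n -expr2 sqrr_sign.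
Qed.

Lemma iso_mx_row k (Y : 'M[int]_(m, k)) i j :
  (iso_mx f *m Y) (iso_edge f i) j = (-1) ^+ (iso_half f (i, false)).2 * Y i j.
Proof.
rewrite mxE (bigD1 i) //= mxE eqxx mulr1n big1 ?addr0 // => e ei.
by rewrite mxE (inj_eq (@perm_inj _ _)) eq_sym (negbTE ei) mul0r.
Qed.

Lemma orients_iso s s' C : admissible G -> @orients n m G s C ->
  exists C', @orients n m G' s' C'.
Proof.
move=> /admissible_card[n0 nm] [[GC hC] [P GP dP]].
have Elp : (loop_number G + n.-1)%N = m by rewrite /loop_number; lia.
have l0 : (0 < loop_number G)%N by rewrite /loop_number; lia.
set Q := iso_mx f.
have QQ : Q *m Q^T = 1%:M := iso_mx_mulT.
have QQ' : Q^T *m Q = 1%:M := mulmx1C QQ.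
have GQ k (Y : 'M[int]_(m, k)) : boundary G' *m (Q *m Y) =
    perm_mx (iso_vertex f)^-1 *m (boundary G *m Y).
  by rewrite !mulmxA boundary_iso.
have [A AE dA] := perm_based_paths (iso_vertex f)^-1 n0 GP.
have uA : A \in unitmx by rewrite unitmxE dA unitrX // unitrN1.
(* The sign still missing after the transport of cycles and paths. Negating one cycle, which exists
   since the loop number is positive, supplies it, so either sign s' can be reached. *)
pose b := s' (+) s (+) odd_perm (iso_edge f) (+)
  odd #|[pred e : 'I_m | (iso_half f (e, false)).2]| (+) odd_perm (iso_vertex f).
pose D : 'M[int]_(loop_number G) :=
  diag_mx (\row_i (if i == Ordinal l0 then (-1) ^+ b else 1)).
have dD : \det D = (-1) ^+ b.
  rewrite det_diag (bigD1 (Ordinal l0)) //= mxE eqxx big1 ?mulr1 // => i ni.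
  by rewrite mxE (negbTE ni).
have DD : D *m D = 1%:M.
  rewrite mulmx_diag -diag_const_mx; congr diag_mx; apply/rowP => i; rewrite !mxE.
  by case: ifP; rewrite ?mulr1 // -expr2 sqrr_sign.
have QC : Q *m C = Q *m C *m D *m D by rewrite -mulmxA DD mulmx1.
have QP : Q *m P = Q *m C *m D *m 0 + Q *m P *m invmx A *m A.
  by rewrite mulmx0 add0r mulmxKV.
exists (Q *m C *m D); split; last first.
  exists (Q *m P *m invmx A).
    move=> v i; rewrite -(mulmxA Q) GQ (mulmxA (boundary G)) mulmxA AE -(mulmxA _ A) mulmxV //.
    rewrite mulmx1.
    exact: GP.
  have := cycles_paths_det_block Elp QC QP; rewrite /cycles_paths_det.
  have -> : \det (conform_mx (0 : 'M[int]_m) (row_mx C P)) = (-1) ^+ s.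
    by rewrite -[LHS](signrMK s) dP mulr1.
  rewrite det_iso_mx dA odd_permV dD /b.
  move: (\det _) (odd_perm (iso_vertex f)) (odd_perm (iso_edge f)) (odd _) => x c e g.
  move: s s' {b D dD DD QC QP dP} => s s'.
  by case: s; case: s'; case: c; case: e; case: g; rewrite /= ?expr1 ?expr0; lia.
split; first by rewrite -(mulmxA Q) GQ (mulmxA (boundary G)) GC mul0mx mulmx0.
move=> c Gc; have GQc : boundary G *m (Q^T *m c) = 0.
  apply: (can_inj (mulKmx (unitmx_perm _ (iso_vertex f)^-1))).
  by rewrite -GQ !mulmxA -(mulmxA _ Q) QQ mulmx1 Gc mulmx0.
have [z [zE zuniq]] := hC _ GQc; exists (D *m z); split.
  by rewrite -!mulmxA (mulmxA D) DD mul1mx -zE mulmxA QQ mul1mx.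
move=> y cE; rewrite (zuniq (D *m y)) ?mulmxA ?DD ?mul1mx //.
by rewrite cE !mulmxA QQ' mul1mx.
Qed.

End OrientationExistence.

Definition graph_iso_refl n m (G : graph n m) : graph_iso G G.
Proof. by exists 1%g 1%g 1%g => h; rewrite !perm1. Defined.

Lemma iso_sign_refl n m (G : graph n m) : iso_sign (graph_iso_refl G) = false.
Proof.
rewrite /iso_sign /= odd_perm1 eq_card0 // => e.
by rewrite !inE perm1.
Qed.

Definition graph_iso_sym n m (G G' : graph n m) (f : graph_iso G G') : graph_iso G' G.
Proof.
exists (iso_vertex f)^-1%g (iso_edge f)^-1%g (iso_half f)^-1%g => h.
  by rewrite -{2}[h](permKV (iso_half f)) iso_half_edge permK.
by rewrite -{2}[h](permKV (iso_half f)) iso_incidence permK.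
Defined.

Lemma orients_full_rank (R : realType) n m (G : graph n m) s C :
  admissible G -> @orients n m G s C ->
  full_rank (map_mx intr C : 'M[R]_(m, loop_number G)).
Proof.
move=> /admissible_card[n0 nm] [_ [P GP dP]].
apply: (@full_rank_cycles _ n.-1 _ _ R C P); first by rewrite /loop_number; lia.
by apply: contra_eq_neq dP; rewrite /cycles_paths_det => ->; rewrite mulr0 eq_sym oner_eq0.
Qed.

Lemma canonical_integral_iso (R : realType) d (w : canonical_poly R) n m
    (G G' : graph n m) (f : graph_iso G G') s s'
    (C : 'M[int]_(m, loop_number G)) (C' : 'M[int]_(m, loop_number G')) :
  homogeneous d w -> admissible G -> admissible G' ->
  orients s C -> orients s' C' ->
  canonical_integral C' w d =
  (-1) ^+ (iso_sign f (+) s (+) s') * canonical_integral C w d.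
Proof.
move=> hw aG aG' oC oC'; have [dl|dl] := eqVneq (d + loop_number G)%N m.-1; last first.
  have dl' : ((d + loop_number G')%N == m.-1) = false := negbTE dl.
  by rewrite /canonical_integral dl' mulr0.
have [n0 nm] := admissible_card aG.
have m1 : (1 < m)%N by lia.
have dm : (d + loop_number G).+1 = m by lia.
have hC := orients_full_rank R aG oC; have hC' := orients_full_rank R aG' oC'.
have [_ ->] := integral_density hw dm m1 hC.
have [_ ->] := integral_density hw (dm : (d + loop_number G').+1 = m) m1 hC'.
rewrite [RHS]mulrCA; apply: (congr1 ( *%R _)).
rewrite [RHS]mulrCA; apply: (congr1 ( *%R _)).
have [U UE dU] := orients_transport f aG oC oC'.
set b := iso_sign f (+) s (+) s'.
have dU' : \det (map_mx intr U : 'M[R]_(loop_number G)) = (-1) ^+ (iso_edge f (+) b).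
  by rewrite det_map_mx dU rmorph_sign /b !addbA.
have uU : (map_mx intr U : 'M[R]_(loop_number G)) \in unitmx.
  by rewrite unitmxE dU' unitrX // unitrN1.
(* The integral for [iso_mx f *m C] = C' U is computed twice: as a change of cycle basis and as a
   signed permutation of the edges. The sign of the edge permutation occurs in both and cancels. *)
have e1 := eta_integral_mulmx hw dm m1 hC' uU.
pose ep i : R := (-1) ^+ (iso_half f (i, false)).2.
have e2 : eta_integral w (map_mx intr C' *m map_mx intr U : 'M[R]_(m, _)) =
    (-1) ^+ iso_edge f * eta_integral w (map_mx intr C : 'M[R]_(m, _)).
  apply: (eta_integral_signed_perm (ep := ep) hw dm m1 hC) => [i|i j].
    exact: sqrr_sign.
  rewrite -map_mxM -UE [LHS]mxE iso_mx_row rmorphM rmorph_sign.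
  by rewrite [map_mx _ _ _ _]mxE.
have := etrans (esym e1) e2; rewrite dU' sgrX sgrN1 signr_addb.
move: (eta_integral w _) (eta_integral w _) => x y /(congr1 ( *%R ((-1) ^+ iso_edge f))).
by rewrite -mulrA !signrMK => <-; rewrite signrMK.
Qed.

From mathcomp Require Import freeg.

(** * Linear extension to the graph complex *)

Section FreegEval.
Variables (K : choiceType) (F : numFieldType) (f : K -> F).
Implicit Types x y : {freeg K / rat}.

Definition freeg_eval x : F := \sum_(z <- dom x) ratr (coeff z x) * f z.

(** Allows two elements and their combination to be summed over one common list containing all
    supports. *)
Lemma freeg_eval_seq x (s : seq K) : uniq s -> {subset dom x <= s} ->
  freeg_eval x = \sum_(z <- s) ratr (coeff z x) * f z.
Proof.
move=> us xs; rewrite [RHS](bigID (mem (dom x))) /= [X in _ = _ + X]big1 => [|z zx].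
  rewrite addr0 -big_filter; apply: perm_big; apply: uniq_perm.
  - exact: uniq_dom.
  - exact: filter_uniq.
  by move=> z; rewrite mem_filter; apply/idP/andP => [zx|[]//]; split=> //; exact: xs.
by rewrite coeff_outdom // rmorph0 mul0r.
Qed.

Lemma freeg_eval_linear a x y :
  freeg_eval (a *: x + y) = ratr a * freeg_eval x + freeg_eval y.
Proof.
pose s := undup (dom x ++ dom y).
have us : uniq s := undup_uniq _.
have xs : {subset dom x <= s} by move=> z zx; rewrite mem_undup mem_cat zx.
have ys : {subset dom y <= s} by move=> z zy; rewrite mem_undup mem_cat zy orbT.
rewrite (freeg_eval_seq us xs) (freeg_eval_seq us ys) (@freeg_eval_seq _ s) //.
  rewrite mulr_sumr -big_split; apply: eq_bigr => z _ /=.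
  by rewrite coeffD coeffZ rmorphD rmorphM mulrDl mulrA.
move=> z /domD_subset; rewrite mem_cat => /orP[/domZ_subset/xs|/ys] //.
Qed.

Lemma freeg_eval1 z : freeg_eval (Freeg [:: (1, z)]) = f z.
Proof. by rewrite /freeg_eval domU1 big_seq1 coeffU eqxx mulr1 rmorph1 mul1r. Qed.

End FreegEval.

Section GraphIntegral.
Variables (R : realType) (d : nat) (w : canonical_poly R).
Hypothesis hw : homogeneous d w.

(* The default value 0 is never taken, since every graph in GC_3 is oriented by
   some C; proving this is avoided, because the existence of C is invariant
   under isomorphisms and sign changes (orients_iso). *)
Definition graph_integral (G : oriented_graph) : R :=
  if pselect (exists C : 'M[int]_(nedges G, loop_number (underlying G)),
    orients (orientation_sign G) C) is left h
  then canonical_integral (projT1 (cid h)) w d else 0.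

Lemma graph_integral_iso n m (G G' : graph n m) (aG : admissible G)
    (aG' : admissible G') (f : graph_iso G G') s s' :
  graph_integral (OrientedGraph s' aG') =
  (-1) ^+ (iso_sign f (+) s (+) s') * graph_integral (OrientedGraph s aG).
Proof.
rewrite /graph_integral /=; case: pselect => [h|nC]; case: pselect => [h'|nC'].
- exact: (canonical_integral_iso f hw aG aG' (projT2 (cid h')) (projT2 (cid h))).
- by case: h => C hC; case: nC'; exact: (orients_iso (graph_iso_sym f) s aG' hC).
- by case: h' => C hC; case: nC; exact: (orients_iso f s' aG hC).
by rewrite mulr0.
Qed.

(** Two bases that orient G with the same sign are compared through the identity isomorphism, so the
    chosen one is immaterial. *)
Lemma graph_integralE (G : oriented_graph)
    (C : 'M[int]_(nedges G, loop_number (underlying G))) :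
  orients (orientation_sign G) C -> graph_integral G = canonical_integral C w d.
Proof.
case: G C => n m G s aG /= C hC; rewrite /graph_integral /=.
case: pselect => [h|nC]; last by case: nC; exists C.
have := canonical_integral_iso (graph_iso_refl G) hw aG aG hC (projT2 (cid h)).
by rewrite iso_sign_refl addFb addbb mul1r.
Qed.

Definition free_integral (x : free_graphs) : R := freeg_eval graph_integral x.

Lemma free_integral_linear a (x y : free_graphs) :
  free_integral (a *: x + y) = ratr a * free_integral x + free_integral y.
Proof. exact: freeg_eval_linear. Qed.

Lemma free_integral0 : free_integral 0 = 0.
Proof.
by have := free_integral_linear (-1) 0 0; rewrite scaler0 addr0 rmorphN1 mulN1r addNr.
Qed.

Lemma free_integral_class G : free_integral (free_class G) = graph_integral G.
Proof. exact: freeg_eval1. Qed.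

Lemma free_integral_relator x : graph_relator x -> free_integral x = 0.
Proof.
case=> [n m G G' aG aG' f s|n m G aG s].
  rewrite addrC -scaleN1r free_integral_linear !free_integral_class.
  rewrite (graph_integral_iso aG aG' f s) addbC addbA addbK addbb mul1r.
  by rewrite rmorphN1 mulN1r addNr.
(* Reversing the orientation is the identity isomorphism read between opposite signs. *)
rewrite -[free_class _]scale1r free_integral_linear !free_integral_class.
rewrite (graph_integral_iso aG aG (graph_iso_refl G) s) iso_sign_refl.
by rewrite addFb addbN addbb rmorph1 mul1r expr1 mulN1r addNr.
Qed.

Lemma free_integral_relations x : x \in relations -> free_integral x = 0.
Proof.
move=> /asboolP[t ht ->]; elim: t ht => [|r t IH] ht; first by rewrite big_nil free_integral0.
rewrite big_cons free_integral_linear free_integral_relator ?mulr0 ?add0r.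
  by apply: IH => r' r't; apply: ht; rewrite inE r't orbT.
by apply: ht; rewrite mem_head.
Qed.

Definition GC3_integral (x : GC3) : R := free_integral (repr x).

Lemma GC3_integral_proj x : GC3_integral (GC3_proj x) = free_integral x.
Proof.
have /free_integral_relations : x - repr (GC3_proj x) \in relations.
  by rewrite (Quotient.idealrBE relations) /GC3_proj reprK.
rewrite addrC -scaleN1r free_integral_linear rmorphN1 mulN1r addrC => /eqP.
by rewrite subr_eq0 => /eqP ->.
Qed.

Lemma GC3_integral_linear : linear_for (ratr \; *%R) GC3_integral.
Proof.
move=> a x y; have [x' ->] := GC3_projP x; have [y' ->] := GC3_projP y.
rewrite -[a *: _]/(GC3_scale a _) GC3_projZ -GC3_projD !GC3_integral_proj.
exact: free_integral_linear.
Qed.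

End GraphIntegral.

Theorem theorem1p3 (R : realType) (d : nat) (w : canonical_poly R)
    (hw : homogeneous d w) :
  (forall (G : oriented_graph)
      (C : 'M[int]_(nedges G, loop_number (underlying G))),
    orients (orientation_sign G) C ->
    (d + loop_number (underlying G) = (nedges G).-1)%N ->
    absolutely_convergent C w) /\
  (exists I : {linear GC3 -> R | ratr \; *%R},
    forall (G : oriented_graph)
      (C : 'M[int]_(nedges G, loop_number (underlying G))),
    orients (orientation_sign G) C ->
    I (GC3_class G) = canonical_integral C w d).
Proof.
split=> [[n m G s aG] /= C oC dl|].
  have [n0 nm] := admissible_card aG.
  have m1 : (1 < m)%N by lia.
  have dm : (d + loop_number G).+1 = m by lia.
  by have [] := integral_density hw dm m1 (orients_full_rank R aG oC).
pose isLin := GRing.isLinear.Build rat GC3 R (ratr \; *%R)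
  (GC3_integral d w) (GC3_integral_linear hw).
pose I : {linear GC3 -> R | ratr \; *%R} := HB.pack (GC3_integral d w) isLin.
exists I => G C oC.
apply: etrans (GC3_integral_proj hw (free_class G)) _.
by rewrite free_integral_class (graph_integralE hw oC).
Qed.
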